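(* Let $n\ge2$ be an integer and suppose the counts $c_0,\dots,c_n$ are all non-zero and log-concave. If $\beta_{\min}\le\log\frac{c_0}{c_1}$ and $\beta_{\max}\ge\log\frac{c_{n-1}}{c_n}$, then $q\le O(n\Gamma)$ where $\Gamma:=\max\{\beta_{\max},\log\frac{c_1}{c_0},1\}$. Furthermore, with probability at least $1-\gamma$ we can obtain $\varepsilon$-estimates of all values $\pi(x)$, $x\in\{0,\dots,n\}$, at cost $$O\Bigl(\min\Bigl\{\frac{n\Gamma\log n\log\frac1\gamma}{\varepsilon^2},\ \frac{n^2\log\frac1\gamma}{\varepsilon^2}+n\log\Gamma\Bigr\}\Bigr).$$
   Context: The counts $c_0,\dots,c_n>0$ are log-concave if $c_k^2\ge c_{k-1}c_{k+1}$ for $k=1,\dots,n-1$. Let $Z(\beta)=\sum_{x=0}^nc_xe^{\beta x}$, $\mu_\beta(x)=c_xe^{\beta x}/Z(\beta)$, $q=\log(Z(\beta_{\max})/Z(\beta_{\min}))$, $\pi(x)=\mu_{\beta_{\min}}(x)$. The algorithm accesses the counts only via an oracle which, on query $\beta\in[\beta_{\min},\beta_{\max}]$, returns an independent sample from $\mu_\beta$; cost is the expected number of oracle calls. A positive number $a$ is an $\varepsilon$-estimate of a positive number $b$ if $|\log a-\log b|\le\varepsilon$. $\varepsilon,\gamma\in(0,1)$; $O(\cdot)$ constants are absolute. *)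

(* Defs.v *)
From HB Require Import structures.
From mathcomp Require Import all_boot all_order all_algebra.
From mathcomp Require Import boolp classical_sets reals ereal sequences exp.

Set Implicit Arguments.
Unset Strict Implicit.
Unset Printing Implicit Defensive.

Import Order.TTheory GRing.Theory Num.Theory.
Local Open Scope classical_set_scope.
Local Open Scope ring_scope.

Section Gibbs.
Context {R : realType} (n : nat) (c : nat -> R).

(* Counts are given as [c : nat -> R]; only c 0, ..., c n are ever used. *)
Definition positive_counts : Prop := forall k, (k <= n)%N -> 0 < c k.

Definition log_concave : Prop :=
  forall k, (1 <= k <= n.-1)%N -> c k.-1 * c k.+1 <= c k ^+ 2.

Definition partition_fun (beta : R) : R :=
  \sum_(x < n.+1) c x * expR (beta * x%:R).

Definition gibbs (beta : R) (x : 'I_n.+1) : R :=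
  c x * expR (beta * x%:R) / partition_fun beta.

Definition log_ratio (bmin bmax : R) : R :=
  ln (partition_fun bmax / partition_fun bmin).

Definition Gamma (bmax : R) : R :=
  Num.max (Num.max bmax (ln (c 1%N / c 0%N))) 1.

End Gibbs.

Definition is_estimate {R : realType} (eps a b : R) : Prop :=
  [/\ 0 < a, 0 < b & `|ln a - ln b| <= eps].

(* One move of a randomized algorithm with states [S] and outputs [O], whose
   oracle answers in 'I_N: query the oracle at [beta] and continue with the
   answer, draw private randomness from a finite distribution [p], or stop. *)
Inductive action (R : realType) (N : nat) (O S : Type) : Type :=
| Query (beta : R) (next : 'I_N -> S)
| Draw (m : nat) (p : 'I_m -> R) (next : 'I_m -> S)
| Stop (out : O).

Arguments Query {R N O S} beta next.
Arguments Draw {R N O S} m p next.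
Arguments Stop {R N O S} out.

(* States are arbitrary, so they can record the whole history: the next query
   may depend on all earlier answers and draws.  Runs need not be bounded in
   length, nor even terminate. *)
Record algorithm (R : realType) (N : nat) (O : Type) := Algorithm {
  state : Type;
  start : state;
  step : state -> action R N O state }.

Section Execution.
Context {R : realType} {N : nat} {O : Type}.
Variable A : algorithm R N O.

Definition legal (bmin bmax : R) : Prop := forall s : state A,
  match step s return Prop with
  | Query beta _ => bmin <= beta <= bmax
  | Draw m p _ => (forall i, 0 <= p i) /\ \sum_(i < m) p i = 1
  | Stop _ => True
  end.

(* [mu beta] is the law of the oracle's answer to the query [beta]. *)
Variable mu : R -> 'I_N -> R.

(* Probability that, from [s], the algorithm makes a [Stop] move among its first [t] moves,
   with an output satisfying [good]. *)
Fixpoint prob_within (good : O -> Prop) (t : nat) (s : state A) : R :=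
  if t is t'.+1 then
    match step s with
    | Query beta next =>
        \sum_(x < N) mu beta x * prob_within good t' (next x)
    | Draw m p next => \sum_(i < m) p i * prob_within good t' (next i)
    | Stop out => if `[< good out >] then 1 else 0
    end
  else 0.

(* Expected number of oracle calls among the first [t] moves from [s]. *)
Fixpoint calls_within (t : nat) (s : state A) : R :=
  if t is t'.+1 then
    match step s with
    | Query beta next => 1 + \sum_(x < N) mu beta x * calls_within t' (next x)
    | Draw m p next => \sum_(i < m) p i * calls_within t' (next i)
    | Stop _ => 0
    end
  else 0.

(* Both quantities above are nondecreasing in [t], so the suprema below are
   their limits; by monotone convergence the second is the expected total
   number of oracle calls, possibly +oo. *)
Definition output_prob (good : O -> Prop) : \bar R :=
  ereal_sup (range (fun t => (prob_within good t (start A))%:E)).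

Definition expected_calls : \bar R :=
  ereal_sup (range (fun t => (calls_within t (start A))%:E)).

End Execution.

(* Main.v *)
Require Import Defs.
From mathcomp Require Import all_boot all_order all_algebra.
From mathcomp Require Import boolp classical_sets reals ereal sequences exp.
From mathcomp Require Import ring lra zify.
Import Order.TTheory GRing.Theory Num.Theory.
Local Open Scope ring_scope.

(* Put b_k = ln (c_(k-1) / c_k), a nondecreasing sequence in [-Gamma, Gamma].
   The first claim follows from c_x <= c_0 e^(x Gamma).

   For the second, write P_b for the Gibbs law at b.  A schedule is a sequence
   bmin = b_0 < b_1 < ... with cuts z_0 < z_1 < ... such that z_i is near the
   median of P_(b_i) and P_(b_(i+1)) (X <= z_i) is near 1/4.  Consecutive laws
   are then at a constant distance, so their symmetrized relative entropy
   (b_(i+1) - b_i) (E_(i+1) X - E_i X) is bounded below; summing by AM-GM, the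
   length T of the schedule is O(sqrt (n Gamma)), and it is at most n since the
   cuts increase.  With D = b_(i+1) - b_i,
     Z(b_(i+1)) e^(- D z_i) / Z(b_i)
       = E_i [min 1 e^(D (X - z_i))] / E_(i+1) [min 1 e^(- D (X - z_i))]
   is a ratio of means of [0, 1]-valued variables that are bounded below, so
   O(T / eps^2) samples per point control all the partial products at once, by
   the L^2 maximal inequality.  By log-concavity P_(b_i) has mass of order
   1 / (z_i - z_(i-1)) at each point of the block ]z_(i-1), z_i], so histograms
   over all blocks take O(n log n / eps^2) samples.  Medians over O(log 1/gamma)
   repetitions bring the cost to O((T^2 + n log n) log (1/gamma) / eps^2).

   Each b_(i+1) is found by a noisy binary search.  On a grid of step 1 a single
   sample per step suffices: a test at distance t from the transition errs with
   probability at most e^(-t) and no grid point is tested twice, so the errors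
   sum up to a small constant; starting with doubling steps keeps the expected
   cost O(log Gamma).  The result is refined on a grid of step 1/(32 n) by
   majority votes, and then verified, which makes it reliable at the price of a
   constant expected number of retries. *)

Set Implicit Arguments.
Unset Strict Implicit.

(** * Sampling programs *)

(** The algorithm is fixed before the counts, so it cannot use [Gamma], which depends on them. Hence
    the doubling steps of the search, and overlap samples whose number is read off the length of the
    schedule actually found. One program obeys both bounds of the minimum: [main_cost_bound] is
    applied to it with T = n and with T = 34 sqrt (n Gamma).

    A single search fails with constant probability. Fresh samples alone decide whether its result
    is kept, so a failed search costs a retry and only the error of those samples is charged to the
    schedule. The schedule is built once, with failure probability at most g/2, and only the
    estimation along it is repeated. Even a bad schedule has at most n points, because the cuts
    increase on every run. The verification sample is large enough for an error of order g / n^8, so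
    the n^2 cost of a bad schedule hardly changes the expectation. *)

Ltac nlia := repeat match goal with
  | H : is_true (Order.le _ _) |- _ => clear H
  | H : is_true (Order.lt _ _) |- _ => clear H
  | H : is_true (Order.le _ _) \/ _ |- _ => clear H
  | H : is_true (Order.le _ _) /\ _ |- _ => clear H
  | H : is_true (_ && _) |- _ =>
      match type of H with context [Order.le] => clear H end
  end; lia.

(** Well-founded trees: every run halts, so [expect] and [cost] are finite sums by structural
    recursion, and no limit is taken before compilation. Answers are typed [nat], so a program
    mentions neither the range nor the law of the oracle. *)
Inductive prog (R : realType) (T : Type) : Type :=
| Ret (t : T)
| Ask (b : R) (next : nat -> prog R T).
Arguments Ret {R T} t.
Arguments Ask {R T} b next.

Fixpoint bind (R : realType) S T (p : prog R S) (f : S -> prog R T) : prog R T :=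
  match p with
  | Ret t => f t
  | Ask b k => Ask b (fun x => bind (k x) f)
  end.

Fixpoint rep (R : realType) T (p : prog R T) (m : nat) : prog R (seq T) :=
  if m is m'.+1 then bind p (fun x => bind (rep p m') (fun s => Ret (x :: s)))
  else Ret [::].

Definition sample (R : realType) (b : R) : prog R nat := Ask b Ret.

Section Semantics.
Context {R : realType} (N : nat) (mu : R -> 'I_N -> R).
Hypothesis mu0 : forall b x, 0 <= mu b x.
Hypothesis mu1 : forall b, \sum_(x < N) mu b x = 1.

(** Independent of the law; it carries deterministic facts such as sample sizes, ranges of points
    and increasing cuts. *)
Fixpoint always T (p : prog R T) (Q : T -> Prop) : Prop :=
  match p with
  | Ret t => Q t
  | Ask _ k => forall x, (x < N)%N -> always (k x) Q
  end.

Fixpoint expect T (p : prog R T) (f : T -> R) : R :=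
  match p with
  | Ret t => f t
  | Ask b k => \sum_(x < N) mu b x * expect (k x) f
  end.

Fixpoint cost T (p : prog R T) : R :=
  match p with
  | Ret _ => 0
  | Ask b k => 1 + \sum_(x < N) mu b x * cost (k x)
  end.

Definition fail T (p : prog R T) (Q : T -> Prop) : R :=
  expect p (fun t => if `[< Q t >] then 0 else 1).

Lemma always_bind S T (p : prog R S) (f : S -> prog R T) P Q :
  always p P -> (forall t, P t -> always (f t) Q) -> always (bind p f) Q.
Proof. by move=> + H; elim: p => [t|b k IH] /= HP; [exact: H | move=> x xN; apply: IH; exact: HP]. Qed.

Lemma always_true T (p : prog R T) : always p (fun=> True).
Proof. by elim: p => //= b k IH x _. Qed.

Lemma expect_bind S T (p : prog R S) (f : S -> prog R T) g :
  expect (bind p f) g = expect p (fun t => expect (f t) g).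
Proof. by elim: p => //= b k IH; apply: eq_bigr => x _; rewrite IH. Qed.

Lemma cost_bind S T (p : prog R S) (f : S -> prog R T) :
  cost (bind p f) = cost p + expect p (fun t => cost (f t)).
Proof.
elim: p => [t|b k IH] /=; first by rewrite add0r.
by rewrite -addrA -big_split /=; congr (_ + _); apply: eq_bigr => x _; rewrite IH mulrDr.
Qed.

Lemma expect_le_always T (p : prog R T) P f g :
  always p P -> (forall t, P t -> f t <= g t) -> expect p f <= expect p g.
Proof.
move=> + H; elim: p => [t|b k IH] /= HP; first exact: H.
by apply: ler_sum => x _; apply: ler_wpM2l => //; apply: IH; apply: HP.
Qed.

Lemma expect_le T (p : prog R T) f g : (forall t, f t <= g t) -> expect p f <= expect p g.
Proof. by move=> H; apply: (expect_le_always (always_true p)). Qed.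

Lemma expect_ext T (p : prog R T) f g : (forall t, f t = g t) -> expect p f = expect p g.
Proof. by move=> H; elim: p => //= b k IH; apply: eq_bigr => x _; rewrite IH. Qed.

Lemma expect_ext_always T (p : prog R T) P f g :
  always p P -> (forall t, P t -> f t = g t) -> expect p f = expect p g.
Proof.
move=> HP H; apply/eqP; rewrite eq_le; apply/andP; split;
  by apply: (expect_le_always HP) => t /H ->.
Qed.

Lemma expect_const T (p : prog R T) a : expect p (fun=> a) = a.
Proof.
elim: p => //= b k IH; rewrite -[RHS]mul1r -(mu1 b) mulr_suml.
by apply: eq_bigr => x _; rewrite IH.
Qed.

Lemma expectD T (p : prog R T) f g : expect p (fun t => f t + g t) = expect p f + expect p g.
Proof.
elim: p => //= b k IH; rewrite -big_split /=.
by apply: eq_bigr => x _; rewrite IH mulrDr.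
Qed.

Lemma expectZ T (p : prog R T) a f : expect p (fun t => a * f t) = a * expect p f.
Proof.
elim: p => //= b k IH; rewrite mulr_sumr.
by apply: eq_bigr => x _; rewrite IH mulrCA.
Qed.

Lemma expect_sum T (p : prog R T) (f : nat -> T -> R) m :
  expect p (fun t => \sum_(0 <= j < m) f j t) = \sum_(0 <= j < m) expect p (f j).
Proof.
elim: m => [|m IH].
  by rewrite big_geq // -[RHS](expect_const p); apply: expect_ext => t; rewrite big_geq.
rewrite big_nat_recr //= -IH -expectD.
by apply: expect_ext => t; rewrite big_nat_recr.
Qed.

Lemma expect_ge0 T (p : prog R T) f : (forall t, 0 <= f t) -> 0 <= expect p f.
Proof. by move=> H; rewrite -(expect_const p 0); apply: expect_le. Qed.

Lemma cost_ge0 T (p : prog R T) : 0 <= cost p.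
Proof.
elim: p => //= b k IH; apply: addr_ge0 => //; apply: sumr_ge0 => x _.
exact: mulr_ge0.
Qed.

Lemma fail_ge0 T (p : prog R T) Q : 0 <= fail p Q.
Proof. by apply: expect_ge0 => t; case: ifP. Qed.

Lemma fail_le1 T (p : prog R T) Q : fail p Q <= 1.
Proof. by rewrite -(expect_const p 1); apply: expect_le => t; case: ifP. Qed.

Lemma fail_weak T (p : prog R T) (P Q : T -> Prop) :
  (forall t, P t -> Q t) -> fail p Q <= fail p P.
Proof.
move=> H; apply: expect_le => t; case: asboolP => // nQ; case: asboolP => // /H //.
Qed.

Lemma fail_always T (p : prog R T) (Q : T -> Prop) : always p Q -> fail p Q = 0.
Proof.
move=> H; rewrite /fail (expect_ext_always (g := fun=> 0) H) ?expect_const // => t Qt.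
by rewrite asboolT.
Qed.

(** Union bound along a composition, with [P] the success of the first stage. *)
Lemma fail_bind S T (p : prog R S) (f : S -> prog R T) P Q (b : R) : 0 <= b ->
  (forall t, P t -> fail (f t) Q <= b) -> fail (bind p f) Q <= fail p P + b.
Proof.
move=> b0 H; rewrite /fail expect_bind -[b in X in _ <= X](expect_const p) -expectD.
apply: expect_le => t; case: asboolP => [/H|_]; first by rewrite add0r.
by apply: (le_trans (fail_le1 _ _)); rewrite lerDl.
Qed.

(** Off the good event [P] the value exceeds [a] by at most [M]. Rare bad schedules are thus
    harmless on average, their length being bounded anyway. *)
Lemma expect_bound_always T (p : prog R T) (A P : T -> Prop) f (a M : R) :
  always p A ->
  (forall t, A t -> P t -> f t <= a) -> (forall t, A t -> f t <= a + M) -> 0 <= M ->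
  expect p f <= a + M * fail p P.
Proof.
move=> HA H1 H2 M0; rewrite -[a in X in _ <= X](expect_const p) -expectZ -expectD.
apply: (expect_le_always HA) => t At.
by case: asboolP => [/(H1 _ At)|_]; rewrite ?mulr0 ?mulr1 ?addr0 //; apply: H2.
Qed.

Lemma cost_bind_le S T (p : prog R S) (f : S -> prog R T) (A : S -> Prop) (C : R) :
  always p A -> (forall t, A t -> cost (f t) <= C) -> cost (bind p f) <= cost p + C.
Proof.
move=> HA H; rewrite cost_bind lerD2l -[X in _ <= X](expect_const p).
exact: (expect_le_always HA).
Qed.

Lemma cost_bind0 S T (p : prog R S) (f : S -> prog R T) :
  (forall t, cost (f t) = 0) -> cost (bind p f) = cost p.
Proof. by move=> H; rewrite cost_bind (expect_ext _ H) expect_const addr0. Qed.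

Lemma rep_size T (p : prog R T) m : always (rep p m) (fun s => size s = m).
Proof.
elim: m => //= m IH; apply: (always_bind (always_true p)) => x _.
by apply: (always_bind IH) => s /= ->.
Qed.

Lemma cost_rep T (p : prog R T) m : cost (rep p m) = m%:R * cost p.
Proof.
elim: m => [|m IH] /=; first by rewrite mul0r.
rewrite cost_bind mulrS mulrDl mul1r; congr (_ + _).
rewrite (expect_ext _ (g := fun=> m%:R * cost p)) ?expect_const // => x.
by rewrite cost_bind IH /= expect_const addr0.
Qed.

Lemma expect_rep_prod T (p : prog R T) m (h : T -> R) :
  expect (rep p m) (fun s => \prod_(t <- s) h t) = expect p h ^+ m.
Proof.
elim: m => [|m IH] /=; first by rewrite big_nil.
rewrite expect_bind exprSr -IH -expectZ.
apply: expect_ext => x; rewrite expect_bind /= mulrC -expectZ.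
by apply: expect_ext => s; rewrite big_cons.
Qed.

Lemma expect_rep_sum T (p : prog R T) m (h : T -> R) :
  expect (rep p m) (fun s => \sum_(t <- s) h t) = m%:R * expect p h.
Proof.
elim: m => [|m IH] /=; first by rewrite big_nil mul0r.
rewrite expect_bind mulrS mulrDl mul1r -IH.
rewrite (expect_ext _ (g := fun x => h x + expect (rep p m) (fun s => \sum_(t <- s) h t))).
  by rewrite expectD expect_const.
move=> x; rewrite expect_bind /= -[X in X + _](expect_const (rep p m)) -expectD.
by apply: expect_ext => s; rewrite big_cons.
Qed.

Lemma expect_rep_sum2 T (p : prog R T) m (h : T -> R) :
  expect (rep p m) (fun s => (\sum_(t <- s) h t) ^+ 2) =
  m%:R * expect p (fun t => h t ^+ 2) + m%:R * (m%:R - 1) * expect p h ^+ 2.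
Proof.
elim: m => [|m IH] /=; first by rewrite big_nil expr0n /= !mul0r addr0.
rewrite expect_bind.
rewrite (expect_ext _ (g := fun x => h x ^+ 2 + ((2 * expect (rep p m) (fun s => \sum_(t <- s) h t)) * h x + expect (rep p m) (fun s => (\sum_(t <- s) h t) ^+ 2)))).
  rewrite !expectD expectZ expect_const IH expect_rep_sum -natr1; ring.
move=> x; rewrite expect_bind /= -[X in X + _](expect_const (rep p m)) mulrAC -expectZ -!expectD.
by apply: expect_ext => s; rewrite big_cons; ring.
Qed.

(** * Empirical means and tail bounds *)

Definition mean T (h : T -> R) (s : seq T) : R := (\sum_(t <- s) h t) / (size s)%:R.

Lemma expect_mean T (p : prog R T) m (h : T -> R) : (0 < m)%N ->
  expect (rep p m) (mean h) = expect p h.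
Proof.
move=> m0; rewrite (expect_ext_always (g := fun s => m%:R^-1 * \sum_(t <- s) h t) (rep_size p m)).
  by rewrite expectZ expect_rep_sum mulKf // pnatr_eq0 -lt0n.
by move=> s; rewrite /mean => ->; rewrite mulrC.
Qed.

(** The square of a sum of [m] independent copies has [m] diagonal terms [E h^2] and [m (m - 1)]
    cross terms [(E h)^2]: the relative variance of the mean is at most [K / m]. *)
Lemma expect_mean2 T (p : prog R T) m (h : T -> R) (K : R) : (0 < m)%N ->
  0 <= K -> expect p (fun t => h t ^+ 2) <= K * expect p h ^+ 2 ->
  expect (rep p m) (fun s => mean h s ^+ 2) <= expect p h ^+ 2 * (1 + K / m%:R).
Proof.
move=> m0 K0 hK.
rewrite (expect_ext_always (g := fun s => m%:R^-1 ^+ 2 * (\sum_(t <- s) h t) ^+ 2) (rep_size p m)); last first.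
  by move=> s; rewrite /mean => ->; rewrite mulrC exprMn.
have m0' : (0 : R) < m%:R by rewrite ltr0n.
rewrite expectZ expect_rep_sum2 exprVn mulrC ler_pdivrMr ?exprn_gt0 //.
rewrite [X in _ <= X](_ : _ = m%:R ^+ 2 * expect p h ^+ 2 + m%:R * (K * expect p h ^+ 2)); last first.
  by field; rewrite gt_eqF.
have := ler_wpM2l (ltW m0') hK; have := sqr_ge0 (expect p h); nra.
Qed.

(** From [expR l <= 1 / (1 - l)], since [(1 - l) (1 + l + 2 l^2) = 1 + l^2 (1 - 2 l) >= 1]. *)
Lemma expR_le_quad (l : R) : l <= 1/2 -> expR l <= 1 + l + 2 * l ^+ 2.
Proof.
move=> hl; have h1 : 0 < 1 - l by lra.
have h2 : expR l * (1 - l) <= 1.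
  have := ler_wpM2l (expR_ge0 l) (expR_ge1Dx (- l)).
  by rewrite -expRD subrr expR0.
rewrite -(ler_pM2r h1); apply: (le_trans h2).
have : 0 <= l ^+ 2 * (1 - 2 * l) by apply: mulr_ge0; [exact: sqr_ge0 | lra].
nra.
Qed.

Lemma expR_sum_seq T (s : seq T) (h : T -> R) :
  expR (\sum_(t <- s) h t) = \prod_(t <- s) expR (h t).
Proof.
by elim: s => [|x s IH]; rewrite ?big_nil ?expR0 // !big_cons expRD IH.
Qed.

(** Exponential Markov inequality; [sg] selects the tail. Since [q] is only an upper bound of the
    success probability, [q = 1] gives additive deviations, the probability itself relative ones,
    and [q = 1/4] serves the medians. *)
Lemma chernoff T (p : prog R T) (a : pred T) m (q eta sg : R) :
  expect p (fun t => (a t)%:R) <= q -> 0 < eta <= 2 -> sg = 1 \/ sg = -1 ->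
  expect (rep p m) (fun s =>
    (m%:R * (eta * q) <= sg * ((count a s)%:R - m%:R * expect p (fun t => (a t)%:R)))%R%:R)
  <= expR (- (m%:R * q * eta ^+ 2 / 8)).
Proof.
set pr := expect p _ => hq /andP[eta0 eta2] hsg.
have pr0 : 0 <= pr by apply: expect_ge0 => t; rewrite ler0n.
(* In units of [m q], this rate gains [eta^2 / 4] and loses at most the second-order term
   [2 l^2 = eta^2 / 8]; [eta <= 2] ensures [l <= 1/2]. *)
pose l := sg * (eta / 4).
have hl : l <= 1/2 by rewrite /l; case: hsg => ->; lra.
have l2 : l ^+ 2 = eta ^+ 2 / 16 by rewrite /l; case: hsg => ->; field.
pose c := expR (- (eta / 4 * (m%:R * (eta * q)) + l * m%:R * pr)).
apply: (@le_trans _ _ (expect (rep p m) (fun s => c * \prod_(t <- s) expR (l * (a t)%:R)))).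
  apply: expect_le => s; rewrite /c -expR_sum_seq -expRD.
  have -> : \sum_(t <- s) l * (a t)%:R = l * (count a s)%:R.
    rewrite -mulr_sumr; congr (_ * _).
    by elim: s => [|x s IH]; rewrite ?big_nil // big_cons IH /= natrD.
  case: (boolP (_ <= sg * _)) => [h|_] /=; last exact: expR_ge0.
  apply: (le_trans _ (expR_ge1Dx _)); rewrite lerDl.
  have h' : 0 <= (sg * ((count a s)%:R - m%:R * pr) - m%:R * (eta * q)) * (eta / 4).
    by apply: mulr_ge0; lra.
  apply: (le_trans h'); rewrite /l.
  by rewrite le_eqVlt; apply/orP; left; apply/eqP; field.
rewrite expectZ expect_rep_prod.
have h1 : expect p (fun t => expR (l * (a t)%:R)) <= expR (pr * (l + 2 * l ^+ 2)).
  apply: (le_trans _ (expR_ge1Dx _)).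
  rewrite (_ : 1 + _ = expect p (fun t => 1 + (l + 2 * l ^+ 2) * (a t)%:R)); last first.
    by rewrite expectD expect_const expectZ mulrC.
  apply: expect_le => t; case: (a t); rewrite ?mulr1 ?mulr0 ?expR0 ?addr0 // addrA.
  exact: expR_le_quad.
have h0 : 0 <= expect p (fun t => expR (l * (a t)%:R)) by apply: expect_ge0 => t; exact: expR_ge0.
apply: (@le_trans _ _ (c * expR (pr * (l + 2 * l ^+ 2)) ^+ m)).
  by apply: ler_wpM2l; [exact: expR_ge0 | apply: lerXn2r => //; rewrite nnegrE //; exact: expR_ge0].
rewrite -expRM_natl /c -expRD ler_expR l2.
have m0 : (0 : R) <= m%:R by rewrite ler0n.
have h2 : 0 <= m%:R * (q - pr) * eta ^+ 2.
  by apply: mulr_ge0; [apply: mulr_ge0; lra | exact: sqr_ge0].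
nra.
Qed.

End Semantics.

(** * Log-concave sequences *)

Section LogConcave.
Context {R : realType}.

Definition lc_seq (n : nat) (a : nat -> R) : Prop :=
  (forall x, (x <= n)%N -> 0 < a x) /\
  (forall x, (x.+2 <= n)%N -> a x * a x.+2 <= a x.+1 ^+ 2).

Lemma lc_ratio n (a : nat -> R) x y : lc_seq n a -> (x <= y)%N -> (y < n)%N ->
  a y.+1 * a x <= a x.+1 * a y.
Proof.
move=> [pos lc] /subnKC <-; elim: (y - x)%N => [|d IH]; first by rewrite addn0.
rewrite addnS => h; have h' := IH (ltnW h).
have py : 0 < a (x + d)%N by apply: pos; nlia.
have py1 : 0 < a (x + d).+1 by apply: pos; nlia.
have px : 0 < a x by apply: pos; nlia.
have h2 := lc _ h; rewrite -(ler_pM2r py).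
have h3 := ler_wpM2r (ltW px) h2; have h4 := ler_wpM2r (ltW py1) h'.
nra.
Qed.

Lemma lc_rev n (a : nat -> R) : lc_seq n a -> lc_seq n (fun y => a (n - y)%N).
Proof.
move=> [pos lc]; split=> [x _|x hx]; first by apply: pos; nlia.
have := lc (n - x.+2)%N; rewrite (_ : (n - x.+2).+2 = n - x)%N; last nlia.
rewrite (_ : (n - x.+2).+1 = n - x.+1)%N; last nlia.
by rewrite mulrC; apply; nlia.
Qed.

Lemma geo_partial (r : R) m : 0 <= r -> (1 - r) * (\sum_(0 <= i < m) r ^+ i.+1) <= r.
Proof.
move=> r0; rewrite (_ : _ * _ = r - r ^+ m.+1); first by rewrite lerBlDr lerDl exprn_ge0.
elim: m => [|m IH]; first by rewrite big_geq // mulr0 subrr.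
by rewrite big_nat_recr //= mulrDr IH !exprS; ring.
Qed.

Lemma bernoulli_le (u : R) m : 0 <= u <= 1 -> 1 - m%:R * u <= (1 - u) ^+ m.
Proof.
move=> /andP[u0 u1]; elim: m => [|m IH]; first by rewrite mul0r subr0 expr0.
rewrite exprS; apply: (@le_trans _ _ ((1 - u) * (1 - m%:R * u))); last first.
  by apply: ler_wpM2l => //; lra.
have : 0 <= m%:R * u ^+ 2 by rewrite mulr_ge0 // sqr_ge0.
rewrite -natr1; nra.
Qed.

(* With [r = a (x - 1) / a x], either [r] is so small that the geometric bound
   [a (x - i) <= a x * r ^ i] controls the left sum, or so close to 1 that
   [a (x + i) <= a x / r ^ i] stays below [2 * a x] on the block. *)
Lemma lc_core n (a : nat -> R) x z (s : nat) (p : R) : lc_seq n a ->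
  (x <= z)%N -> (z <= n)%N -> (z.+1 - x <= s)%N -> 0 < p ->
  p <= \sum_(0 <= y < x) a y -> p <= \sum_(x <= y < z.+1) a y ->
  p <= 2 * s%:R * a x.
Proof.
move=> lc xz zn hs p0 hL hB.
case: x xz hs hL hB => [|x] xz hs hL hB.
  by move: hL; rewrite big_geq // => /(lt_le_trans p0); rewrite ltxx.
have pos := lc.1.
have px : 0 < a x.+1 by apply: pos; nlia.
have px0 : 0 < a x by apply: pos; nlia.
set r := a x / a x.+1.
have r0 : 0 < r by rewrite divr_gt0.
have rE : a x = r * a x.+1 by rewrite /r divfK // gt_eqF.
have s0 : (0 : R) < s%:R by rewrite ltr0n; nlia.
have left i : (i <= x)%N -> a (x - i)%N <= a x.+1 * r ^+ i.+1.
  elim: i => [|i IH] hi; first by rewrite subn0 expr1 mulrC -rE.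
  have h : a x.+1 * a (x - i.+1)%N <= a (x - i)%N * a x.
    have := @lc_ratio n a (x - i.+1) x lc; rewrite (_ : (x - i.+1).+1 = x - i)%N; last nlia.
    by apply; nlia.
  have h1 : a (x - i.+1)%N <= r * a (x - i)%N.
    by rewrite -(ler_pM2l px); apply: (le_trans h); rewrite rE; nra.
  apply: (le_trans h1); rewrite exprS mulrCA ler_pM2l //; apply: IH; nlia.
have right i : (x.+1 + i <= n)%N -> a (x.+1 + i)%N * r ^+ i <= a x.+1.
  elim: i => [|i IH] hi; first by rewrite addn0 expr0 mulr1.
  have h : a (x.+1 + i).+1 * a x <= a x.+1 * a (x.+1 + i)%N by apply: (lc_ratio lc); nlia.
  have h1 : a (x.+1 + i.+1)%N * r <= a (x.+1 + i)%N.
    rewrite addnS -(ler_pM2l px); apply: (le_trans _ h); rewrite rE; nra.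
  rewrite exprS mulrA; apply: (le_trans _ (IH _)); last nlia.
  by apply: ler_wpM2r => //; rewrite exprn_ge0 // ltW.
have sumL : \sum_(0 <= y < x.+1) a y <= a x.+1 * \sum_(0 <= i < x.+1) r ^+ i.+1.
  rewrite big_nat_rev mulr_sumr /=; apply: ler_sum_nat => i hi.
  by rewrite (_ : (0 + x.+1 - i.+1 = x - i)%N); [apply: left; nlia | nlia].
(* Up to this threshold the geometric series sums to at most [2 s]; beyond it, Bernoulli's
   inequality gives [r^i >= 1/2] for all [i <= s]. *)
have [hr|hr] := leP r (1 - (2 * s%:R)^-1).
  have h1 : 0 < (2 * s%:R : R)^-1 by rewrite invr_gt0 mulr_gt0.
  have h2 := geo_partial x.+1 (ltW r0).
  have h3 : \sum_(0 <= i < x.+1) r ^+ i.+1 <= 2 * s%:R.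
    have S0 : 0 <= \sum_(0 <= i < x.+1) r ^+ i.+1.
      by apply: sumr_ge0 => i _; rewrite exprn_ge0 // ltW.
    rewrite -[X in X <= _](mulKf (x := (2 * s%:R)^-1)) ?gt_eqF // invrK.
    rewrite -[X in _ <= X]mulr1 ler_pM2l ?mulr_gt0 //.
    apply: (le_trans (y := r)); last lra.
    by apply: (le_trans _ h2); apply: ler_wpM2r => //; lra.
  apply: (le_trans hL); apply: (le_trans sumL).
  by rewrite mulrC ler_pM2r.
have half i : (i <= s)%N -> 1/2 <= r ^+ i.
  move=> hi; have hu : 0 <= (2 * s%:R : R)^-1 <= 1.
    have s1 : (1 : R) <= s%:R by rewrite ler1n; nlia.
    apply/andP; split; first by rewrite invr_ge0; lra.
    by rewrite invf_le1; lra.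
  apply: (@le_trans _ _ ((1 - (2 * s%:R)^-1) ^+ i)); last first.
    by apply: lerXn2r; rewrite ?nnegrE; lra.
  apply: (le_trans _ (bernoulli_le i hu)).
  have : i%:R * (2 * s%:R)^-1 <= (1/2 : R).
    rewrite ler_pdivrMr ?mulr_gt0 //.
    have : (i%:R : R) <= s%:R by rewrite ler_nat.
    lra.
  lra.
apply: (le_trans hB).
apply: (@le_trans _ _ (\sum_(x.+1 <= y < z.+1) 2 * a x.+1)).
  apply: ler_sum_nat => y /andP[hy1 hy2].
  have h1 := right (y - x.+1)%N; have h2 := half (y - x.+1)%N.
  have py : 0 < a y by apply: pos; nlia.
  move: h1; rewrite subnKC // => h1.
  have h3 := h1 ltac:(nlia); have := ler_wpM2l (ltW py) (h2 ltac:(nlia)); lra.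
rewrite sumr_const_nat -mulr_natl.
have : ((z.+1 - x.+1)%:R : R) <= s%:R by rewrite ler_nat.
nra.
Qed.

Lemma lc_core_rev n (a : nat -> R) k x (s : nat) (p : R) : lc_seq n a ->
  (k <= x)%N -> (x <= n)%N -> (x.+1 - k <= s)%N -> 0 < p ->
  p <= \sum_(x.+1 <= y < n.+1) a y -> p <= \sum_(k <= y < x.+1) a y ->
  p <= 2 * s%:R * a x.
Proof.
move=> lc kx xn hs p0 hR hB.
have := @lc_core n _ (n - x) (n - k) s p (lc_rev lc).
rewrite subKn //; apply => //; try nlia.
  apply: (le_trans hR); rewrite big_nat_rev /= -{1}(add0n x.+1) big_addn /=.
  rewrite (_ : n.+1 - x.+1 = n - x)%N; last nlia.
  apply: ler_sum_nat => i hi; rewrite (_ : x.+1 + n.+1 - (i + x.+1).+1 = n - i)%N //; nlia.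
apply: (le_trans hB); rewrite big_nat_rev /= -{1}(add0n k) big_addn.
rewrite -{1}(add0n (n - x)%N) big_addn.
rewrite (_ : (n - k).+1 - (n - x) = x.+1 - k)%N; last nlia.
apply: ler_sum_nat => i hi.
rewrite (_ : k + x.+1 - (i + k).+1 = n - (i + (n - x)))%N //; nlia.
Qed.

(** One side of [x] within the block carries mass [p]; [lc_core] or its mirror image then needs mass
    [p] on the other side of [x], which the outer tail supplies. At an end of the range, where a
    tail may vanish, monotonicity takes its place. The right tail is asked to be [2 p] because it
    starts at [z], possibly at [x] itself, whose mass must be taken off. *)
Lemma lc_block n (a : nat -> R) k x z (p : R) : lc_seq n a ->
  (k <= x)%N -> (x <= z)%N -> (z <= n)%N -> 0 < p ->
  2 * p <= \sum_(k <= y < z.+1) a y ->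
  p <= \sum_(0 <= y < k) a y \/ (forall i j, (i <= j)%N -> (j <= n)%N -> a j <= a i) ->
  2 * p <= \sum_(z <= y < n.+1) a y \/ (forall i j, (i <= j)%N -> (j <= n)%N -> a i <= a j) ->
  p <= 2 * (z.+1 - k)%:R * a x.
Proof.
move=> lc kx xz zn p0 hB hL hR; have pos := lc.1.
have px : 0 < a x by apply: pos; nlia.
have sub u v : (v <= n.+1)%N -> 0 <= \sum_(u <= y < v) a y.
  move=> vn; rewrite big_nat_cond sumr_ge0 // => y; rewrite andbT => hy.
  by apply: ltW; apply: pos; nlia.
have s1 : (1 : R) <= (z.+1 - k)%:R by rewrite ler1n; nlia.
have [h|h] := leP p (\sum_(x <= y < z.+1) a y).
  case: hL => hL.
    apply: (lc_core lc xz zn _ p0 _ h); first nlia.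
    apply: (le_trans hL); rewrite [X in _ <= X](@big_cat_nat _ _ _ k) //= lerDl.
    by apply: sub; nlia.
  apply: (le_trans h); apply: (@le_trans _ _ (\sum_(x <= y < z.+1) a x)).
    by apply: ler_sum_nat => y hy; apply: hL; nlia.
  rewrite sumr_const_nat -mulr_natl.
  have : ((z.+1 - x)%:R : R) <= (z.+1 - k)%:R by rewrite ler_nat; nlia.
  nra.
have h2 : p <= \sum_(k <= y < x.+1) a y.
  move: hB; rewrite (@big_cat_nat _ _ _ x) //=; last by apply: leq_trans xz _.
  by rewrite [X in _ -> _ <= X]big_nat_recr //=; lra.
case: hR => hR; last first.
  apply: (le_trans h2); apply: (@le_trans _ _ (\sum_(k <= y < x.+1) a x)).
    by apply: ler_sum_nat => y hy; apply: hR; nlia.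
  rewrite sumr_const_nat -mulr_natl.
  have : ((x.+1 - k)%:R : R) <= (z.+1 - k)%:R by rewrite ler_nat; nlia.
  nra.
have [h3|h3] := leP p (a x); first nra.
apply: (lc_core_rev lc kx _ _ p0 _ h2); try nlia.
have h4 : 2 * p <= \sum_(x <= y < n.+1) a y.
  apply: (le_trans hR); rewrite [X in _ <= X](@big_cat_nat _ _ _ z) //=; last nlia.
  by rewrite lerDr; apply: sub; nlia.
by move: h4; rewrite big_ltn; [lra | nlia].
Qed.

End LogConcave.

(** * Gibbs distributions *)

Section GibbsFacts.
Context {R : realType}.
Implicit Types (b : R) (x y j : nat).
Variables (n : nat) (c : nat -> R).
Hypothesis pos : positive_counts n c.

Local Notation Z := (partition_fun n c).

Definition pm b x : R := c x * expR (b * x%:R) / Z b.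
(** Strict convention: [P_b (X <= z)] is [cdf b z.+1], and [1 - cdf b z] is the tail including
    [z]. *)
Definition cdf b j : R := \sum_(0 <= x < j) pm b x.
Definition avg b : R := \sum_(0 <= x < n.+1) pm b x * x%:R.

Lemma partition_fun_gt0 b : 0 < Z b.
Proof.
rewrite /partition_fun big_ord_recl /=; apply: ltr_pwDl.
  by rewrite mulr_gt0 ?expR_gt0 ?pos.
by apply: sumr_ge0 => i _; rewrite mulr_ge0 ?expR_ge0 // ltW // pos.
Qed.

Lemma pm_gt0 b x : (x <= n)%N -> 0 < pm b x.
Proof. by move=> xn; rewrite divr_gt0 ?mulr_gt0 ?expR_gt0 ?pos // partition_fun_gt0. Qed.

Lemma gibbs_ge0 b (x : 'I_n.+1) : 0 <= gibbs c b x.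
Proof. by apply: ltW; apply: (pm_gt0 b); rewrite -ltnS. Qed.

Lemma gibbs_sum b : \sum_(x < n.+1) gibbs c b x = 1.
Proof. by rewrite /gibbs -mulr_suml divff // gt_eqF // partition_fun_gt0. Qed.

Lemma cdf0 b : cdf b 0 = 0.
Proof. by rewrite /cdf big_geq. Qed.

Lemma cdf_top b : cdf b n.+1 = 1.
Proof. by rewrite /cdf big_mkord; exact: gibbs_sum. Qed.

Lemma cdfB b i j : (i <= j)%N -> cdf b j - cdf b i = \sum_(i <= x < j) pm b x.
Proof. by move=> ij; rewrite /cdf (@big_cat_nat _ _ _ i 0 j) //= addrAC subrr add0r. Qed.

Lemma cdf_mono b i j : (i <= j)%N -> (j <= n.+1)%N -> cdf b i <= cdf b j.
Proof.
move=> ij jn; rewrite -subr_ge0 cdfB // big_nat_cond sumr_ge0 // => x.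
by rewrite andbT => hx; apply: ltW; apply: pm_gt0; nlia.
Qed.

Lemma cdf_ge0 b j : (j <= n.+1)%N -> 0 <= cdf b j.
Proof. by move=> jn; rewrite -(cdf0 b) cdf_mono. Qed.

Lemma cdf_le1 b j : (j <= n.+1)%N -> cdf b j <= 1.
Proof. by move=> jn; rewrite -(cdf_top b) cdf_mono. Qed.

Lemma cdf_tail b j : (j <= n.+1)%N -> 1 - cdf b j = \sum_(j <= x < n.+1) pm b x.
Proof. by move=> jn; rewrite -(cdf_top b) cdfB. Qed.

(** Each pair [x < j <= y] is reweighted by [e^((b' - b) (y - x))] with [y - x >= 1], so the odds of
    [X >= j] grow exponentially in [b]. This is why single-sample tests on a unit grid suffice. *)
Lemma cdf_odds b b' j : b <= b' -> (j <= n.+1)%N ->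
  (1 - cdf b j) * cdf b' j * expR (b' - b) <= (1 - cdf b' j) * cdf b j.
Proof.
move=> bb' jn; rewrite !cdf_tail // /cdf !big_distrlr /= mulr_suml.
apply: ler_sum_nat => y hy; rewrite mulr_suml; apply: ler_sum_nat => x hx.
rewrite /pm; have z := partition_fun_gt0 b; have z' := partition_fun_gt0 b'.
rewrite (_ : _ * expR (b' - b) = (c y * c x / (Z b * Z b')) *
  (expR (b * y%:R) * expR (b' * x%:R) * expR (b' - b))); last first.
  by field; rewrite !gt_eqF.
rewrite [X in _ <= X](_ : _ = (c y * c x / (Z b * Z b')) *
  (expR (b' * y%:R) * expR (b * x%:R))); last by field; rewrite !gt_eqF.
apply: ler_wpM2l.
  by rewrite divr_ge0 // ?mulr_ge0 // ltW // pos //; nlia.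
rewrite -!expRD ler_expR.
have : (x%:R : R) + 1 <= y%:R by rewrite natr1 ler_nat; nlia.
nra.
Qed.

Lemma cdf_anti b b' j : b <= b' -> (j <= n.+1)%N -> cdf b' j <= cdf b j.
Proof.
move=> bb' jn; have h := cdf_odds bb' jn.
have h1 : 1 <= expR (b' - b) by rewrite -expR0 ler_expR; lra.
have h2 : 0 <= (1 - cdf b j) * cdf b' j.
  by apply: mulr_ge0; [rewrite subr_ge0 cdf_le1 | rewrite cdf_ge0].
nra.
Qed.

(** No mass shrinks by more than [e^(- n (b' - b))]: numerators grow, and [Z] grows by at most
    [e^(n (b' - b))]. This dictates a fine grid of step of order [1 / n]. *)
Lemma cdf_lip b b' j : b <= b' -> (j <= n.+1)%N ->
  cdf b j - n%:R * (b' - b) <= cdf b' j.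
Proof.
move=> bb' jn; apply: (@le_trans _ _ (expR (- (n%:R * (b' - b))) * cdf b j)).
  have h1 := expR_ge1Dx (- (n%:R * (b' - b))).
  have h2 := cdf_le1 b jn; have h3 := cdf_ge0 b jn.
  have h4 : 0 <= n%:R * (b' - b) by rewrite mulr_ge0 // subr_ge0.
  nra.
rewrite /cdf mulr_sumr; apply: ler_sum_nat => x hx.
rewrite /pm; have z := partition_fun_gt0 b; have z' := partition_fun_gt0 b'.
rewrite mulrA ler_pdivrMr // mulrAC ler_pdivlMr // -!mulrA (mulrCA (expR _)).
apply: ler_wpM2l; first by rewrite ltW // pos //; nlia.
rewrite mulrCA; apply: ler_pM; rewrite ?mulr_ge0 ?expR_ge0 //; first exact: ltW.
  by rewrite ler_expR ler_wpM2r.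
rewrite -(ler_pM2l (expR_gt0 (n%:R * (b' - b)))) mulrA -expRD subrr expR0 mul1r.
rewrite /partition_fun mulr_sumr; apply: ler_sum => i _.
rewrite mulrCA; apply: ler_wpM2l; first by rewrite ltW // pos // -ltnS.
rewrite -expRD ler_expR.
have : (i%:R : R) <= n%:R by rewrite ler_nat -ltnS.
nra.
Qed.

Lemma expect_sample_sum b (f : nat -> R) :
  expect (gibbs c (n:=n)) (sample b) f = \sum_(0 <= x < n.+1) pm b x * f x.
Proof. by rewrite /= big_mkord. Qed.

Lemma expect_sample_lt b j : (j <= n.+1)%N ->
  expect (gibbs c (n:=n)) (sample b) (fun x => (x < j)%N%:R) = cdf b j.
Proof.
move=> jn; rewrite expect_sample_sum (@big_cat_nat _ _ _ j) //=.
rewrite [X in _ + X]big_nat_cond [X in _ + X]big1 ?addr0; last first.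
  by move=> x /andP[hx _]; rewrite ltnNge (_ : (j <= x)%N) ?mulr0 //; nlia.
by apply: eq_big_nat => x hx; rewrite (_ : (x < j)%N) ?mulr1 //; nlia.
Qed.

Lemma expect_sample_eq b x0 : (x0 <= n)%N ->
  expect (gibbs c (n:=n)) (sample b) (fun x => (x == x0)%:R) = pm b x0.
Proof.
move=> jn; rewrite expect_sample_sum (bigD1_seq x0) ?mem_index_iota ?iota_uniq //=.
rewrite eqxx mulr1 big1 ?addr0 // => x /negPf ->; by rewrite mulr0.
Qed.

(* Both sides are [\sum_x c x * min (e^(b x)) (e^(b' x - (b' - b) z))], up to
   the two normalizations. *)
Lemma overlap b b' (z : R) :
  expect (gibbs c (n:=n)) (sample b) (fun x => Num.min 1 (expR ((b' - b) * (x%:R - z)))) =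
  Z b' / Z b * expR (- ((b' - b) * z)) *
  expect (gibbs c (n:=n)) (sample b') (fun x => Num.min 1 (expR (- ((b' - b) * (x%:R - z))))).
Proof.
rewrite !expect_sample_sum mulr_sumr; apply: eq_big_nat => x hx; rewrite /pm.
have z0 := partition_fun_gt0 b; have z0' := partition_fun_gt0 b'.
have e1 : expR (b' * x%:R) = expR (b * x%:R) * expR ((b' - b) * (x%:R - z)) *
    expR ((b' - b) * z) by rewrite -!expRD; congr expR; ring.
have e2 : expR (- ((b' - b) * (x%:R - z))) = (expR ((b' - b) * (x%:R - z)))^-1.
  by rewrite expRN.
have e3 : expR (- ((b' - b) * z)) = (expR ((b' - b) * z))^-1 by rewrite expRN.
rewrite e1 e2 e3; set u := expR ((b' - b) * (x%:R - z)); set v := expR ((b' - b) * z).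
have u0 : 0 < u by exact: expR_gt0.
have v0 : 0 < v by exact: expR_gt0.
have -> : Num.min 1 u = u * Num.min 1 u^-1.
  by rewrite minr_pMr ?(ltW u0) // mulr1 mulfV ?gt_eqF // minC.
by field; rewrite !gt_eqF.
Qed.

Lemma overlap_lo b b' z : b <= b' -> (z <= n.+1)%N ->
  1 - cdf b z <=
  expect (gibbs c (n:=n)) (sample b) (fun x => Num.min 1 (expR ((b' - b) * (x%:R - z%:R)))).
Proof.
move=> bb' zn; rewrite cdf_tail // expect_sample_sum [X in _ <= X](@big_cat_nat _ _ _ z) //=.
apply: ler_wpDl.
  rewrite big_nat_cond sumr_ge0 // => x; rewrite andbT => hx.
  by rewrite mulr_ge0 ?le_min ?ler01 ?expR_ge0 // ltW // pm_gt0; nlia.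
apply: ler_sum_nat => x hx; rewrite min_l ?mulr1 // -[X in X <= _]expR0 ler_expR.
apply: mulr_ge0; first by rewrite subr_ge0.
by rewrite subr_ge0 ler_nat; nlia.
Qed.

Lemma overlap_hi b b' z : b <= b' -> (z <= n)%N ->
  cdf b' z.+1 <=
  expect (gibbs c (n:=n)) (sample b') (fun x => Num.min 1 (expR (- ((b' - b) * (x%:R - z%:R))))).
Proof.
move=> bb' zn; rewrite expect_sample_sum [X in _ <= X](@big_cat_nat _ _ _ z.+1) //=.
apply: ler_wpDr.
  rewrite big_nat_cond sumr_ge0 // => x; rewrite andbT => hx.
  by rewrite mulr_ge0 ?le_min ?ler01 ?expR_ge0 // ltW // pm_gt0; nlia.
apply: ler_sum_nat => x hx; rewrite min_l ?mulr1 // -[X in X <= _]expR0 ler_expR oppr_ge0.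
apply: mulr_ge0_le0; first by rewrite subr_ge0.
by rewrite subr_le0 ler_nat; nlia.
Qed.

Lemma avg_ge0 b : 0 <= avg b.
Proof.
rewrite /avg big_nat_cond sumr_ge0 // => x; rewrite andbT => hx.
by rewrite mulr_ge0 // ltW // pm_gt0; nlia.
Qed.

Lemma avg_len b : avg b <= n%:R.
Proof.
rewrite (_ : n%:R = cdf b n.+1 * n%:R); last by rewrite cdf_top // mul1r.
rewrite /cdf mulr_suml; apply: ler_sum_nat => x hx.
by apply: ler_wpM2l; [rewrite ltW // pm_gt0; nlia | rewrite ler_nat; nlia].
Qed.

(** By symmetry [p <= q]; then [ln (q / p) >= 1 - p / q] and [q <= p + q]. *)
Lemma sub_ln_ge (p q : R) : 0 < p -> 0 < q ->
  (q - p) ^+ 2 / (p + q) <= (q - p) * (ln q - ln p).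
Proof.
wlog pq : p q / p <= q.
  move=> H p0 q0; have [pq|pq] := leP p q; first exact: H.
  have := H _ _ (ltW pq) q0 p0; rewrite -(opprB q p) sqrrN -(opprB (ln q)) mulrNN.
  by rewrite (addrC q p).
move=> p0 q0; have h : (q - p) / q <= ln q - ln p.
  rewrite -ln_div ?posrE //.
  have := expR_ge1Dx (- ln (q / p)).
  rewrite expRN lnK ?posrE ?divr_gt0 // invf_div.
  by rewrite mulrBl divff ?gt_eqF //; lra.
apply: (@le_trans _ _ ((q - p) * ((q - p) / q))); last by apply: ler_wpM2l => //; lra.
rewrite expr2 -mulrA; apply: ler_wpM2l; first lra.
apply: ler_wpM2l; first lra.
by rewrite lef_pV2 ?posrE; lra.
Qed.

(* [(b' - b) (avg b' - avg b)] is the symmetrized relative entropy. *)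
Lemma avg_progress b b' j : (j <= n.+1)%N -> 1/8 <= cdf b j - cdf b' j ->
  1/128 <= (b' - b) * (avg b' - avg b).
Proof.
move=> jn h.
have z := partition_fun_gt0 b; have z' := partition_fun_gt0 b'.
have E : (b' - b) * (avg b' - avg b) =
    \sum_(0 <= x < n.+1) (pm b' x - pm b x) * (ln (pm b' x) - ln (pm b x)).
  transitivity (\sum_(0 <= x < n.+1) ((pm b' x - pm b x) * ((b' - b) * x%:R) +
     (pm b' x - pm b x) * (ln (Z b) - ln (Z b')))).
    have E0 : \sum_(0 <= x < n.+1) (pm b' x - pm b x) * (ln (Z b) - ln (Z b')) = 0.
      by rewrite -mulr_suml sumrB -/(cdf b' n.+1) -/(cdf b n.+1) !cdf_top subrr mul0r.
    rewrite big_split /= E0 addr0.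
    rewrite /avg -sumrB mulr_sumr; apply: eq_big_nat => x _; ring.
  apply: eq_big_nat => x hx; rewrite -mulrDr; congr (_ * _).
  have cx : 0 < c x by apply: pos; nlia.
  rewrite /pm !ln_div ?posrE ?mulr_gt0 ?expR_gt0 // !lnM ?posrE ?expR_gt0 //.
  rewrite !expRK; ring.
rewrite E.
apply: (@le_trans _ _ (1/8 * (cdf b j - cdf b' j) - 1/256 * (cdf b n.+1 + cdf b' n.+1))).
  by rewrite !cdf_top; lra.
rewrite [X in _ <= X](@big_cat_nat _ _ _ j) //=.
rewrite /cdf (@big_cat_nat _ _ _ j 0 n.+1 _ (pm b)) //= (@big_cat_nat _ _ _ j 0 n.+1 _ (pm b')) //=.
(* Linearization [d^2 / s >= 2 t d - t^2 s]. With [t = 1/16] below [j] and [t = 0] from [j] on, the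
   total is at least [1/8 * 1/8 - 2/256 = 1/128]. *)
have key x : (x <= n)%N -> forall t : R, (2 * t * (pm b x - pm b' x) - t ^+ 2 * (pm b x + pm b' x)
   <= (pm b' x - pm b x) * (ln (pm b' x) - ln (pm b x)))%R.
  move=> xn t; have p0 := pm_gt0 b xn; have p0' := pm_gt0 b' xn.
  apply: (le_trans _ (sub_ln_ge p0 p0')).
  rewrite ler_pdivlMr; last lra.
  have := sqr_ge0 ((pm b x - pm b' x) - t * (pm b x + pm b' x)); nra.
have k1 : \sum_(0 <= x < j) (1/8 * (pm b x - pm b' x) - 1/256 * (pm b x + pm b' x)) <=
   \sum_(0 <= x < j) (pm b' x - pm b x) * (ln (pm b' x) - ln (pm b x)).
  apply: ler_sum_nat => x hx; apply: (le_trans _ (key x _ (1/16))); first lra.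
  by nlia.
have k2 : \sum_(j <= x < n.+1) (- (1/256 * (pm b x + pm b' x))) <=
   \sum_(j <= x < n.+1) (pm b' x - pm b x) * (ln (pm b' x) - ln (pm b x)).
  apply: ler_sum_nat => x hx; apply: (le_trans _ (key x _ 0)); last nlia.
  have p0 := @pm_gt0 b x; have p0' := @pm_gt0 b' x.
  have := p0 ltac:(nlia); have := p0' ltac:(nlia); lra.
move: k1 k2; rewrite sumrB -!mulr_sumr sumrB big_split /= sumrN -mulr_sumr big_split /=.
lra.
Qed.

End GibbsFacts.

Section LogConcaveGibbs.
Context {R : realType}.
Implicit Types (b : R) (x y j : nat).
Variables (n : nat) (c : nat -> R).
Hypothesis pos : positive_counts n c.
Hypothesis lc : log_concave n c.
Hypothesis n2 : (2 <= n)%N.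

Local Notation Z := (partition_fun n c).

Lemma lc_pm b : lc_seq n (pm n c b).
Proof.
split=> [x xn|x xn]; first exact: pm_gt0.
rewrite /pm; have z := partition_fun_gt0 pos b.
rewrite (_ : _ * _ = c x * c x.+2 * (expR (b * x.+1%:R) / Z b) ^+ 2); last first.
  have e : expR (b * x.+1%:R) ^+ 2 = expR (b * x%:R) * expR (b * x.+2%:R).
    by rewrite expr2 -!expRD; congr expR; rewrite -!natr1; ring.
  by rewrite exprMn e exprVn; field; rewrite gt_eqF.
rewrite -[X in _ <= X ^+ 2]mulrA [X in _ <= X]exprMn; apply: ler_wpM2r; first exact: sqr_ge0.
by apply: (lc (k := x.+1)); nlia.
Qed.

(** The hypothesis makes the first ratio at most 1, and by log-concavity the later ones are no
    larger. At [bmin] this replaces the missing left tail in [lc_block]; [pm_nondecr] does the same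
    on the right at [bmax]. *)
Lemma pm_nonincr b : b <= ln (c 0%N / c 1%N) ->
  forall i j, (i <= j)%N -> (j <= n)%N -> pm n c b j <= pm n c b i.
Proof.
move=> hb.
have c0 : 0 < c 0%N by exact: pos.
have c1 : 0 < c 1%N by apply: pos; nlia.
have h1 : pm n c b 1 <= pm n c b 0.
  rewrite /pm ler_pM2r ?invr_gt0 ?partition_fun_gt0 // mulr0 expR0 !mulr1.
  move: hb; rewrite -ler_expR lnK ?posrE ?divr_gt0 // ler_pdivlMr //; lra.
move=> i j /subnKC <-; elim: (j - i)%N => [|d IH]; first by rewrite addn0.
rewrite addnS => h; apply: (le_trans _ (IH (ltnW h))).
have := @lc_ratio _ n (pm n c b) 0 (i + d) (lc_pm b) (leq0n _) h.
have := pm_gt0 pos b (leq0n n); have := pm_gt0 pos b (ltnW h); nra.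
Qed.

Lemma pm_nondecr b : ln (c n.-1 / c n) <= b ->
  forall i j, (i <= j)%N -> (j <= n)%N -> pm n c b i <= pm n c b j.
Proof.
move=> hb.
have c0 : 0 < c n by exact: pos.
have c1 : 0 < c n.-1 by apply: pos; nlia.
have h1 : pm n c b n.-1 <= pm n c b n.
  rewrite /pm ler_pM2r ?invr_gt0 ?partition_fun_gt0 //.
  have -> : expR (b * n%:R) = expR b * expR (b * n.-1%:R).
    by rewrite -expRD -{1}(prednK (n := n)) ?(ltnW n2) // -natr1; congr expR; ring.
  move: hb; rewrite -ler_expR lnK ?posrE ?divr_gt0 // ler_pdivrMr // => hb.
  by rewrite mulrA; apply: ler_wpM2r; [exact: expR_ge0 | lra].
move=> i j /subnKC <-; elim: (j - i)%N => [|d IH]; first by rewrite addn0.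
rewrite addnS => h; apply: (le_trans (IH (ltnW h))).
have := @lc_ratio _ n (pm n c b) (i + d) n.-1 (lc_pm b).
rewrite prednK ?(ltnW n2) // => /(_ _ _) h2; have {h2} := h2 ltac:(nlia) ltac:(nlia).
have := pm_gt0 pos b (leqnn n); have := pm_gt0 pos b (ltnW h); have := pm_gt0 pos b h; nra.
Qed.

Lemma bmin_le_bmax bmin bmax : bmin <= ln (c 0%N / c 1%N) ->
  ln (c n.-1 / c n) <= bmax -> bmin <= bmax.
Proof.
move=> h1 h2; apply: (le_trans h1); apply: (le_trans _ h2).
have c0 : 0 < c 0%N by exact: pos.
have c1 : 0 < c 1%N by apply: pos; nlia.
have h3 := @pm_nonincr _ (lexx _) n.-1 n (leq_pred n) (leqnn n).
have cn : 0 < c n by exact: pos.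
have cn1 : 0 < c n.-1 by apply: pos; nlia.
set b := ln (c 0%N / c 1%N) in h3 *.
rewrite -ler_expR lnK ?posrE ?divr_gt0 // ler_pdivlMr //.
move: h3; rewrite /pm ler_pM2r ?invr_gt0 ?partition_fun_gt0 //.
have -> : expR (b * n%:R) = expR b * expR (b * n.-1%:R).
  by rewrite -expRD -{1}(prednK (n := n)) ?(ltnW n2) // -natr1; congr expR; ring.
rewrite mulrA ler_pM2r ?expR_gt0 // mulrC //.
Qed.

Lemma Gamma_ge1 bmax : 1 <= Gamma c bmax.
Proof. by rewrite /Gamma le_max lexx orbT. Qed.

Lemma Gamma_ge bmax : bmax <= Gamma c bmax.
Proof. by rewrite /Gamma !le_max lexx. Qed.

Lemma Gamma_ratio bmax : c 1%N <= expR (Gamma c bmax) * c 0%N.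
Proof.
have c0 : 0 < c 0%N by exact: pos.
have c1 : 0 < c 1%N by apply: pos; nlia.
rewrite -ler_pdivrMr // -[X in X <= _]lnK ?posrE ?divr_gt0 // ler_expR.
by rewrite /Gamma !le_max lexx orbT.
Qed.

(** All consecutive ratios are at most [e^Gamma e^(- Gamma - 1) <= 1/2], so 0 alone carries half of
    the mass. The relevant range of [b] thus has width [O(Gamma)], however low [bmin] is. *)
Lemma cdf_low b bmax j : (1 <= j)%N -> (j <= n.+1)%N -> b <= - Gamma c bmax - 1 ->
  1/2 <= cdf n c b j.
Proof.
move=> j1 jn hb.
have a1 : pm n c b 1 <= 1/2 * pm n c b 0.
  rewrite /pm mulrA ler_pM2r ?invr_gt0 ?partition_fun_gt0 // mulr0 expR0 !mulr1.
  have h1 : expR b <= expR (- Gamma c bmax) * (1/2).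
    apply: (@le_trans _ _ (expR (- Gamma c bmax - 1))); first by rewrite ler_expR.
    rewrite expRD ler_wpM2l ?expR_ge0 // expRN.
    have := expR_ge1Dx (1 : R) => h; rewrite div1r lef_pV2 ?posrE ?expR_gt0 //.
  have h2 := ler_wpM2r (expR_ge0 (- Gamma c bmax)) (Gamma_ratio bmax).
  have h3 : expR (Gamma c bmax) * expR (- Gamma c bmax) = 1 by rewrite -expRD subrr expR0.
  have c1 : 0 < c 1%N by apply: pos; nlia.
  rewrite mulrAC h3 mul1r in h2.
  have := ler_wpM2l (ltW c1) h1; lra.
have dec x : (x < n)%N -> pm n c b x.+1 <= 1/2 * pm n c b x.
  move=> xn; have := @lc_ratio _ n (pm n c b) 0 x (lc_pm b) (leq0n _) xn.
  have := pm_gt0 pos b (leq0n n); have := pm_gt0 pos b (ltnW xn); nra.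
have S m : (m <= n)%N -> \sum_(1 <= x < m.+1) pm n c b x <= pm n c b 0 - pm n c b m.
  elim: m => [|m IH] hm; first by rewrite big_geq // subrr.
  rewrite big_nat_recr //=; have := IH (ltnW hm); have := dec _ hm; lra.
apply: (le_trans _ (cdf_mono pos b j1 jn)).
have h1 : 1 - cdf n c b 1 <= pm n c b 0.
  rewrite cdf_tail //; apply: (le_trans (S n _)) => //.
  by have := pm_gt0 pos b (leqnn n); lra.
have h2 : cdf n c b 1 = pm n c b 0 by rewrite /cdf big_nat1.
lra.
Qed.

(** In the constant 3, the growth of [c x] and the factor [e^(bmax x)] account for one each, and
    [ln (n + 1) <= n] for the last. Below, [Z bmin >= c 0] for every [bmin]. *)
Lemma log_ratio_le bmin bmax : bmin <= ln (c 0%N / c 1%N) ->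
  ln (c n.-1 / c n) <= bmax ->
  log_ratio n c bmin bmax <= 3 * (n%:R * Gamma c bmax).
Proof.
move=> h1 h2; set G := Gamma c bmax.
have c0 : 0 < c 0%N by exact: pos.
have G1 : 1 <= G by exact: Gamma_ge1.
have z1 := partition_fun_gt0 pos bmin; have z2 := partition_fun_gt0 pos bmax.
have hc x : (x <= n)%N -> c x <= c 0%N * expR (G * x%:R).
  elim: x => [|x IH] hx; first by rewrite mulr0 expR0 mulr1.
  have := @lc_ratio _ n (pm n c 0) 0 x (lc_pm 0) (leq0n _) hx.
  rewrite /pm !mul0r !expR0 !mulr1 => h.
  have z : 0 < (Z 0)^-1 by rewrite invr_gt0 partition_fun_gt0.
  have {}h : c x.+1 * c 0%N <= c 1%N * c x.
    rewrite -(ler_pM2r (mulr_gt0 z z)); nra.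
  rewrite -natr1 mulrDr mulr1 expRD.
  have h3 := Gamma_ratio bmax; rewrite -/G in h3.
  have h4 := IH (ltnW hx).
  have cx : 0 < c x by apply: pos; nlia.
  rewrite -(ler_pM2r c0); apply: (le_trans h).
  apply: (@le_trans _ _ ((expR G * c 0%N) * (c 0%N * expR (G * x%:R)))); last lra.
  by apply: ler_pM => //; [rewrite ltW // pos //; nlia | exact: ltW].
have hZ : Z bmax <= c 0%N * (n.+1%:R * expR (2 * (n%:R * G))).
  rewrite /partition_fun; apply: (@le_trans _ _ (\sum_(x < n.+1) c 0%N * expR (2 * (n%:R * G)))).
    apply: ler_sum => x _; have xn : (x <= n)%N by rewrite -ltnS.
    apply: (@le_trans _ _ (c 0%N * expR (G * x%:R) * expR (bmax * x%:R))).
      by apply: ler_wpM2r; [exact: expR_ge0 | exact: hc].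
    rewrite -mulrA ler_pM2l // -expRD ler_expR.
    have h3 : bmax <= G by exact: Gamma_ge.
    have h4 : (x%:R : R) <= n%:R by rewrite ler_nat.
    have h5 : (0 : R) <= x%:R by [].
    nra.
  by rewrite sumr_const card_ord -mulr_natl; lra.
have hz : c 0%N <= Z bmin.
  rewrite /partition_fun big_ord_recl /= mulr0 expR0 mulr1 lerDl.
  by apply: sumr_ge0 => i _; rewrite mulr_ge0 ?expR_ge0 // ltW // pos.
rewrite /log_ratio.
apply: (@le_trans _ _ (ln (n.+1%:R * expR (2 * (n%:R * G))))).
  rewrite ler_ln ?posrE ?divr_gt0 ?mulr_gt0 ?expR_gt0 //.
  rewrite ler_pdivrMr //; apply: (le_trans hZ); rewrite [X in X <= _]mulrC.
  by apply: ler_wpM2l => //; rewrite mulr_ge0 ?expR_ge0.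
rewrite lnM ?posrE ?expR_gt0 ?ltr0n // expRK.
have h3 : ln (n.+1%:R : R) <= n%:R.
  rewrite -ler_expR lnK ?posrE ?ltr0n // -natr1 addrC; exact: expR_ge1Dx.
have h4 : (n%:R : R) * 1 <= n%:R * G by apply: ler_wpM2l.
lra.
Qed.

End LogConcaveGibbs.

(** * Noisy search for a quantile *)

Section Bisection.
Context {R : realType}.
Variable test : nat -> prog R bool.

Fixpoint bisect d a : prog R nat :=
  if d is d'.+1 then
    bind (test (a + 2 ^ d')) (fun t => bisect d' (if t then a + 2 ^ d' else a)%N)
  else Ret a.

Fixpoint gallop fuel j : prog R nat :=
  if fuel is f.+1 then
    bind (test (2 ^ j)) (fun t =>
      if t then gallop f j.+1 else if j is j'.+1 then bisect j' (2 ^ j') else Ret 0%N)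
  else Ret 0%N.

Context (N : nat) (mu : R -> 'I_N -> R).
Hypothesis mu0 : forall b x, 0 <= mu b x.
Hypothesis mu1 : forall b, \sum_(x < N) mu b x = 1.

(* [U i]: the bracket may start at [i]; [D i]: it may end at [i].  Each grid
   point is tested at most once, so the errors [e] add up over the grid. *)
Variables (U D : nat -> Prop) (e : nat -> R).
Hypothesis UD : forall i, U i \/ D i.
Hypothesis e0 : forall i, 0 <= e i.
Hypothesis eU : forall i, ~ U i -> expect mu (test i) (fun t => t%:R) <= e i.
Hypothesis eD : forall i, ~ D i -> expect mu (test i) (fun t => (~~ t)%:R) <= e i.

Lemma sum_e_ge0 i j : 0 <= \sum_(i <= m < j) e m.
Proof. exact: sumr_ge0. Qed.

Lemma sum_e_sub i j i' j' : (i' <= i)%N -> (j <= j')%N -> (i <= j)%N ->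
  \sum_(i <= m < j) e m <= \sum_(i' <= m < j') e m.
Proof.
move=> h1 h2 h3; rewrite [X in _ <= X](@big_cat_nat _ _ _ i) //=; last nlia.
rewrite [X in _ + X](@big_cat_nat _ _ _ j) //=.
have := sum_e_ge0 i' i; have := sum_e_ge0 j j'; lra.
Qed.

(** Where [U i] and [D i] both hold, either answer leaves a valid bracket and nothing is charged;
    otherwise exactly one answer is wrong, at the price [e i]. *)
Lemma test_fail i S (f : bool -> prog R S) (Q : S -> Prop) (B1 B2 B : R) :
  fail mu (f true) Q <= B1 \/ ~ U i -> fail mu (f false) Q <= B2 \/ ~ D i ->
  B1 + e i <= B -> B2 + e i <= B -> fail mu (bind (test i) f) Q <= B.
Proof.
have := e0 i => ei H1 H2 h1 h2.
have [nU|U'] := pselect (~ U i).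
  have Di : D i by case: (UD i).
  have h2' : fail mu (f false) Q <= B2 by case: H2.
  have B20 : 0 <= B2 by apply: (le_trans _ h2'); exact: fail_ge0.
  apply: (le_trans (fail_bind mu0 mu1 _ (P := fun t : bool => ~~ t : Prop) B20 _)).
    by case.
  apply: (le_trans _ h2); rewrite addrC lerD2l.
  apply: (le_trans _ (eU nU)); apply: expect_le => // t.
  by case: asboolP; case: t.
have h1' : fail mu (f true) Q <= B1 by case: H1.
have [nD|D'] := pselect (~ D i).
  have B10 : 0 <= B1 by apply: (le_trans _ h1'); exact: fail_ge0.
  apply: (le_trans (fail_bind mu0 mu1 _ (P := fun t : bool => t : Prop) B10 _)).
    by case.
  apply: (le_trans _ h1); rewrite addrC lerD2l.
  apply: (le_trans _ (eD nD)); apply: expect_le => // t.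
  by case: asboolP; case: t.
have h2' : fail mu (f false) Q <= B2 by case: H2.
have B0 : 0 <= B by have := fail_ge0 mu0 mu1 (f true) Q; lra.
apply: (le_trans (fail_bind mu0 mu1 _ (P := fun t => True) B0 _)).
  by case=> _; lra.
by rewrite (fail_always mu0 mu1 (always_true N (test i))) add0r.
Qed.

Lemma bisect_fail d a : U a -> D (a + 2 ^ d)%N ->
  fail mu (bisect d a) (fun r => U r /\ D r.+1) <= \sum_(a.+1 <= m < a + 2 ^ d) e m.
Proof.
elim: d a => [|d IH] a Ua Da.
  rewrite expn0 addn1 in Da *; rewrite big_geq //= /fail /= asboolT //.
have d0 : (0 < 2 ^ d)%N by rewrite expn_gt0.
have E : (a + 2 ^ d.+1 = a + 2 ^ d + 2 ^ d)%N by rewrite expnS; nlia.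
rewrite /=; pose m := (a + 2 ^ d)%N; rewrite -/m.
apply: (@test_fail m _ _ _ (\sum_(m.+1 <= i < a + 2 ^ d.+1) e i) (\sum_(a.+1 <= i < m) e i)).
- have [Um|nU] := pselect (U m); last by right.
  by left; have := IH _ Um; rewrite E -/m => -> //; rewrite /m -E.
- by have [Dm|nD] := pselect (D m); [left; exact: IH | right].
- have -> : \sum_(m.+1 <= i < a + 2 ^ d.+1) e i + e m = \sum_(m <= i < a + 2 ^ d.+1) e i.
    by rewrite [RHS]big_ltn ?(addrC (e m)) //; rewrite /m E; nlia.
  by apply: sum_e_sub => //; rewrite /m ?E; nlia.
have -> : \sum_(a.+1 <= i < m) e i + e m = \sum_(a.+1 <= i < m.+1) e i.
  by rewrite big_nat_recr //=; rewrite /m; nlia.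
by apply: sum_e_sub => //; rewrite /m ?E; nlia.
Qed.

Lemma bisect_cost (r : R) d a : 0 <= r -> (forall i, cost mu (test i) <= r) ->
  cost mu (bisect d a) <= d%:R * r.
Proof.
move=> r0 H; elim: d a => [|d IH] a /=; first by rewrite mul0r.
apply: (le_trans (cost_bind_le mu0 mu1 (always_true N _) (C := d%:R * r) _)) => //.
by have := H (a + 2 ^ d)%N; rewrite -natr1 mulrDl mul1r; lra.
Qed.

(** Stands for the grid points at or below [bmin], where the answer is given without a query; they
    end the doubling within its fuel. *)
Variable fin : nat -> bool.
Hypothesis fin_test : forall i, fin i -> test i = Ret false.
Hypothesis fin_D : forall i, fin i -> D i.

Definition gallop_start j := if j is j'.+1 then (2 ^ j')%N else 0%N.

Lemma gallop_fail f j : fin (2 ^ (j + f)) -> U (gallop_start j) ->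
  fail mu (gallop f.+1 j) (fun r => U r /\ D r.+1) <=
  \sum_((gallop_start j).+1 <= m < (2 ^ (j + f)).+1) e m.
Proof.
have stop j' : U (gallop_start j') -> D (2 ^ j')%N ->
    fail mu (if j' is i.+1 then bisect i (2 ^ i) else Ret 0%N) (fun r => U r /\ D r.+1)
    <= \sum_((gallop_start j').+1 <= m < 2 ^ j') e m.
  case: j' => [|i] Us Ds; first by rewrite big_geq //= /fail /= asboolT.
  have E : (2 ^ i.+1 = 2 ^ i + 2 ^ i)%N by rewrite expnS; nlia.
  by rewrite E; apply: bisect_fail => //; rewrite -E.
have lt j' : ((gallop_start j').+1 <= 2 ^ j')%N.
  by case: j' => //= i; rewrite expnS; have : (0 < 2 ^ i)%N by [rewrite expn_gt0]; nlia.
elim: f j => [|f IH] j hf Us.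
  rewrite addn0 in hf *; rewrite /= fin_test //=.
  apply: (le_trans (stop _ Us (fin_D hf))); apply: sum_e_sub => //.
have hle : (2 ^ j <= 2 ^ (j + f.+1))%N by rewrite leq_exp2l // leq_addr.
have [hj|hj] := boolP (fin (2 ^ j)).
  rewrite /= fin_test //=.
  apply: (le_trans (stop _ Us (fin_D hj))); apply: sum_e_sub => //; nlia.
change (gallop f.+2 j) with (bind (test (2 ^ j)) (fun t =>
      if t then gallop f.+1 j.+1 else if j is j'.+1 then bisect j' (2 ^ j') else Ret 0%N)).
apply: (@test_fail _ _ _ _ (\sum_((2 ^ j).+1 <= m < (2 ^ (j + f.+1)).+1) e m)
  (\sum_((gallop_start j).+1 <= i < 2 ^ j) e i)).
- have [Um|nU] := pselect (U (2 ^ j)%N); last by right.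
  by left; have := IH j.+1; rewrite addSnnS; apply.
- by have [Dm|nD] := pselect (D (2 ^ j)%N); [left; exact: stop | right].
- rewrite addrC -big_ltn ?ltnS //; have ltj := lt j; apply: sum_e_sub => //; nlia.
by have ltj := lt j; rewrite -big_nat_recr //=; apply: sum_e_sub => //; nlia.
Qed.

(** From level [J] on, the doubling continues with probability at most 1/2, and stopping at level
    [j] costs at most [j] further samples: the bound is inductive because
    [1 + j + (j + 10) / 2 <= 2 j + 8]. *)
Lemma gallop_cost J f j : (forall i, cost mu (test i) <= 1) ->
  (forall i, (2 ^ J <= i)%N -> expect mu (test i) (fun t => t%:R) <= 1/2) ->
  cost mu (gallop f j) <= (J - j)%:R + 2 * (maxn j J)%:R + 8.
Proof.
move=> H1 H2; elim: f j => [|f IH] j.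
  by rewrite /=; have := ler0n R (J - j); have := ler0n R (maxn j J); lra.
rewrite [gallop f.+1 j]/= cost_bind; have := H1 (2 ^ j)%N.
have Hs : cost mu (if j is j'.+1 then bisect j' (2 ^ j') else Ret 0%N) <= j%:R.
  case: j => [|j] //=; apply: (le_trans (@bisect_cost 1 _ _ ler01 H1)).
  by rewrite mulr1 ler_nat.
have [hj|hj] := leqP J j; last first.
  set C : R := (J - j.+1)%:R + 2 * J%:R + 8.
  have : expect mu (test (2 ^ j)) (fun t => cost mu (if t then gallop f j.+1
      else if j is j'.+1 then bisect j' (2 ^ j') else Ret 0%N)) <= C.
    rewrite -[C](expect_const mu1 (test (2 ^ j))); apply: expect_le => // -[].
      by apply: (le_trans (IH j.+1)); rewrite /C (maxn_idPr hj).
    apply: (le_trans Hs); rewrite /C.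
    have : (j%:R : R) <= J%:R by rewrite ler_nat; nlia.
    have := ler0n R (J - j.+1); have := ler0n R J; lra.
  rewrite /C.
  have -> : (J - j = (J - j.+1).+1)%N by nlia.
  by rewrite -natr1; lra.
have h2 := H2 (2 ^ j)%N; rewrite leq_exp2l // in h2.
have {h2} := h2 hj.
have : expect mu (test (2 ^ j)) (fun t => cost mu (if t then gallop f j.+1
      else if j is j'.+1 then bisect j' (2 ^ j') else Ret 0%N)) <=
    expect mu (test (2 ^ j)) (fun t => j%:R + (j%:R + 10) * t%:R).
  apply: expect_le => // -[] /=; last by rewrite mulr0 addr0.
  apply: (le_trans (IH j.+1)).
  rewrite (_ : J - j.+1 = 0)%N; last nlia.
  rewrite (maxn_idPl (_ : J <= j.+1)%N) ?mulr1 ?(leqW hj) // -natr1; lra.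
rewrite expectD expect_const // expectZ (_ : J - j = 0)%N; last nlia.
have := ler0n R j; nra.
Qed.

End Bisection.

(** * Finding a point [b] with [P_b (X < k)] close to 1/4 *)

Section Search.
Context {R : realType}.
Variables (n : nat) (bmin bmax : R).

Definition clip (b : R) : R := Num.max bmin (Num.min b bmax).

Section Programs.
Variable k : nat.

(** The index is the depth below [bmax]: the answer [X >= k] suggests that [b] is still too large,
    so the search descends. *)
Definition coarse_test (i : nat) : prog R bool :=
  if bmax - i%:R <= bmin then Ret false
  else bind (sample (bmax - i%:R)) (fun x => Ret (k <= x)%N).

(** Ascending grid: it starts 8 below the coarse answer and, with at least [512 n] steps, ends at
    least 8 above it. *)
Definition fine_point (a i : nat) : R := clip (bmax - a%:R - 8 + i%:R / (32 * n%:R)).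

Definition fine_test (r a i : nat) : prog R bool :=
  bind (rep (sample (fine_point a i)) r)
    (fun s => Ret (r <= 4 * count (fun x => x < k) s)%N).

(** The upper end [i.+1] of the bracket is returned: [F <= 1/4 + 1/32] is known there, and the lower
    bound known at [i] loses at most 1/32 over one step. *)
Definition attempt (fuel d r : nat) : prog R R :=
  bind (gallop coarse_test fuel.+1 0) (fun a =>
  bind (bisect (fine_test r a) d 0) (fun i => Ret (fine_point a i.+1))).

End Programs.

Hypothesis bb : bmin <= bmax.

Lemma clip_range b : bmin <= clip b <= bmax.
Proof. by rewrite /clip le_max lexx /= ge_max bb ge_min lexx orbT. Qed.

Lemma clip_id b : bmin <= b <= bmax -> clip b = b.
Proof. by move=> /andP[h1 h2]; rewrite /clip min_l // max_r. Qed.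

Lemma clip_mono b b' : b <= b' -> clip b <= clip b'.
Proof. by move=> h; rewrite /clip ge_max !le_max lexx /= le_min !ge_min h lexx !orbT. Qed.

Lemma clip_low b : b <= bmin -> clip b = bmin.
Proof. by move=> h; rewrite /clip min_l ?max_l // (le_trans h bb). Qed.

Lemma clip_high b : bmax <= b -> clip b = bmax.
Proof. by move=> h; rewrite /clip min_r ?max_r. Qed.

Lemma clip_lip b b' : b <= b' -> clip b' - clip b <= b' - b.
Proof.
have clipP x : [\/ x <= bmin /\ clip x = bmin, bmax <= x /\ clip x = bmax
  | bmin <= x <= bmax /\ clip x = x].
  have [h|h] := leP x bmin; first by constructor 1; rewrite clip_low.
  have [h'|h'] := leP bmax x; first by constructor 2; rewrite clip_high.
  by constructor 3; rewrite clip_id !ltW.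
move=> h; have := bb.
case: (clipP b) => [] [h1 ->]; case: (clipP b') => [] [h2 ->]; lra.
Qed.

Variable c : nat -> R.
Hypothesis pos : positive_counts n c.
Hypothesis lc : log_concave n c.
Hypothesis n2 : (2 <= n)%N.

(** Queries are clipped by the oracle of the analysis, so every program is legal; the compiled
    algorithm clips in the same way before asking. *)
Definition law (b : R) : 'I_n.+1 -> R := gibbs c (clip b).

Lemma law_ge0 b x : 0 <= law b x.
Proof. exact: gibbs_ge0. Qed.

Lemma law_sum b : \sum_(x < n.+1) law b x = 1.
Proof. exact: gibbs_sum. Qed.

Lemma expect_law b f : bmin <= b <= bmax ->
  expect law (sample b) f = expect (gibbs c (n:=n)) (sample b) f.
Proof. by move=> h; rewrite /= /law clip_id. Qed.

Variable k : nat.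
Hypothesis k1 : (1 <= k)%N.
Hypothesis kn : (k <= n)%N.

Local Notation F b := (cdf n c b k).

Lemma coarse_true i : bmin < bmax - i%:R ->
  expect law (coarse_test k i) (fun t => t%:R) = 1 - F (bmax - i%:R).
Proof.
move=> h; rewrite /coarse_test leNgt h /= -(expect_sample_lt c (bmax - i%:R) (leqW kn)).
set f := fun x : nat => _.
have -> : 1 - expect (gibbs c (n:=n)) (sample (bmax - i%:R)) f =
    expect (gibbs c (n:=n)) (sample (bmax - i%:R)) (fun x => 1 + (-1) * f x).
  by rewrite expectD expectZ expect_const ?mulN1r //; exact: gibbs_sum.
rewrite /law clip_id; last by rewrite ltW //= gerBl.
rewrite /=; apply: eq_bigr => x _; rewrite /f (leqNgt k).
by case: (x < k)%N => /=; ring.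
Qed.

Lemma coarse_false i : bmin < bmax - i%:R ->
  expect law (coarse_test k i) (fun t => (~~ t)%:R) = F (bmax - i%:R).
Proof.
move=> h; rewrite /coarse_test leNgt h /= -(expect_sample_lt c (bmax - i%:R) (leqW kn)).
rewrite /law clip_id; last by rewrite ltW //= gerBl.
by rewrite /=; apply: eq_bigr => x _; rewrite (leqNgt k) negbK.
Qed.

(** An endpoint excuses the inequality that would call for moving beyond it. *)
Definition good_beta (t : R) (b : R) : Prop :=
  [/\ bmin <= b <= bmax, 1/4 - t <= F b \/ b = bmin & F b <= 1/4 + t \/ b = bmax].

Section Coarse.
Variable fuel : nat.
Hypothesis hfuel : bmax - (2 ^ fuel)%:R <= bmin.

(** The transition is put at 1/2 rather than 1/4 to make the odds bound symmetric: on both sides the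
    error is at most [e^(- distance)]. *)
Let far i := (1/2 <= F (bmax - i%:R)) || (bmax - i%:R <= bmin).
Let far_ex : exists i, far i.
Proof. by exists (2 ^ fuel)%N; rewrite /far hfuel orbT. Qed.
Let i0 := ex_minn far_ex.

Let i0_far : far i0.
Proof. by rewrite /i0; case: ex_minnP. Qed.

Let i0_lt i : (i < i0)%N -> F (bmax - i%:R) < 1/2 /\ bmin < bmax - i%:R.
Proof.
rewrite /i0; case: ex_minnP => m _ hm; rewrite ltnNge => /negP h; split; rewrite ltNge;
  by apply/negP => h'; apply: h; apply: hm; rewrite /far h' ?orbT.
Qed.

Lemma expRN_half d : expR (- d%:R) <= (1/2) ^+ d :> R.
Proof.
rewrite -mulN1r mulrC expRM_natl; apply: lerXn2r; rewrite ?nnegrE ?expR_ge0 //.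
rewrite expRN div1r lef_pV2 ?posrE ?expR_gt0 //.
by have := expR_ge1Dx (1 : R); lra.
Qed.

Let F_before i : (i < i0)%N -> F (bmax - i%:R) <= expR (- (i0.-1 - i)%:R).
Proof.
move=> hi; have [h1 _] := i0_lt (i := i0.-1) ltac:(nlia).
have hb : bmax - i0.-1%:R <= bmax - i%:R by rewrite lerD2l lerN2 ler_nat; nlia.
have := cdf_odds pos hb (leqW kn).
rewrite (_ : bmax - i%:R - (bmax - i0.-1%:R) = (i0.-1 - i)%:R); last first.
  by rewrite natrB; [ring | nlia].
move=> h; rewrite expRN -(ler_pM2r (expR_gt0 (i0.-1 - i)%:R)) mulVf ?gt_eqF ?expR_gt0 //.
set f := F (bmax - i%:R) in h *; set g := F (bmax - i0.-1%:R) in h h1.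
have f0 : 0 <= f by apply: cdf_ge0 => //; exact: leqW.
have f1 : f <= 1 by apply: cdf_le1 => //; exact: leqW.
have g0 : 0 <= g by apply: cdf_ge0 => //; exact: leqW.
set E := expR _ in h *.
have E0 : 0 < E by exact: expR_gt0.
have : 0 <= f * E by rewrite mulr_ge0 // ltW.
nra.
Qed.

Let F_after i : (i0 <= i)%N -> bmin < bmax - i%:R ->
  1 - F (bmax - i%:R) <= expR (- (i - i0)%:R).
Proof.
move=> hi hm; have h1 : 1/2 <= F (bmax - i0%:R).
  case/orP: i0_far => // h; exfalso.
  have : bmax - i%:R <= bmax - i0%:R by rewrite lerD2l lerN2 ler_nat.
  by lra.
have hb : bmax - i%:R <= bmax - i0%:R by rewrite lerD2l lerN2 ler_nat; nlia.
have := cdf_odds pos hb (leqW kn).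
rewrite (_ : bmax - i0%:R - (bmax - i%:R) = (i - i0)%:R); last first.
  by rewrite natrB //; ring.
move=> h; rewrite expRN -(ler_pM2r (expR_gt0 (i - i0)%:R)) mulVf ?gt_eqF ?expR_gt0 //.
set f := F (bmax - i%:R) in h *; set g := F (bmax - i0%:R) in h h1.
have f0 : 0 <= f by apply: cdf_ge0 => //; exact: leqW.
have f1 : f <= 1 by apply: cdf_le1 => //; exact: leqW.
have g1 : g <= 1 by apply: cdf_le1 => //; exact: leqW.
set E := expR _ in h *.
have E0 : 0 < E by exact: expR_gt0.
have : 0 <= (1 - f) * E by rewrite mulr_ge0 ?subr_ge0 // ltW.
nra.
Qed.

(** Within distance 5 of [i0] both answers are acceptable, so no error is charged. The two geometric
    tails beyond start at [(1/2)^5] and [(1/2)^6] and sum to [1/16 + 1/32 = 3/32]. *)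
Let el i : R := if (i + 5 < i0)%N then (1/2) ^+ (i0.-1 - i) else 0.
Let er i : R := if (i0 + 5 < i)%N then (1/2) ^+ (i - i0) else 0.

Let halve (S q : R) : S <= 1/2 * q -> S + 1/2 * q <= q.
Proof. lra. Qed.

Let halve' (S p q : R) : S <= p - q -> S + 1/2 * q <= p - 1/2 * q.
Proof. lra. Qed.

Let suml B : \sum_(0 <= i < B) el i <= (1/2) ^+ (maxn (i0 - B) 5).-1.
Proof.
elim: B => [|B IH]; first by rewrite big_geq.
rewrite big_nat_recr //= /el; case: ifP => h.
  have -> : (maxn (i0 - B.+1) 5).-1 = (i0 - B.+1).-1 by nlia.
  have E : (i0 - B).-1 = ((i0 - B.+1).-1).+1 by nlia.
  move: IH; have -> : (maxn (i0 - B) 5).-1 = ((i0 - B.+1).-1).+1 by nlia.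
  have -> : (i0.-1 - B = ((i0 - B.+1).-1).+1)%N by nlia.
  by rewrite exprS => /halve.
rewrite addr0; move: IH.
by have -> : (maxn (i0 - B) 5).-1 = (maxn (i0 - B.+1) 5).-1 by nlia.
Qed.

Let sumr B : \sum_(0 <= i < B) er i <= (1/2) ^+ 5 - (1/2) ^+ (maxn (B.-1 - i0) 5).
Proof.
elim: B => [|B IH]; first by rewrite big_geq // (_ : maxn _ _ = 5%N) ?subrr //; nlia.
rewrite big_nat_recr //= /er; case: ifP => h.
  have -> : maxn (B - i0) 5 = (B - i0)%N by nlia.
  move: IH; have -> : maxn (B.-1 - i0) 5 = (B.-1 - i0)%N by nlia.
  have -> : (B - i0 = (B.-1 - i0).+1)%N by nlia.
  by rewrite [(1/2) ^+ (B.-1 - i0).+1]exprS => /halve'.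
rewrite addr0; apply: (le_trans IH).
have -> : maxn (B - i0) 5 = 5%N by nlia.
by have -> : maxn (B.-1 - i0) 5 = 5%N by nlia.
Qed.

(** A correct coarse search ends with [i0 - 6 <= a <= i0 + 5]. So depth [a + 7] is past the
    transition, and [a - 8] is at least two unit steps before [i0 - 1], which gives
    [F <= (1/2)^2]. *)
Definition coarse_good (a : nat) : Prop :=
  (1/2 <= F (clip (bmax - a%:R - 7)) \/ bmax - a%:R - 7 <= bmin) /\
  (F (clip (bmax - a%:R + 8)) <= 1/4 \/ bmax <= bmax - a%:R + 8).

Lemma coarse_fail : fail law (gallop (coarse_test k) fuel.+1 0) coarse_good <= 3/32.
Proof.
pose U i : Prop := (i <= i0 + 5)%N; pose D i : Prop := (i0 <= i + 5)%N.
have e0 i : 0 <= el i + er i by rewrite addr_ge0 // /el /er; case: ifP.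
have UD i : U i \/ D i.
  by rewrite /U /D; case: (leqP i (i0 + 5)) => h; [left | right; nlia].
have eU i : ~ U i -> expect law (coarse_test k i) (fun t => t%:R) <= el i + er i.
  move=> /negP; rewrite -ltnNge => hi.
  have [h|h] := leP (bmax - i%:R) bmin; first by rewrite /coarse_test h /=.
  rewrite coarse_true // /el /er hi; apply: (le_trans (F_after _ h)); first nlia.
  by apply: (le_trans (expRN_half _)); rewrite lerDr; case: ifP.
have eD i : ~ D i -> expect law (coarse_test k i) (fun t => (~~ t)%:R) <= el i + er i.
  move=> /negP; rewrite -ltnNge => hi.
  have [h2 h3] := i0_lt (i := i) ltac:(nlia).
  rewrite coarse_false // /el /er hi; apply: (le_trans (F_before _)); first nlia.
  by apply: (le_trans (expRN_half _)); rewrite lerDl; case: ifP.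
have finT i : bmax - i%:R <= bmin -> coarse_test k i = Ret false.
  by move=> h; rewrite /coarse_test h.
have finD i : bmax - i%:R <= bmin -> D i.
  move=> h; rewrite /D; apply: contraT; rewrite -ltnNge => hi.
  by have [_] := i0_lt (i := i) ltac:(nlia); rewrite ltNge h.
have H := gallop_fail law_ge0 law_sum UD e0 eU eD (fin := fun i => bmax - i%:R <= bmin)
  finT finD (f := fuel) (j := 0) hfuel (leq0n _).
apply: (le_trans (fail_weak law_ge0 _ (P := fun r => U r /\ D r.+1) _)); last first.
  apply: (le_trans H).
  rewrite big_split /=.
  have sub (f : nat -> R) B : (forall i, 0 <= f i) -> \sum_(1 <= i < B) f i <= \sum_(0 <= i < B) f i.
    move=> f0; case: B => [|B]; first by rewrite !big_geq.
    by rewrite [X in _ <= X]big_ltn // lerDr.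
  have l1 : \sum_(1 <= i < (2 ^ fuel).+1) el i <= 1/16.
    apply: (le_trans (sub _ _ _)); first by move=> i; rewrite /el; case: ifP.
    apply: (le_trans (suml _)); apply: (@le_trans _ _ ((1/2) ^+ 4)); last lra.
    apply: ler_wiXn2l; [by rewrite divr_ge0 | by lra | nlia].
  have l2 : \sum_(1 <= i < (2 ^ fuel).+1) er i <= 1/32.
    apply: (le_trans (sub _ _ _)); first by move=> i; rewrite /er; case: ifP.
    apply: (le_trans (sumr _)).
    by apply: (@le_trans _ _ ((1/2) ^+ 5)); [rewrite gerBl | lra].
  lra.
move=> a [/= Ua Da]; rewrite /U in Ua; rewrite /D in Da; split.
  have [h|h] := leP (bmax - a%:R - 7) bmin; [by right | left].
  rewrite clip_id; last by rewrite ltW //=; have := ler0n R a; lra.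
  have h1 : bmax - a%:R - 7 <= bmax - i0%:R.
    have : (i0%:R : R) <= (a + 7)%:R by rewrite ler_nat; nlia.
    by rewrite natrD; lra.
  case/orP: i0_far => h2; last lra.
  by apply: (le_trans h2); apply: cdf_anti => //; exact: leqW.
have [h|h] := leP bmax (bmax - a%:R + 8); [by right | left].
have a8 : (8 <= a)%N by rewrite -(ler_nat R); lra.
have h8 : bmax - a%:R + 8 = bmax - (a - 8)%:R by rewrite natrB //; ring.
have ha : (a - 8 < i0)%N by nlia.
have [h9 h10] := i0_lt ha.
rewrite h8 clip_id; last by rewrite ltW //= gerBl.
apply: (le_trans (F_before ha)); apply: (le_trans (expRN_half _)).
apply: (@le_trans _ _ ((1/2) ^+ 2)); last lra.
by apply: ler_wiXn2l; [rewrite divr_ge0 | lra | nlia].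
Qed.

End Coarse.

Lemma fine_point_range a i : bmin <= fine_point a i <= bmax.
Proof. exact: clip_range. Qed.

Lemma fine_point_step a i :
  fine_point a i <= fine_point a i.+1 /\
  n%:R * (fine_point a i.+1 - fine_point a i) <= 1/32.
Proof.
have n0 : (0 : R) < n%:R by rewrite ltr0n ltnW.
have h : bmax - a%:R - 8 + i.+1%:R / (32 * n%:R) =
    bmax - a%:R - 8 + i%:R / (32 * n%:R) + 1 / (32 * n%:R).
  by rewrite -natr1; field; rewrite gt_eqF.
have h0 : 0 < 1 / (32 * n%:R : R) by rewrite divr_gt0 // mulr_gt0.
split; first by apply: clip_mono; rewrite h lerDl ltW.
have := @clip_lip (bmax - a%:R - 8 + i%:R / (32 * n%:R))
  (bmax - a%:R - 8 + i.+1%:R / (32 * n%:R)).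
rewrite h lerDl => /(_ (ltW h0)); rewrite -/(fine_point a i) -h -/(fine_point a i.+1) h.
rewrite addrAC subrr add0r => h1.
apply: (@le_trans _ _ (n%:R * (1 / (32 * n%:R)))); first by rewrite ler_pM2l.
rewrite le_eqVlt; apply/orP; left; apply/eqP; field; rewrite gt_eqF //.
Qed.

Lemma count_dev b j r (eta sg : R) : bmin <= b <= bmax -> (j <= n.+1)%N ->
  0 < eta <= 2 -> sg = 1 \/ sg = -1 ->
  expect law (rep (sample b) r) (fun s => (r%:R * eta <=
    sg * ((count (fun x => x < j)%N s)%:R - r%:R * cdf n c b j))%R%:R) <=
  expR (- (r%:R * eta ^+ 2 / 8)).
Proof.
move=> hb jn heta hsg.
have E : expect law (sample b) (fun x => (x < j)%N%:R) = cdf n c b j.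
  by rewrite expect_law // expect_sample_lt.
have h1 : expect law (sample b) (fun x => (x < j)%N%:R) <= 1.
  by rewrite E; apply: cdf_le1.
have h2 := chernoff law_ge0 law_sum r h1 heta hsg.
rewrite !mulr1 in h2; apply: (le_trans _ h2); apply: expect_le => [|s]; first exact: law_ge0.
by rewrite -E.
Qed.

Definition fine_err (r : nat) : R := expR (- (r%:R * (1/32) ^+ 2 / 8)).

Lemma fine_fail a d r : (512 * n <= 2 ^ d)%N -> coarse_good a ->
  fail law (bisect (fine_test k r a) d 0)
    (fun i => good_beta (1/16) (fine_point a i.+1)) <= (2 ^ d)%:R * fine_err r.
Proof.
move=> hd [ca cb]; have n0 : (0 : R) < n%:R by rewrite ltr0n ltnW.
pose U i := 1/4 - 1/32 <= F (fine_point a i) \/ i = 0%N.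
pose D i := F (fine_point a i) <= 1/4 + 1/32 \/ i = (2 ^ d)%N.
have UD i : U i \/ D i.
  have [h|h] := leP (1/4 - 1/32) (F (fine_point a i)); first by left; left.
  by right; left; lra.
pose e := fun _ : nat => fine_err r.
have e0 i : 0 <= e i by exact: expR_ge0.
have EE : fine_err r = expR (- (r%:R * (1/32) ^+ 2 / 8)).
  by [].
have eta32 : 0 < (1/32 : R) <= 2.
  by apply/andP; split; lra.
have r0 : (0 : R) <= r%:R by [].
have eU i : ~ U i -> expect law (fine_test k r a i) (fun t => t%:R) <= fine_err r.
  move=> nU; rewrite /fine_test expect_bind EE.
  have h := @count_dev (fine_point a i) k r (1/32) 1 (fine_point_range a i) (leqW kn)
    eta32 (or_introl erefl).
  apply: (le_trans _ h); apply: expect_le => // [|s /=]; first exact: law_ge0.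
  have hF : F (fine_point a i) < 1/4 - 1/32.
    by rewrite ltNge; apply/negP => h'; apply: nU; left.
  case: leqP => // hc; rewrite (_ : r%:R * (1/32) <= _) //.
  have := ler_wpM2l r0 (ltW hF); move: hc; rewrite -(ler_nat R) natrM; lra.
have eD i : ~ D i -> expect law (fine_test k r a i) (fun t => (~~ t)%:R) <= fine_err r.
  move=> nD; rewrite /fine_test expect_bind EE.
  have h := @count_dev (fine_point a i) k r (1/32) (-1) (fine_point_range a i) (leqW kn)
    eta32 (or_intror erefl).
  apply: (le_trans _ h); apply: expect_le => // [|s /=]; first exact: law_ge0.
  have hF : 1/4 + 1/32 < F (fine_point a i).
    by rewrite ltNge; apply/negP => h'; apply: nD; left.
  case: leqP => //= hc; rewrite (_ : r%:R * (1/32) <= _) //.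
  have := ler_wpM2l r0 (ltW hF); move: hc; rewrite -(ltr_nat R) natrM; lra.
have H := bisect_fail law_ge0 law_sum (e := e) UD e0 eU eD (d := d) (a := 0%N)
  (or_intror erefl) (or_intror (add0n _)).
apply: (le_trans (fail_weak law_ge0 _ (P := fun r => U r /\ D r.+1) _)); last first.
  apply: (le_trans H); rewrite /e sumr_const_nat -[X in X <= _]mulr_natl ler_pM2r ?expR_gt0 //.
  by rewrite ler_nat leq_subr.
move=> i [Ui Di]; split; first exact: fine_point_range.
- case: Ui => [Ui|->].
    left; have [h1 h2] := fine_point_step a i.
    by have := cdf_lip pos h1 (leqW kn); lra.
  (* The bracket starts at 0: the returned point, of index 1, is still below [bmax - a - 7], as a
     fine step is at most 1. *)
  have [h|h] := leP (bmax - a%:R - 7) bmin.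
    right; apply: clip_low; apply: (le_trans _ h).
    have : (1%:R : R) / (32 * n%:R) <= 1.
      rewrite ler_pdivrMr ?mulr_gt0 // mul1r.
      have : (1 : R) <= n%:R by rewrite ler1n ltnW.
      lra.
    lra.
  case: ca => ca; last lra.
  left; apply: (@le_trans _ _ (1/2)); first lra.
  apply: (le_trans ca); apply: cdf_anti => //; last exact: leqW.
  apply: clip_mono.
  have : (1%:R : R) / (32 * n%:R) <= 1.
    rewrite ler_pdivrMr ?mulr_gt0 // mul1r.
    have : (1 : R) <= n%:R by rewrite ler1n ltnW.
    lra.
  lra.
case: Di => [Di|Di]; first by left; lra.
have hw : bmax - a%:R + 8 <= bmax - a%:R - 8 + i.+1%:R / (32 * n%:R).
  rewrite Di; have : 16 <= (2 ^ d)%:R / (32 * n%:R) :> R.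
    rewrite ler_pdivlMr ?mulr_gt0 //.
    by move: hd; rewrite -(ler_nat R) natrM; lra.
  lra.
case: cb => cb; last by right; apply: clip_high; lra.
left; apply: (@le_trans _ _ (1/4)); last lra.
apply: (le_trans _ cb); apply: cdf_anti => //; last exact: leqW.
exact: clip_mono.
Qed.

Lemma attempt_fail fuel d r : bmax - (2 ^ fuel)%:R <= bmin -> (512 * n <= 2 ^ d)%N ->
  fail law (attempt k fuel d r) (good_beta (1/16)) <= 3/32 + (2 ^ d)%:R * fine_err r.
Proof.
move=> hf hd; have e0 : 0 <= (2 ^ d)%:R * fine_err r by rewrite mulr_ge0 ?expR_ge0.
apply: (le_trans (fail_bind law_ge0 law_sum _ (P := coarse_good) e0 _)); last first.
  by rewrite lerD2r; exact: coarse_fail.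
move=> a ha; rewrite -[X in _ <= X]addr0.
apply: (le_trans (fail_bind law_ge0 law_sum _
  (P := fun i => good_beta (1/16) (fine_point a i.+1)) (lexx 0) _)).
  by move=> i hi; rewrite /fail /= asboolT.
by rewrite lerD2r; exact: fine_fail.
Qed.

Lemma attempt_range fuel d r :
  always n.+1 (attempt k fuel d r) (fun b => bmin <= b <= bmax).
Proof.
apply: (always_bind (always_true _ _)) => a _.
by apply: (always_bind (always_true _ _)) => i _; exact: fine_point_range.
Qed.

Lemma cost_sample b : cost law (sample b) = 1.
Proof. by rewrite /= big1 ?addr0 // => x _; rewrite mulr0. Qed.

Lemma attempt_cost fuel d r J : 2 * Gamma c bmax + 1 <= (2 ^ J)%:R ->
  cost law (attempt k fuel d r) <= 3 * J%:R + 8 + d%:R * r%:R.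
Proof.
move=> hJ.
apply: (le_trans (cost_bind_le law_ge0 law_sum (always_true _ _) (C := d%:R * r%:R) _)).
  move=> a _; rewrite (cost_bind0 law_sum) //.
  apply: (bisect_cost law_ge0 law_sum) => // i.
  by rewrite /fine_test (cost_bind0 law_sum) // (cost_rep law_sum) cost_sample mulr1.
rewrite lerD2r.
have := @gallop_cost R (coarse_test k) n.+1 law law_ge0 law_sum J fuel.+1 0.
rewrite subn0 max0n => H; have : J%:R + 2 * J%:R + 8 <= 3 * J%:R + 8 :> R by lra.
apply: le_trans; apply: H => i.
  rewrite /coarse_test; case: ifP => _ //=.
  by rewrite big1 ?addr0 // => x _; rewrite mulr0.
(* From depth [2 Gamma + 1] on, [b <= - Gamma - 1], and [cdf_low] bounds the chance of descending
   further by 1/2. *)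
move=> hi; have [h|h] := leP (bmax - i%:R) bmin.
  by rewrite /coarse_test h /= divr_ge0.
rewrite coarse_true //.
have hi' : (2 ^ J)%:R <= i%:R :> R by rewrite ler_nat.
have hG := Gamma_ge c bmax.
have := @cdf_low R n c pos lc n2 (bmax - i%:R) bmax k k1 (leqW kn) ltac:(lra).
lra.
Qed.

End Search.

(** * One point of the schedule *)

Section Schedule.
Context {R : realType}.
Variables (n : nat) (bmin bmax : R).
Variables (fuel d r V K : nat).

Definition emp (s : seq nat) (j : nat) : R := (count (fun x => x < j)%N s)%:R / V%:R.

(** The tolerance is [3/32 = 1/16 + 1/32], search error plus sampling error, so good points pass;
    one more sampling error puts every accepted point within 1/8 of 1/4. *)
Definition accept (k : nat) (b : R) (s : seq nat) : bool :=
  ((1/4 - 3/32 <= emp s k) || (b == bmin)) && ((emp s k <= 1/4 + 3/32) || (b == bmax)).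

(** The margin 1/32 absorbs the sampling error, so that the true mass up to the cut is at least 1/2.
    Starting at [k] keeps the block nonempty. *)
Definition quantile (k : nat) (s : seq nat) : nat :=
  minn n (k + find (fun z => 1/2 + 1/32 <= emp s z.+1) (iota k (n.+1 - k))).

Definition trial (k : nat) : prog R (R * seq nat) :=
  bind (attempt n bmin bmax k fuel d r) (fun b =>
  bind (rep (sample b) V) (fun s => Ret (b, s))).

(** The [V] samples of a trial serve both the verdict and the cut. The cut [n], which ends the
    schedule, is forced at [bmax] and also when the retries run out. *)
Fixpoint next_point (m k : nat) : prog R (R * nat) :=
  if m is m'.+1 then
    bind (trial k) (fun bs =>
      if accept k bs.1 bs.2 then Ret (bs.1, if bs.1 == bmax then n else quantile k bs.2)
      else next_point m' k)
  else Ret (bmax, n).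

Fixpoint sched (m k : nat) : prog R (seq (R * nat)) :=
  if m is m'.+1 then
    bind (next_point K k) (fun bz =>
      if (n <= bz.2)%N then Ret [:: bz]
      else bind (sched m' bz.2.+1) (fun l => Ret (bz :: l)))
  else Ret [::].

(* The first point of the schedule is [bmin]; only its cut is returned. *)
Definition schedule : prog R (nat * seq (R * nat)) :=
  bind (rep (sample bmin) V) (fun s =>
    let z := if bmin == bmax then n else quantile 0 s in
    if (n <= z)%N then Ret (z, [::]) else bind (sched n z.+1) (fun l => Ret (z, l))).

Hypothesis bb : bmin <= bmax.
Variable c : nat -> R.
Hypothesis pos : positive_counts n c.
Hypothesis lc : log_concave n c.
Hypothesis n2 : (2 <= n)%N.
Hypothesis V0 : (0 < V)%N.

Local Notation law := (law bmin bmax c (n:=n)).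
Local Notation F := (cdf n c).
Let law0 := law_ge0 bmin bmax pos.
Let law1 := law_sum bmin bmax pos.

Definition emp_ok (b : R) (s : seq nat) : Prop :=
  forall j, (j <= n.+1)%N -> `|emp s j - F b j| <= 1/32.

Definition emp_err : R := 2 * (n.+2)%:R * fine_err V.

Lemma emp_err_ge0 : 0 <= emp_err.
Proof. by rewrite mulr_ge0 ?expR_ge0. Qed.

Lemma emp_fail b : bmin <= b <= bmax -> fail law (rep (sample b) V) (emp_ok b) <= emp_err.
Proof.
move=> hb.
pose ind (sg : R) j (s : seq nat) : R := (V%:R * (1/32) <=
    sg * ((count (fun x => x < j)%N s)%:R - V%:R * F b j))%R%:R.
have V0' : (0 : R) < V%:R by rewrite ltr0n.
apply: (@le_trans _ _ (expect law (rep (sample b) V)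
    (fun s => \sum_(0 <= j < n.+2) (ind 1 j s + ind (-1) j s)))).
  apply: expect_le => // s; case: asboolP => [_|nok].
    by apply: sumr_ge0 => j _; rewrite addr_ge0 // ler0n.
  have [j [jn hj]] : exists j, (j <= n.+1)%N /\ 1/32 < `|emp s j - F b j|.
    apply: contrapT => h; apply: nok => j jn; rewrite leNgt; apply/negP => hj.
    by apply: h; exists j.
  have ji : j \in index_iota 0 n.+2 by rewrite mem_index_iota.
  rewrite (bigD1_seq j ji (iota_uniq _ _)) /=.
  apply: ler_wpDr; first by apply: sumr_ge0 => i _; rewrite addr_ge0 // ler0n.
  have E : (count (fun x => (x < j)%N) s)%:R - V%:R * F b j = V%:R * (emp s j - F b j).
    by rewrite /emp mulrBr mulrCA divff ?gt_eqF // mulr1.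
  rewrite /ind E [1 * (V%:R * _)]mul1r mulN1r -mulrN !ler_pM2l //.
  case: (leP (1/32) (emp s j - F b j)) => h1; first by apply: ler_wpDr; rewrite ?ler0n.
  rewrite (_ : (1/32 <= - (emp s j - F b j)) = true); first by apply: ler_wpDl; rewrite ?ler0n.
  by move: hj; rewrite ltr_normr => /orP[h2|/ltW] //; lra.
rewrite (expect_sum law1).
apply: (@le_trans _ _ (\sum_(0 <= j < n.+2) (2 * fine_err V))); last first.
  rewrite sumr_const_nat subn0 -[X in X <= _]mulr_natl /emp_err.
  by rewrite mulrCA mulrA.
apply: ler_sum_nat => j hj; rewrite expectD.
have h (sg : R) : sg = 1 \/ sg = -1 -> expect law (rep (sample b) V) (ind sg j) <= fine_err V.
  move=> hsg; rewrite (_ : fine_err V = expR (- (V%:R * (1/32) ^+ 2 / 8))).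
    by apply: (count_dev pos) => //; apply/andP; split; lra.
  by [].
have := h 1 (or_introl erefl); have := h (-1) (or_intror erefl); lra.
Qed.

Lemma trial_emp k :
  fail law (trial k) (fun bs => bmin <= bs.1 <= bmax /\ emp_ok bs.1 bs.2) <= emp_err.
Proof.
rewrite /trial /fail expect_bind -[emp_err](expect_const law1 (attempt n bmin bmax k fuel d r)).
apply: (expect_le_always law0 (attempt_range n bb k fuel d r)) => b hb.
rewrite expect_bind /=; apply: (le_trans _ (emp_fail hb)).
apply: expect_le => // s; case: asboolP => h1; case: asboolP => h2 //.
by case: h1.
Qed.

Lemma quantile_range j s : (j <= n)%N -> (j <= quantile j s <= n)%N.
Proof. by clear n2 V0 => jn; rewrite /quantile; nlia. Qed.

Lemma quantile_ok j b s : (j <= n)%N -> emp_ok b s -> F b j <= 7/8 ->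
  1/2 <= F b (quantile j s).+1 /\ F b (quantile j s) <= 7/8.
Proof.
clear n2 V0; move=> jn hs hj; rewrite /quantile; set P := fun z => _.
set f := find P _.
have hf : (f <= n.+1 - j)%N by rewrite /f -[X in (_ <= X)%N](size_iota j); exact: find_size.
split.
  have [hm|hm] := boolP (has P (iota j (n.+1 - j))).
    have hf' : (f < n.+1 - j)%N by rewrite -[X in (_ < X)%N](size_iota j) -has_find.
    have := nth_find 0%N hm; rewrite -/f nth_iota // => hP.
    have -> : minn n (j + f) = (j + f)%N by nlia.
    have := hs (j + f).+1 ltac:(nlia); rewrite ler_norml => /andP[h1 h2].
    rewrite /P in hP; lra.
  have -> : minn n (j + f) = n.
    by rewrite /f hasNfind // size_iota; nlia.
  by rewrite (cdf_top pos); lra.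
have [->|f0] := eqVneq f 0%N; first by rewrite addn0 (minn_idPr jn).
have hp : (f.-1 < f)%N by nlia.
have := before_find 0%N hp; rewrite nth_iota; last nlia.
set m := minn n (j + f).
have hm : (m <= (j + f.-1).+1)%N by rewrite /m; nlia.
move=> /negbT; rewrite /P -ltNge => h1.
have := hs (j + f.-1).+1 ltac:(nlia); rewrite ler_norml => /andP[h2 h3].
have := cdf_mono pos b hm ltac:(nlia); lra.
Qed.

Section Point.
Variable k : nat.
Hypothesis k1 : (1 <= k)%N.
Hypothesis kn : (k <= n)%N.
Hypothesis hfuel : bmax - (2 ^ fuel)%:R <= bmin.
Hypothesis hd : (512 * n <= 2 ^ d)%N.
Hypothesis small : 3/32 + (2 ^ d)%:R * fine_err r + emp_err <= 1/4.

Lemma trial_accept : fail law (trial k) (fun bs => accept k bs.1 bs.2) <= 1/4.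
Proof.
apply: (le_trans _ small); rewrite /trial.
apply: (le_trans (fail_bind law0 law1 _ (P := good_beta n bmin bmax c k (1/16)) emp_err_ge0 _)); last first.
  by rewrite lerD2r; apply: attempt_fail.
move=> b [hb h1 h2]; rewrite -[X in _ <= X]addr0.
apply: (le_trans (fail_bind law0 law1 _ (P := emp_ok b) (lexx 0) _)); last first.
  by rewrite lerD2r emp_fail.
move=> s hs; rewrite /fail /= asboolT // /accept.
have := hs k (leqW kn); rewrite ler_norml => /andP[h3 h4].
apply/andP; split.
  by case: h1 => [h1|->]; rewrite ?eqxx ?orbT //; apply/orP; left; lra.
by case: h2 => [h2|->]; rewrite ?eqxx ?orbT //; apply/orP; left; lra.
Qed.

Definition point_good (bz : R * nat) : Prop :=
  [/\ bmin <= bz.1 <= bmax, (k <= bz.2 <= n)%N,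
      F bz.1 k <= 3/8 \/ bz.1 = bmax, 1/8 <= F bz.1 k \/ bz.1 = bmin &
      if bz.1 == bmax then bz.2 = n else 1/2 <= F bz.1 bz.2.+1 /\ F bz.1 bz.2 <= 7/8].

(** Nothing is assumed about the search: accurate samples and acceptance are enough. *)
Lemma accept_good bs : bmin <= bs.1 <= bmax -> emp_ok bs.1 bs.2 -> accept k bs.1 bs.2 ->
  point_good (bs.1, if bs.1 == bmax then n else quantile k bs.2).
Proof.
case: bs => b s /= hb hs /andP[h1 h2].
have := hs k (leqW kn); rewrite ler_norml => /andP[h3 h4].
have h5 : F b k <= 3/8 \/ b = bmax.
  by case/orP: h2 => [h|/eqP]; [left; lra | right].
split=> //=.
- by case: ifP => _; rewrite ?kn ?leqnn //; exact: quantile_range.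
- by case/orP: h1 => [h|/eqP]; [left; lra | right].
case: (eqVneq b bmax) => // hne; apply: quantile_ok => //.
by case: h5 => [|h6]; [lra | rewrite h6 eqxx in hne].
Qed.

Lemma point_range m : always n.+1 (next_point m k) (fun bz => k <= bz.2 <= n)%N.
Proof.
clear n2 V0 hd hfuel small k1; elim: m => [|m IH] /=; first by rewrite kn leqnn.
apply: (always_bind (always_true _ _)) => -[b s] _ /=.
case: ifP => // _ /=; case: ifP => _; first by rewrite kn leqnn.
exact: quantile_range.
Qed.

Definition point_err m : R := 2 * emp_err + expR (- m%:R).

Lemma quarter_exp : 1/4 <= expR (-1) :> R.
Proof.
have h := expR_ge1Dx (- (1/2) : R).
rewrite (_ : (-1 : R) = - (1/2) + - (1/2)); last by field.
rewrite expRD; have h0 := expR_gt0 (- (1/2) : R); nra.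
Qed.

(** Either the samples of the first trial are inaccurate, or it is rejected and the rest must fail:
    [p (m + 1) <= emp_err + p m / 4], which [2 emp_err + e^(- m)] satisfies since
    [1/4 <= e^(-1)]. *)
Lemma point_fail m : fail law (next_point m k) point_good <= point_err m.
Proof.
have e0 := emp_err_ge0.
elim: m => [|m IH].
  rewrite /point_err oppr0 expR0; have := fail_le1 law0 law1 (next_point 0 k) point_good; lra.
pose acc bs := accept k bs.1 bs.2.
rewrite /fail /= expect_bind.
apply: (@le_trans _ _ (fail law (trial k) (fun bs => bmin <= bs.1 <= bmax /\ emp_ok bs.1 bs.2) +
   fail law (next_point m k) point_good * fail law (trial k) acc)).
  rewrite /fail -expectZ -expectD; apply: expect_le => // -[b s] /=.
  rewrite -/(fail law (next_point m k) point_good).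
  have f0 := fail_ge0 law0 law1 (next_point m k) point_good.
  rewrite /acc /=; case: ifP => hacc /=.
    rewrite (asboolT (P := true)) // mulr0 addr0.
    case: asboolP => h1; case: asboolP => h2 //.
    by exfalso; apply: h1; apply: (accept_good (bs := (b, s))); case: h2.
  rewrite (asboolF (P := false)) // mulr1.
  by case: asboolP => _; rewrite ?add0r // lerDr.
have h1 := trial_emp k; have h2 := trial_accept; rewrite -/acc in h2.
have h3 := fail_ge0 law0 law1 (next_point m k) point_good.
have h4 := fail_ge0 law0 law1 (trial k) acc.
rewrite /point_err (_ : - m.+1%:R = - m%:R + -1 :> R); last by rewrite mulrSr opprD.
rewrite expRD; rewrite /point_err in IH.
have h5 := quarter_exp; have h6 := expR_gt0 (- m%:R : R).
apply: (@le_trans _ _ (emp_err + (2 * emp_err + expR (- m%:R)) * (1/4))).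
  by apply: lerD => //; apply: ler_pM.
have := ler_wpM2l (ltW h6) h5; lra.
Qed.

(** Geometric retries: [(C + V) + 2 (C + V) / 4 <= 2 (C + V)]. *)
Lemma point_cost m (C : R) : cost law (attempt n bmin bmax k fuel d r) <= C ->
  cost law (next_point m k) <= 2 * (C + V%:R).
Proof.
move=> hC; have C0 : 0 <= C := le_trans (cost_ge0 law0 _) hC.
have V00 : (0 : R) <= V%:R by [].
have ht : cost law (trial k) <= C + V%:R.
  apply: (le_trans (cost_bind_le law0 law1 (attempt_range n bb k fuel d r) (C := V%:R) _)).
    move=> b hb; rewrite (cost_bind0 law1) // (cost_rep law1).
    by rewrite cost_sample mulr1.
  by rewrite lerD2r.
elim: m => [|m IH] /=; first by rewrite mulr_ge0 // addr_ge0.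
rewrite cost_bind.
have h : expect law (trial k) (fun bs => cost law (if accept k bs.1 bs.2
      then Ret (bs.1, if bs.1 == bmax then n else quantile k bs.2) else next_point m k)) <=
    2 * (C + V%:R) * fail law (trial k) (fun bs => accept k bs.1 bs.2).
  rewrite /fail -expectZ; apply: expect_le => // bs.
  case: ifP => hacc /=; first by rewrite asboolT // mulr0.
  by rewrite asboolF // mulr1.
have := trial_accept; have := fail_ge0 law0 law1 (trial k) (fun bs => accept k bs.1 bs.2).
nra.
Qed.

End Point.
End Schedule.

(** * The schedule *)

Section ScheduleFacts.
Context {R : realType}.
Variables (n : nat) (bmin bmax : R) (c : nat -> R).
Hypothesis bb : bmin <= bmax.
Hypothesis pos : positive_counts n c.
Hypothesis lc : log_concave n c.
Hypothesis n2 : (2 <= n)%N.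
Hypothesis hmin : bmin <= ln (c 0%N / c 1%N).
Hypothesis hmax : ln (c n.-1 / c n) <= bmax.

Local Notation F := (cdf n c).

(** [link_prev] and [link_next] bound both overlap means below by 1/8; [link_mid] and [link_step]
    give the distance [1/2 - 3/8 = 1/8] that [avg_progress] needs; [link_mass], [link_next] and
    [link_end] are the three masses of [lc_block]. *)
Record link (b' : R) (z' : nat) (b : R) (z : nat) : Prop := Link {
  link_le : b' <= b;
  link_range : bmin <= b <= bmax;
  link_cut : (z' < z <= n)%N;
  link_prev : F b' z' <= 7/8;
  link_mid : 1/2 <= F b' z'.+1;
  link_next : 1/8 <= F b z'.+1;
  link_mass : 1/16 <= F b z.+1 - F b z'.+1;
  link_step : F b z'.+1 <= 3/8 \/ b = bmax;
  link_end : F b z <= 7/8 \/ (z = n /\ b = bmax);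
  link_top : b = bmax -> z = n }.

Fixpoint good_sched (b' : R) (z' : nat) (l : seq (R * nat)) : Prop :=
  if l is (b, z) :: l' then link b' z' b z /\ good_sched b z l' else z' = n.

Definition sched_inv (b : R) (z : nat) : Prop :=
  [/\ bmin <= b <= bmax, b != bmax, (z < n)%N, 1/2 <= F b z.+1 & F b z <= 7/8].

Lemma point_link b' z' bz : sched_inv b' z' -> point_good n bmin bmax c z'.+1 bz ->
  link b' z' bz.1 bz.2.
Proof.
case: bz => b z [/= hb' hne zn h1 h2] [/= hb hz h3 h4 h5].
have hF : 1/8 <= F b z'.+1.
  case: h4 => // ->; apply: (@le_trans _ _ (1/2)); first lra.
  by apply: (le_trans h1); apply: (cdf_anti pos); [case/andP: hb' | nlia].
have hle : b' <= b.
  rewrite leNgt; apply/negP => hlt.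
  have := cdf_anti pos (ltW hlt) (leqW zn); case: h3 => [h3|h3]; first lra.
  by move: hlt; rewrite h3; case/andP: hb' => _ /le_lt_trans h /h; rewrite ltxx.
have htop : b = bmax -> z = n by move=> e; move: h5; rewrite e eqxx.
split=> //.
(* Last block: the mass from [z'] on is at least 1/8, and as the law at [bmax] is nondecreasing,
   dropping the point [z'] leaves at least half of it. *)
- have [e|e] := eqVneq b bmax.
    rewrite (htop e) (cdf_top pos); case: h3 => [h3|_]; first lra.
    have g1 : 1/8 <= 1 - F b z'.
      by have := cdf_anti pos hle (_ : z' <= n.+1)%N; rewrite (leqW (ltnW zn)) => /(_ isT); lra.
    have g2 : 1 - F b z'.+1 = 1 - F b z' - pm n c b z'.
      by rewrite /cdf big_nat_recr //=; ring.
    have g3 : pm n c b z' <= pm n c b z'.+1.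
      by rewrite e; apply: (pm_nondecr pos lc n2 hmax).
    have g4 : pm n c b z'.+1 <= 1 - F b z'.+1.
      have zn2 : (z'.+1 <= n.+1)%N by exact: leqW.
      rewrite (cdf_tail pos b zn2) big_ltn; last nlia.
      rewrite lerDl big_nat_cond sumr_ge0 // => x; rewrite andbT => hx.
      by apply: ltW; apply: pm_gt0 => //; nlia.
    lra.
  move: h5; rewrite (negPf e) => -[h5 h6]; case: h3 => [h3|h3]; first lra.
  by rewrite h3 eqxx in e.
- have [e|e] := eqVneq b bmax; first by right; split=> //; exact: htop.
  by left; move: h5; rewrite (negPf e) => -[].
Qed.

Lemma link_inv b' z' b z : link b' z' b z -> point_good n bmin bmax c z'.+1 (b, z) ->
  (z < n)%N -> sched_inv b z.
Proof.
move=> hl [/= hb hz h3 h4 h5] zn.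
have e : b != bmax.
  by apply/eqP => /(link_top hl) ezn; rewrite ezn ltnn in zn.
by move: h5; rewrite (negPf e) => -[h5 h6]; split.
Qed.

Section Run.
Variables (fuel d r V K : nat).
Hypothesis V0 : (0 < V)%N.
Hypothesis hfuel : bmax - (2 ^ fuel)%:R <= bmin.
Hypothesis hd : (512 * n <= 2 ^ d)%N.
Hypothesis small : 3/32 + (2 ^ d)%:R * fine_err r + emp_err n V <= 1/4 :> R.

Local Notation law := (law bmin bmax c (n:=n)).
Let law0 := law_ge0 bmin bmax pos.
Let law1 := law_sum bmin bmax pos.

Local Notation sched := (sched n bmin bmax fuel d r V K).
Local Notation schedule := (schedule n bmin bmax fuel d r V K).
Local Notation delta := (point_err n V K : R).

Lemma point_err_ge0 : 0 <= delta.
Proof. by rewrite addr_ge0 ?expR_ge0 // mulr_ge0 // emp_err_ge0. Qed.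

Lemma sched_fail m b' z' : sched_inv b' z' -> (n <= z' + m)%N ->
  fail law (sched m z'.+1) (good_sched b' z') <= m%:R * delta.
Proof.
elim: m b' z' => [|m IH] b' z' hi hm.
  by case: hi => _ _ zn; rewrite addn0 in hm; move: zn; rewrite ltnNge hm.
have d0 := point_err_ge0.
have zn : (z'.+1 <= n)%N by case: hi.
rewrite [sched _ _]/= mulrS mulrDl mul1r.
have md : 0 <= m%:R * delta by rewrite mulr_ge0.
apply: (le_trans (fail_bind law0 law1 _ (P := point_good n bmin bmax c z'.+1) md _)); last first.
  by rewrite lerD2r; apply: point_fail.
move=> [b z] hg /=; have hl := point_link hi hg; rewrite /= in hl.
case: leqP => hz.
  rewrite /fail /= asboolT //; split=> //.
  by have := link_cut hl; nlia.
rewrite -[X in _ <= X]addr0.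
apply: (le_trans (fail_bind law0 law1 _ (P := good_sched b z) (lexx 0) _)).
  by move=> l hgl; rewrite /fail /= asboolT.
rewrite lerD2r; apply: IH; first exact: (link_inv hl hg).
by have := link_cut hl; nlia.
Qed.

Definition good_start (z : nat) : Prop :=
  [/\ (z <= n)%N, 1/2 <= F bmin z.+1, F bmin z <= 7/8 \/ (z = n /\ bmin = bmax) &
    bmin = bmax -> z = n].

Definition good_schedule (zl : nat * seq (R * nat)) : Prop :=
  good_start zl.1 /\ good_sched bmin zl.1 zl.2.

Lemma schedule_fail :
  fail law schedule good_schedule <= emp_err n V + n%:R * delta.
Proof.
have hb : bmin <= bmin <= bmax by rewrite lexx bb.
have d0 : 0 <= n%:R * delta by rewrite mulr_ge0 // point_err_ge0.
apply: (le_trans (fail_bind law0 law1 _ (P := emp_ok n V c bmin) d0 _)); last first.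
  by rewrite lerD2r; apply: emp_fail.
move=> s hs; set z := if _ then _ else _.
have hz : good_start z.
  rewrite /z; case: (eqVneq bmin bmax) => e.
    by split=> //; [rewrite (cdf_top pos); lra | right].
  have [h1 h2] := quantile_ok pos (leq0n n) hs (ltac:(rewrite cdf0; lra)).
  have h3 : (quantile n V 0 s <= n)%N := geq_minl _ _.
  by split=> //; [left | move=> e'; rewrite e' eqxx in e].
have [h1 h2 h3 h4] := hz; lazy zeta.
case: leqP => hn.
  rewrite /fail /= asboolT //; split=> //=.
  by apply/eqP; rewrite eqn_leq h1.
rewrite -[X in _ <= X]addr0.
apply: (le_trans (fail_bind law0 law1 _ (P := good_sched bmin z) (lexx 0) _)).
  by move=> l hl; rewrite /fail /= asboolT.
rewrite lerD2r; apply: sched_fail; last exact: leq_addl.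
have e : bmin != bmax by apply/eqP => /h4 e'; rewrite e' ltnn in hn.
split=> //; case: h3 => [//|[e' _]]; by rewrite e' ltnn in hn.
Qed.

Fixpoint increasing (z' : nat) (l : seq (R * nat)) : Prop :=
  if l is (b, z) :: l' then (z' < z <= n)%N /\ increasing z l' else True.

Lemma increasing_size z' l : (z' <= n)%N -> increasing z' l -> (size l + z' <= n)%N.
Proof.
clear n2 V0 hd hfuel small; elim: l z' => [|[b z] l IH] z' hz' //= [hz hl].
by have := IH z ltac:(nlia) hl; nlia.
Qed.

Lemma sched_increasing m z' : (z' < n)%N -> always n.+1 (sched m z'.+1) (increasing z').
Proof.
elim: m z' => [|m IH] z' zn //=.
apply: (always_bind (point_range bmin bmax fuel d r V zn K)) => -[b z] /= hz.
case: leqP => hn /=; first by split.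
by apply: (always_bind (IH z hn)) => l hl /=; split.
Qed.

Lemma schedule_increasing :
  always n.+1 schedule (fun zl => (zl.1 <= n)%N /\ increasing zl.1 zl.2).
Proof.
apply: (always_bind (always_true _ _)) => s _; set z := if _ then _ else _.
have hz : (z <= n)%N.
  by rewrite /z; case: ifP => // _; exact: geq_minl.
lazy zeta; case: leqP => hn /=; first by split.
by apply: (always_bind (sched_increasing n hn)) => l hl /=; split.
Qed.

(** Wald's argument: the bound per point holds given the past, so it multiplies the expected number
    of points although the schedule is adaptive. *)
Lemma sched_cost m z' (C : R) : (z' < n)%N ->
  (forall k, (1 <= k)%N -> (k <= n)%N -> cost law (attempt n bmin bmax k fuel d r) <= C) ->
  cost law (sched m z'.+1) <= 2 * (C + V%:R) * expect law (sched m z'.+1) (fun l => (size l)%:R).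
Proof.
move=> zn hC; have C0 : 0 <= C := le_trans (cost_ge0 law0 _) (hC 1%N isT (ltnW n2)).
have CV : 0 <= 2 * (C + V%:R) by rewrite mulr_ge0 // addr_ge0.
elim: m z' zn => [|m IH] z' zn /=; first by rewrite mulr0.
rewrite cost_bind expect_bind.
have h1 : cost law (next_point n bmin bmax fuel d r V K z'.+1) <= 2 * (C + V%:R).
  by apply: point_cost => //; exact: hC.
set X := expect law _ (fun t => cost _ _); set Y := expect law _ (fun t => expect _ _ _).
suff : X <= 2 * (C + V%:R) * (Y - 1) by nra.
have -> : Y - 1 = expect law (next_point n bmin bmax fuel d r V K z'.+1) (fun bz =>
    expect law (if (n <= bz.2)%N then Ret [:: bz]
            else bind (sched m bz.2.+1) (fun l => Ret (bz :: l))) (fun l => (size l)%:R) + (-1)).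
  by rewrite expectD expect_const.
rewrite -expectZ; apply: expect_le => // -[b z] /=.
case: leqP => hz /=; first by rewrite subrr mulr0.
rewrite (cost_bind0 law1) // expect_bind /=.
apply: (le_trans (IH z hz)); apply: ler_wpM2l => //.
rewrite -[X in _ + X](expect_const law1 (sched m z.+1)) -expectD; apply: expect_le => // l.
by rewrite -natr1 addrK.
Qed.

Lemma schedule_cost (C : R) :
  (forall k, (1 <= k)%N -> (k <= n)%N -> cost law (attempt n bmin bmax k fuel d r) <= C) ->
  cost law schedule <= V%:R + 2 * (C + V%:R) * expect law schedule (fun zl => (size zl.2)%:R).
Proof.
move=> hC; rewrite cost_bind (cost_rep law1) cost_sample mulr1 lerD2l expect_bind -expectZ.
apply: expect_le => // s; set z := if _ then _ else _.
lazy zeta; case: leqP => hn /=; first by rewrite mulr0.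
rewrite (cost_bind0 law1) // expect_bind /=; exact: sched_cost.
Qed.

End Run.

(** The two terms have product at least 1/128, hence sum at least [2 / sqrt 128 > 1/8]. A link into
    [bmax] may be short, so it is set apart. *)
Lemma link_progress b' z' b z (l : R) : 0 < l -> link b' z' b z -> b != bmax ->
  1/8 <= l * (b - b') + (avg n c b - avg n c b') / l.
Proof.
move=> l0 h e.
have hs : F b z'.+1 <= 3/8 by case: (link_step h) => // e'; rewrite e' eqxx in e.
have hz : (z'.+1 <= n.+1)%N by have := link_cut h; nlia.
have hp := @avg_progress R n c pos b' b z'.+1 hz ltac:(have := link_mid h; lra).
have hD : 0 <= b - b' by rewrite subr_ge0 (link_le h).
set D := b - b' in hp hD *; set a := avg n c b - avg n c b' in hp *.
have a0 : 0 <= a.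
  rewrite leNgt; apply/negP => a0; nra.
have hq : D * a = (l * D) * (a / l) by field; rewrite gt_eqF.
have x0 : 0 <= l * D by rewrite mulr_ge0 // ltW.
have y0 : 0 <= a / l by rewrite divr_ge0 // ltW.
rewrite hq in hp; set x := l * D in hp x0 *; set y := a / l in hp y0 *.
rewrite leNgt; apply/negP => hlt.
have := sqr_ge0 (x - y); nra.
Qed.

(** Both terms telescope along the schedule; the extra 1/8 pays for the last link, into [bmax]. *)
Lemma good_sched_size b' z' l (la : R) : 0 < la -> b' <= bmax -> good_sched b' z' l ->
  (size l)%:R * (1/8) <= 1/8 + la * (bmax - b') + (n%:R - avg n c b') / la.
Proof.
move=> la0; elim: l b' z' => [|[b z] l IH] b' z' hb' /=.
  move=> _; rewrite mul0r.
  have : 0 <= la * (bmax - b') by rewrite mulr_ge0 ?subr_ge0 // ltW.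
  have : 0 <= (n%:R - avg n c b') / la.
    by rewrite divr_ge0 ?subr_ge0 ?(ltW la0) // (avg_len pos).
  lra.
move=> [h hl]; have [e|e] := eqVneq b bmax.
  have hz := link_top h e.
  case: l hl {IH} => [_|[b2 z2] l [h2 _]]; last first.
    by exfalso; have := link_cut h2; rewrite hz; nlia.
  rewrite /= mul1r.
  have : 0 <= la * (bmax - b') by rewrite mulr_ge0 ?subr_ge0 // ltW.
  have : 0 <= (n%:R - avg n c b') / la.
    by rewrite divr_ge0 ?subr_ge0 ?(ltW la0) // (avg_len pos).
  lra.
have hb : b <= bmax by case/andP: (link_range h).
have := IH b z hb hl; have := link_progress la0 h e.
rewrite -natr1 mulrDl mul1r !mulrBl; lra.
Qed.

(** The first link is counted separately, since [bmin] may be arbitrarily low; by [cdf_low] the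
    point it reaches is above [- Gamma - 1]. On the remaining width [3 Gamma], the weight
    [S / Gamma] bounds the two terms by [3 S] and [S]. In all, [1 + (1 + 32 S) <= 34 S]. *)
Lemma good_schedule_size zl (S : R) : good_schedule zl ->
  0 <= S -> S ^+ 2 = n%:R * Gamma c bmax -> (size zl.2)%:R <= 34 * S.
Proof.
case: zl => z0 l [/= hstart hl] S0 S2.
have G1 : 1 <= Gamma c bmax by exact: Gamma_ge1.
have Gb : bmax <= Gamma c bmax by exact: Gamma_ge.
have n1 : (1 : R) <= n%:R by rewrite ler1n ltnW.
set G := Gamma c bmax in S2 G1 Gb.
have S1 : 1 <= S.
  rewrite leNgt; apply/negP => h; have : S ^+ 2 < 1 by nra.
  nra.
case: l hl => [_|[b z] l /= [h hl]]; first by rewrite /= mulr_ge0.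
have hsz : (size l)%:R <= 1 + 32 * S.
  have [e|e] := eqVneq b bmax.
    have hz := link_top h e.
    case: l hl => [_|[b2 z2] l [h2 _]]; first by rewrite /=; lra.
    by exfalso; have := link_cut h2; rewrite hz; nlia.
  have hb : bmin <= b <= bmax := link_range h.
  have hs : F b z0.+1 <= 3/8 by case: (link_step h) => // e'; rewrite e' eqxx in e.
  have hlow : - G - 1 <= b.
    rewrite leNgt; apply/negP => hlt.
    have := @cdf_low R n c pos lc n2 b bmax z0.+1 isT _ (ltW hlt).
    have hz : (z0.+1 <= n.+1)%N by have := link_cut h; nlia.
    by move=> /(_ hz); lra.
  have la0 : 0 < S / G by rewrite divr_gt0; lra.
  have hbm : b <= bmax by case/andP: hb.
  have := good_sched_size la0 hbm hl.
  have k1 : S / G * (bmax - b) <= 3 * S.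
    apply: (@le_trans _ _ (S / G * (3 * G))); first by apply: ler_wpM2l; lra.
    by rewrite le_eqVlt; apply/orP; left; apply/eqP; field; lra.
  have k2 : (n%:R - avg n c b) / (S / G) <= S.
    rewrite ler_pdivrMr //; have := avg_ge0 pos b => ha.
    have -> : S * (S / G) = n%:R.
      by rewrite mulrA -expr2 S2; field; lra.
    lra.
  lra.
rewrite /= -natr1; lra.
Qed.

End ScheduleFacts.

(** * Estimation along a schedule *)

Section RealFacts.
Context {R : realType}.

Lemma ln_near (u t : R) : 0 <= t <= 1/2 -> `|u - 1| <= t -> 0 < u /\ `|ln u| <= 2 * t.
Proof.
move=> /andP[t0 t1]; rewrite ler_norml => /andP[h1 h2].
have u0 : 0 < u by lra.
split=> //; rewrite ler_norml; apply/andP; split; last first.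
  have := @le_ln1Dx R (u - 1); rewrite [1 + _]addrC subrK => h.
  by have := h ltac:(lra); lra.
have := @le_ln1Dx R (u^-1 - 1); rewrite [1 + _]addrC subrK lnV ?posrE // => h.
have ui : 0 < u^-1 by rewrite invr_gt0.
have := h ltac:(lra).
have : u^-1 - 1 <= 2 * t.
  rewrite -(ler_pM2r u0) mulrBl mulVf ?gt_eqF //; nra.
lra.
Qed.

(** Largest entry reached by at least half of the entries: a median without sorting. The default 0
    is harmless for estimates of positive numbers. *)
Definition med (s : seq R) : R :=
  \big[Num.max/0]_(v <- s | (size s <= 2 * count (fun u => (v <= u)%R) s)%N) v.

Lemma seq_min (s : seq R) : s != [::] -> exists2 v, v \in s & forall u, u \in s -> v <= u.
Proof.
elim: s => // a s IH _; have [->|/IH [v vs hv]] := eqVneq s [::].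
  by exists a; rewrite ?mem_head // => u; rewrite inE => /eqP ->.
have [h|h] := leP a v.
  exists a; rewrite ?mem_head // => u; rewrite inE => /predU1P[->//|/hv].
  exact: le_trans.
exists v; first by rewrite inE vs orbT.
by move=> u; rewrite inE => /predU1P[->|/hv //]; apply: ltW.
Qed.

Lemma bigmax_ge (P : pred R) (s : seq R) v : v \in s -> P v ->
  v <= \big[Num.max/0]_(u <- s | P u) u.
Proof.
elim: s => // a s IH; rewrite inE big_cons => /predU1P[<- -> |vs Pv].
  by rewrite le_max lexx.
by case: ifP => _; rewrite ?le_max IH ?orbT.
Qed.

Lemma bigmax_le_seq (P : pred R) (s : seq R) m : 0 <= m ->
  (forall v, v \in s -> P v -> v <= m) -> \big[Num.max/0]_(u <- s | P u) u <= m.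
Proof.
move=> m0; elim: s => [|a s IH] h; first by rewrite big_nil.
rewrite big_cons; have IH' := IH (fun v vs => h v (mem_behead (s := a :: s) vs)).
by case: ifP => // Pa; rewrite ge_max IH' h ?mem_head.
Qed.

Lemma med_between (s : seq R) (lo hi : R) : 0 <= hi ->
  (size s < 2 * count (fun u => (lo <= u <= hi)%R) s)%N -> lo <= med s <= hi.
Proof.
move=> hi0; set a := fun u : R => _; move=> hs; rewrite /med; apply/andP; split.
  have hne : seq.filter a s != [::].
    by apply/eqP => e; move: hs; rewrite -size_filter e /= muln0.
  have [v] := seq_min hne; rewrite mem_filter => /andP[/andP[v1 v2] vs] hv.
  apply: (le_trans v1); apply: bigmax_ge => //.
  apply: (leq_trans (ltnW hs)); rewrite leq_mul2l /=.
  rewrite (@eq_in_count _ a (predI a [in s])) => [|u us /=]; last by rewrite us andbT.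
  by apply: sub_count => u /= /andP[au us]; apply: hv; rewrite mem_filter au.
apply: bigmax_le_seq => // v vs hv.
rewrite leNgt; apply/negP => hlt.
have h : (count (fun u => (v <= u)%R) s + count a s <= size s)%N.
  rewrite -count_predUI (eq_count (a2 := pred0) (a1 := predI _ _)).
    by rewrite count_pred0 addn0 count_size.
  move=> u /=; apply/negP => /andP[h1 /andP[_ h2]].
  by have := le_lt_trans (le_trans h1 h2) hlt; rewrite ltxx.
by move: h hs hv; clear; set k := count _ _; set l := count a s => *; lia.
Qed.

(** Interval form, which medians preserve. *)
Lemma estimateP (eps a b : R) : 0 < b ->
  is_estimate eps a b <-> b * expR (- eps) <= a <= b * expR eps.
Proof.
move=> b0; split=> [[a0 _]|/andP[h1 h2]].
  rewrite ler_norml => /andP[h1 h2].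
  rewrite -[X in X * _]lnK ?posrE // -[X in X * expR eps]lnK ?posrE //.
  by rewrite -!expRD -[a]lnK ?posrE // !ler_expR; apply/andP; split; lra.
have a0 : 0 < a by apply: (lt_le_trans _ h1); rewrite mulr_gt0 ?expR_gt0.
split=> //; rewrite ler_norml; apply/andP; split.
  have := h1; rewrite -(@ler_ln R) ?posrE ?mulr_gt0 ?expR_gt0 //.
  by rewrite lnM ?posrE ?expR_gt0 // expRK; lra.
have := h2; rewrite -(@ler_ln R) ?posrE ?mulr_gt0 ?expR_gt0 //.
by rewrite lnM ?posrE ?expR_gt0 // expRK; lra.
Qed.

End RealFacts.

(** * Boosting by medians *)

Section Boost.
Context {R : realType} (N : nat) (mu : R -> 'I_N -> R).
Hypothesis mu0 : forall b x, 0 <= mu b x.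
Hypothesis mu1 : forall b, \sum_(x < N) mu b x = 1.
Variables (n : nat) (eps : R) (tgt : nat -> R).
Hypothesis tgt0 : forall x, (x <= n)%N -> 0 < tgt x.

Definition all_est (lo : nat) (h : nat -> R) : Prop :=
  forall x, (lo <= x <= n)%N -> is_estimate eps (h x) (tgt x).

Definition boost (p : prog R (nat -> R)) (m : nat) : prog R ('I_n.+1 -> R) :=
  bind (rep p m) (fun hs => Ret (fun x : 'I_n.+1 => med (map (fun h : nat -> R => h x) hs))).

(** One failure event covers all [x], so no union bound over [x] is paid. A median can be wrong only
    if half of the runs fail, twice the bound 1/4: this is [eta = 1]. *)
Lemma boost_fail p m : fail mu p (all_est 0) <= 1/4 ->
  fail mu (boost p m) (fun est => forall x, is_estimate eps (est x) (tgt x)) <=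
  expR (- (m%:R / 32)).
Proof.
move=> hp; pose bad h := ~~ `[< all_est 0 h >].
have E : expect mu p (fun h => (bad h)%:R) = fail mu p (all_est 0).
  by apply: expect_ext => h; rewrite /bad; case: asboolP.
have hq : expect mu p (fun h => (bad h)%:R) <= 1/4 by rewrite E.
have h1 : 0 < (1 : R) <= 2 by rewrite ltr01 ler1n.
have := chernoff mu0 mu1 m hq h1 (or_introl erefl).
rewrite (_ : m%:R * (1/4) * 1 ^+ 2 / 8 = m%:R / 32); last by field.
apply: le_trans; rewrite /fail expect_bind /=.
apply: (expect_le_always mu0 (rep_size N p m)) => hs hsz.
case: asboolP => [_|nok]; first by rewrite ler0n.
have hc : (m <= 2 * count bad hs)%N.
  rewrite leqNgt; apply/negP => hlt; apply: nok => x.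
  have xn : (x <= n)%N by rewrite -ltnS.
  apply/(estimateP _ _ (tgt0 xn)); apply: med_between.
    by rewrite mulr_ge0 ?expR_ge0 // ltW // tgt0.
  rewrite size_map hsz count_map.
  apply: (@leq_trans (2 * count (predC bad) hs)).
    by have := count_predC bad hs; rewrite hsz; clear -hlt; lia.
  rewrite leq_mul2l /=; apply: sub_count => h /=; rewrite /bad negbK => /asboolP hh.
  by apply/(estimateP _ _ (tgt0 xn)); apply: hh.
rewrite (_ : (_ <= 1 * _)%R) //.
have m0 : (0 : R) <= m%:R by [].
have := ler_wpM2l m0 hq.
by move: hc; rewrite -(ler_nat R) natrM; lra.
Qed.

Lemma boost_cost p m : cost mu (boost p m) = m%:R * cost mu p.
Proof. by rewrite (cost_bind0 mu1) // (cost_rep mu1). Qed.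

End Boost.

(** * Running products and block histograms *)

Section Walk.
Context {R : realType}.
Variables (n : nat) (bmin bmax : R).
Variables (Nw : nat) (Mh : nat -> nat).

(** Transports a histogram at [b] to [bmin] by [pm bmin x = (Z b / Z bmin) * pm b x * e^((bmin - b)
    x)]. *)
Definition block_est (b : R) (m : nat) (G : R) : prog R (nat -> R) :=
  bind (rep (sample b) m) (fun s =>
    Ret (fun x => G * ((count (pred1 x) s)%:R / m%:R) * expR ((bmin - b) * x%:R))).

Definition up_weight (b b2 : R) (z x : nat) : R :=
  Num.min 1 (expR ((b2 - b) * (x%:R - z%:R))).

Definition down_weight (b b2 : R) (z x : nat) : R :=
  Num.min 1 (expR (- ((b2 - b) * (x%:R - z%:R)))).

(* [G] is the running estimate of [Z b / Z bmin]. *)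
Fixpoint walk (b : R) (lo z : nat) (G : R) (l : seq (R * nat)) : prog R (nat -> R) :=
  bind (block_est b (Mh (z.+1 - lo)) G) (fun h =>
    if l is (b2, z2) :: l' then
      bind (rep (sample b) Nw) (fun s1 =>
      bind (rep (sample b2) Nw) (fun s2 =>
      bind (walk b2 z.+1 z2 (G * mean (up_weight b b2 z) s1 / mean (down_weight b b2 z) s2
                             * expR ((b2 - b) * z%:R)) l')
        (fun h' => Ret (fun x => if (x <= z)%N then h x else h' x))))
    else Ret h).

Variable c : nat -> R.
Hypothesis bb : bmin <= bmax.
Hypothesis pos : positive_counts n c.
Hypothesis lc : log_concave n c.
Hypothesis n2 : (2 <= n)%N.
Hypothesis hmin : bmin <= ln (c 0%N / c 1%N).
Hypothesis hmax : ln (c n.-1 / c n) <= bmax.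
Variables (eps B : R).
Hypothesis heps : 0 < eps < 1.
Hypothesis Nw0 : (0 < Nw)%N.
(** At relative error [eps / 8] the Chernoff exponent is [m p eps^2 / 512], and [p >= 1 / (64 s)] in
    a heavy block of size [s]; the exponent is thus at least [B]. *)
Hypothesis hM : forall s, (1 <= s)%N -> s%:R * B <= (Mh s)%:R * eps ^+ 2 / (64 * 512).

Local Notation law := (law bmin bmax c (n:=n)).
Local Notation F := (cdf n c).
Local Notation Z := (partition_fun n c).
Let law0 := law_ge0 bmin bmax pos.
Let law1 := law_sum bmin bmax pos.

Definition heavy (b : R) (lo z : nat) : Prop :=
  forall x, (lo <= x <= z)%N -> 1/64 <= (z.+1 - lo)%:R * pm n c b x.

Lemma start_heavy z : good_start n bmin bmax c z -> heavy bmin 0 z.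
Proof.
move=> [zn h1 h2 h3] x /andP[_ xz].
have := @lc_block R n (pm n c bmin) 0 x z (1/32) (lc_pm pos lc n2 bmin) (leq0n _) xz zn.
move=> H; have : 1/32 <= 2 * (z.+1 - 0)%:R * pm n c bmin x; last by lra.
apply: H; first lra.
- by rewrite -/(F bmin z.+1); lra.
- by right; apply: (pm_nonincr pos lc n2 hmin).
case: h2 => [h2|[e1 e2]].
  by left; rewrite -(cdf_tail pos); [lra | exact: leqW].
by right; rewrite e2; apply: (pm_nondecr pos lc n2 hmax).
Qed.

Lemma link_heavy b' z' b z : link n bmin bmax c b' z' b z -> heavy b z'.+1 z.
Proof.
move=> h x /andP[kx xz].
have zn : (z' < z <= n)%N := link_cut h.
have := @lc_block R n (pm n c b) z'.+1 x z (1/32) (lc_pm pos lc n2 b) kx xz.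
have zn' : (z <= n)%N by case/andP: zn.
move=> /(_ zn') H; have : 1/32 <= 2 * (z.+1 - z'.+1)%:R * pm n c b x; last by lra.
apply: H; first lra.
- rewrite -cdfB; last by case/andP: zn => hz _; rewrite ltnS ltnW.
  by have := link_mass h; lra.
- by left; have := link_next h; rewrite /cdf; lra.
case: (link_end h) => [h2|[e1 e2]].
  by left; rewrite -(cdf_tail pos); [lra | exact: leqW].
by right; rewrite e2; apply: (pm_nondecr pos lc n2 hmax).
Qed.

(** For [0 < h <= 1] with mean at least 1/8, [E h^2 <= E h <= 8 (E h)^2]. *)
Lemma weight_moments b (h : nat -> R) : bmin <= b <= bmax ->
  (forall x, 0 < h x <= 1) -> 1/8 <= expect law (sample b) h ->
  [/\ 0 < expect law (sample b) h,
      expect law (rep (sample b) Nw) (fun s => mean h s / expect law (sample b) h) = 1 &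
      expect law (rep (sample b) Nw) (fun s => (mean h s / expect law (sample b) h) ^+ 2)
        <= 1 + 8 / Nw%:R].
Proof.
move=> hb h01 hE; set w := expect _ _ h in hE *.
have w0 : 0 < w by lra.
split=> //.
  under [X in expect _ _ X]funext do rewrite mulrC.
  by rewrite expectZ (expect_mean law0 law1) // mulVf // gt_eqF.
have h2 : expect law (sample b) (fun x => h x ^+ 2) <= 8 * w ^+ 2.
  apply: (@le_trans _ _ w); last by nra.
  apply: expect_le => // x; have /andP[h1 h3] := h01 x; nra.
have := @expect_mean2 R n.+1 law law0 law1 nat (sample b) Nw h 8 Nw0 (ler0n _ _) h2.
rewrite -/w => h3.
under [X in expect _ _ X]funext do rewrite exprMn mulrC.
by rewrite expectZ -ler_pdivlMl ?invrK ?exprVn ?invrK ?exprn_gt0 // invr_gt0 exprn_gt0.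
Qed.

Lemma mean_gt0 (h : nat -> R) s : (forall x, 0 < h x) -> (0 < size s)%N -> 0 < mean h s.
Proof.
move=> h0; case: s => // x s _; rewrite /mean divr_gt0 // big_cons.
by apply: ltr_pwDl => //; apply: sumr_ge0 => y _; apply: ltW.
Qed.

Definition block_ok (b : R) (lo z : nat) (s : seq nat) (m : nat) : Prop :=
  forall x, (lo <= x <= z)%N ->
    `|(count (pred1 x) s)%:R / m%:R - pm n c b x| <= eps / 8 * pm n c b x.

Lemma Mh_gt0 s : 0 < B -> (1 <= s)%N -> (0 < Mh s)%N.
Proof.
move=> B0 s1; rewrite lt0n; apply/eqP => e; have := hM s1; rewrite e !mul0r.
have : (1 : R) <= s%:R by rewrite ler1n.
nra.
Qed.

Lemma block_fail b lo z : 0 < B -> bmin <= b <= bmax -> (lo <= z <= n)%N -> heavy b lo z ->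
  fail law (rep (sample b) (Mh (z.+1 - lo))) (fun s => block_ok b lo z s (Mh (z.+1 - lo)))
  <= (z.+1 - lo)%:R * (2 * expR (- B)).
Proof.
move=> B0 hb /andP[loz zn] hv; set sz := (z.+1 - lo)%N; set m := Mh sz.
have sz1 : (1 <= sz)%N by rewrite /sz subn_gt0 ltnS.
have m0 : (0 < m)%N by apply: Mh_gt0.
have m0' : (0 : R) < m%:R by rewrite ltr0n.
have /andP[e0 e1] := heps.
pose ind (sg : R) x (s : seq nat) : R := (m%:R * (eps / 8 * pm n c b x) <=
    sg * ((count (pred1 x) s)%:R - m%:R * pm n c b x))%R%:R.
apply: (@le_trans _ _ (expect law (rep (sample b) m)
    (fun s => \sum_(lo <= x < z.+1) (ind 1 x s + ind (-1) x s)))).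
  apply: expect_le => // s; case: asboolP => [_|nok].
    by apply: sumr_ge0 => j _; rewrite addr_ge0 // ler0n.
  have [x [hx hj]] : exists x, (lo <= x <= z)%N /\
      eps / 8 * pm n c b x < `|(count (pred1 x) s)%:R / m%:R - pm n c b x|.
    apply: contrapT => h; apply: nok => x hx; rewrite leNgt; apply/negP => hj.
    by apply: h; exists x.
  have xi : x \in index_iota lo z.+1 by rewrite mem_index_iota ltnS.
  rewrite (bigD1_seq x xi (iota_uniq _ _)) /=.
  apply: ler_wpDr; first by apply: sumr_ge0 => i _; rewrite addr_ge0 // ler0n.
  have E : (count (pred1 x) s)%:R - m%:R * pm n c b x =
      m%:R * ((count (pred1 x) s)%:R / m%:R - pm n c b x).
    by field; rewrite gt_eqF.
  set y := _ / _ - _ in hj E.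
  rewrite /ind E [1 * (m%:R * _)]mul1r mulN1r -mulrN !ler_pM2l //.
  case: (leP (eps / 8 * pm n c b x) y) => h1; first by apply: ler_wpDr; rewrite ?ler0n.
  rewrite (_ : (_ <= - y) = true); first by apply: ler_wpDl; rewrite ?ler0n.
  by move: hj; rewrite ltr_normr => /orP[h2|/ltW] //; move: (lt_trans h1 h2); rewrite ltxx.
rewrite (_ : (fun s => _) = (fun s => \sum_(0 <= i < sz) (ind 1 (i + lo)%N s + ind (-1) (i + lo)%N s))); last first.
  by apply/funext => s; rewrite -{1}(add0n lo) big_addn.
rewrite (expect_sum law1).
apply: (@le_trans _ _ (\sum_(0 <= i < sz) (2 * expR (- B)))); last first.
  by rewrite sumr_const_nat subn0 -[X in X <= _]mulr_natl.
apply: ler_sum_nat => i hi; rewrite expectD; set x := (i + lo)%N.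
have hx : (lo <= x <= z)%N by rewrite /x; move: hi; rewrite /sz; clear; lia.
have xn : (x <= n)%N by case/andP: hx => _ /leq_trans; apply.
have h (sg : R) : sg = 1 \/ sg = -1 -> expect law (rep (sample b) m) (ind sg x) <= expR (- B).
  move=> hsg.
  have Ep : expect law (sample b) (fun y => (pred1 x y)%:R) = pm n c b x.
    by rewrite expect_law // (expect_sample_eq c b xn).
  have hq : expect law (sample b) (fun y => (pred1 x y)%:R) <= pm n c b x by rewrite Ep.
  have heta : 0 < eps / 8 <= 2 by apply/andP; split; lra.
  have := chernoff law0 law1 m hq heta hsg; rewrite Ep => h1.
  apply: (le_trans h1); rewrite ler_expR lerN2.
  have h2 := hM sz1; rewrite -/m in h2.
  have h3 : 1/64 <= sz%:R * pm n c b x := hv x hx.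
  have s0 : (0 : R) < sz%:R by rewrite ltr0n.
  have p0 : 0 < pm n c b x by apply: pm_gt0.
  rewrite (_ : _ / 8 = 64 * (m%:R * eps ^+ 2 / (64 * 512)) * pm n c b x); last by field.
  apply: (@le_trans _ _ (64 * (sz%:R * B) * pm n c b x)); last first.
    by rewrite ler_pM2r // ler_pM2l.
  have := ler_wpM2l (ltW B0) h3; lra.
have := h 1 (or_introl erefl); have := h (-1) (or_intror erefl); lra.
Qed.

Let target x : R := pm n c bmin x.

(** Three factors lie within [eps / 8] of 1: both products and the histogram. Each costs at most
    [2 eps / 8] in the logarithm, [3 eps / 4] in all. *)
Lemma block_good b lo z G (P Q : R) s : (z <= n)%N ->
  G = Z b / Z bmin * P / Q -> `|P - 1| <= eps / 8 -> `|Q - 1| <= eps / 8 ->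
  block_ok b lo z s (Mh (z.+1 - lo)) ->
  forall x, (lo <= x <= z)%N ->
  is_estimate eps (G * ((count (pred1 x) s)%:R / (Mh (z.+1 - lo))%:R) * expR ((bmin - b) * x%:R))
    (target x).
Proof.
move=> zn EG hP hQ hok x hx; have := hok x hx; set y := _ / _; set p := pm n c b x => hy.
have /andP[e0 e1] := heps.
have xn : (x <= n)%N by case/andP: hx => _ /leq_trans; apply.
have p0 : 0 < p by exact: pm_gt0.
have z0 := partition_fun_gt0 pos b; have z1 := partition_fun_gt0 pos bmin.
have t0 : 0 < target x by exact: pm_gt0.
have e8 : 0 <= eps / 8 <= 1/2 by apply/andP; split; lra.
have [P0 lP] := ln_near e8 hP; have [Q0 lQ] := ln_near e8 hQ.
have hu : `|y / p - 1| <= eps / 8.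
  rewrite (_ : y / p - 1 = (y - p) / p); last by field; rewrite gt_eqF.
  by rewrite normrM normfV (gtr0_norm p0) ler_pdivrMr.
have [u0 lu] := ln_near e8 hu.
have -> : G * y * expR ((bmin - b) * x%:R) = target x * (P * Q^-1 * (y / p)).
  rewrite EG /target /p /pm.
  have cx : 0 < c x by exact: pos.
  have e2 : expR (bmin * x%:R) = expR ((bmin - b) * x%:R) * expR (b * x%:R).
    by rewrite -expRD; congr expR; ring.
  by rewrite e2; have eb := expR_gt0 (b * x%:R); field; rewrite !gt_eqF.
have Qi : 0 < Q^-1 by rewrite invr_gt0.
move: u0 lu; move: (y / p) => u u0 lu.
move: t0; move: (target x) => tx t0.
split=> //; first by do ?apply: mulr_gt0.
rewrite lnM ?posrE ?mulr_gt0 // lnM ?posrE ?mulr_gt0 // lnM ?posrE // lnV ?posrE //.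
rewrite addrC addrA addNr add0r.
move: lP lQ lu; rewrite !ler_norml => /andP[l1 l2] /andP[l3 l4] /andP[l5 l6].
by apply/andP; split; lra.
Qed.

Let v : R := 8 / Nw%:R.
(** Equals [E (P X - 1)^2] when [E X = 1] and [E X^2 = (1 + v)^k], as for a product [X] of [k]
    independent normalized means. *)
Definition drift (k : nat) (P : R) : R := (P - 1) ^+ 2 + P ^+ 2 * ((1 + v) ^+ k - 1).

Lemma drift_ge0 k P : 0 <= drift k P.
Proof.
rewrite addr_ge0 ?sqr_ge0 // mulr_ge0 ?sqr_ge0 // subr_ge0 exprn_ege1 //.
by rewrite lerDl divr_ge0.
Qed.

Lemma drift_far k P Q : ~~ ((`|P - 1| <= eps / 8) && (`|Q - 1| <= eps / 8)) ->
  1 <= (drift k P + drift k Q) / (eps / 8) ^+ 2.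
Proof.
have /andP[e0 _] := heps => hPQ.
rewrite ler_pdivlMr ?mul1r; last by rewrite exprn_gt0 // divr_gt0.
have big X : eps / 8 < `|X - 1| -> (eps / 8) ^+ 2 <= drift k X.
  move=> hX; apply: (@le_trans _ _ ((X - 1) ^+ 2)).
    by rewrite -[X in _ <= X]real_normK ?num_real //; apply: lerXn2r; rewrite ?nnegrE; lra.
  rewrite lerDl mulr_ge0 ?sqr_ge0 // subr_ge0 exprn_ege1 //.
  by rewrite lerDl divr_ge0.
move: hPQ; rewrite negb_and -!ltNge => /orP[hX|hX].
  by apply: ler_wpDr; [exact: drift_ge0 | exact: big].
by apply: ler_wpDl; [exact: drift_ge0 | exact: big].
Qed.

Lemma drift_step b (w : nat -> R) k (P : R) : bmin <= b <= bmax ->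
  (forall x, 0 < w x <= 1) -> 1/8 <= expect law (sample b) w ->
  expect law (rep (sample b) Nw) (fun s => drift k (P * (mean w s / expect law (sample b) w)))
  <= drift k.+1 P.
Proof.
move=> hb w01 hE; have [w0 m1 m2] := @weight_moments b w hb w01 hE.
set W := expect law (sample b) w in w0 m1 m2 *.
rewrite (_ : (fun s => _) = (fun s => (P ^+ 2 * (1 + v) ^+ k) * (mean w s / W) ^+ 2 +
   ((- (2 * P)) * (mean w s / W) + 1))); last by apply/funext => s; rewrite /drift; ring.
rewrite !expectD !expectZ (expect_const law1) m1.
have X0 : 0 <= P ^+ 2 * (1 + v) ^+ k.
  by rewrite mulr_ge0 ?sqr_ge0 // exprn_ge0 // addr_ge0 // divr_ge0.
have := ler_wpM2l X0 m2; rewrite -/v /drift (exprS (1 + v)); lra.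
Qed.

(* Optional stopping, run backwards: [drift] is the conditional second moment
   of the final product, so it dominates the probability that some running
   product leaves [1 - eps/8, 1 + eps/8]. *)
Lemma walk_fail b lo z G l (P Q : R) : 0 < B ->
  bmin <= b <= bmax -> (lo <= z <= n)%N -> heavy b lo z -> good_sched n bmin bmax c b z l ->
  0 < P -> 0 < Q -> G = Z b / Z bmin * P / Q ->
  fail law (walk b lo z G l) (all_est n eps target lo) <=
  (drift (size l) P + drift (size l) Q) / (eps / 8) ^+ 2 +
  (n.+1 - lo)%:R * (2 * expR (- B)).
Proof.
move=> B0; have /andP[e0 e1] := heps.
have E2 : 0 < (eps / 8) ^+ 2 by rewrite exprn_gt0 // divr_gt0.
have B2 : 0 <= 2 * expR (- B) by rewrite mulr_ge0 ?expR_ge0.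
elim: l b lo z G P Q => [|[b2 z2] l IH] b lo z G P Q hb hz hv hl P0 Q0 EG.
  have [hPQ|hPQ] := boolP ((`|P - 1| <= eps / 8) && (`|Q - 1| <= eps / 8)); last first.
    apply: (le_trans (fail_le1 law0 law1 _ _)); apply: ler_wpDr; first by rewrite mulr_ge0.
    exact: drift_far.
  have /andP[hP hQ] := hPQ; have /andP[loz zn] := hz.
  have D0 : 0 <= (drift 0 P + drift 0 Q) / (eps / 8) ^+ 2.
    by apply: divr_ge0; [rewrite addr_ge0 ?drift_ge0 | exact: ltW].
  rewrite /= in hl *; apply: ler_wpDl => //.
  rewrite -[X in _ <= X]addr0.
  apply: (le_trans (fail_bind law0 law1 _ (P := all_est n eps target lo) (lexx 0) _)).
    by move=> h hh; rewrite /fail /= asboolT.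
  rewrite lerD2r -[X in _ <= X]addr0 /block_est.
  apply: (le_trans (fail_bind law0 law1 _
    (P := fun s => block_ok b lo z s (Mh (z.+1 - lo))) (lexx 0) _)).
    move=> s hs; rewrite /fail /= asboolT // => x hx; apply: (block_good zn EG hP hQ hs).
    by rewrite hl.
  have e : (n.+1 - lo = z.+1 - lo)%N by rewrite hl.
  by rewrite lerD2r e; apply: block_fail.
have [hPQ|hPQ] := boolP ((`|P - 1| <= eps / 8) && (`|Q - 1| <= eps / 8)); last first.
  apply: (le_trans (fail_le1 law0 law1 _ _)); apply: ler_wpDr; first by rewrite mulr_ge0.
  exact: drift_far.
have /andP[hP hQ] := hPQ; have /andP[loz zn] := hz.
set D := (drift _ P + drift _ Q) / _.
have D0 : 0 <= D by apply: divr_ge0; [rewrite addr_ge0 ?drift_ge0 | exact: ltW].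
move: hl => [hlink hl].
have hb2 : bmin <= b2 <= bmax := link_range hlink.
have hcut := link_cut hlink.
have hble := link_le hlink.
rewrite [walk _ _ _ _ _]/=.
pose okb (h : nat -> R) := forall x, (lo <= x <= z)%N -> is_estimate eps (h x) (target x).
have hblock : fail law (block_est b (Mh (z.+1 - lo)) G) okb <=
    (z.+1 - lo)%:R * (2 * expR (- B)).
  rewrite -[X in _ <= X]addr0 /block_est.
  apply: (le_trans (fail_bind law0 law1 _
    (P := fun s => block_ok b lo z s (Mh (z.+1 - lo))) (lexx 0) _)).
    by move=> s hs; rewrite /fail /= asboolT //; exact: (block_good zn EG hP hQ hs).
  by rewrite lerD2r; apply: block_fail.
have rest0 : 0 <= D + (n.+1 - z.+1)%:R * (2 * expR (- B)).
  by rewrite addr_ge0 // mulr_ge0.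
apply: (le_trans (fail_bind law0 law1 _ (P := okb) rest0 _)); last first.
  have : (n.+1 - lo)%:R = (z.+1 - lo)%:R + (n.+1 - z.+1)%:R :> R.
    by rewrite -natrD; congr _%:R; clear -loz zn; lia.
  move=> ->; rewrite mulrDl; lra.
move=> h hh.
set w := up_weight b b2 z; set w' := down_weight b b2 z.
have w01 x : 0 < w x <= 1.
  by rewrite /w /up_weight lt_min ltr01 expR_gt0 ge_min lexx.
have w01' x : 0 < w' x <= 1.
  by rewrite /w' /down_weight lt_min ltr01 expR_gt0 ge_min lexx.
set W := expect law (sample b) w; set W' := expect law (sample b2) w'.
have hW : 1/8 <= W.
  rewrite /W expect_law //; apply: (le_trans _ (overlap_lo pos hble (leqW zn))).
  by have := link_prev hlink; lra.
have hW' : 1/8 <= W'.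
  rewrite /W' expect_law //; apply: (le_trans _ (overlap_hi pos hble zn)).
  exact: link_next hlink.
have W0 : 0 < W by lra.
have W0' : 0 < W' by lra.
have z0 := partition_fun_gt0 pos b; have z1 := partition_fun_gt0 pos bmin.
have z2' := partition_fun_gt0 pos b2.
have EW : W = Z b2 / Z b * expR (- ((b2 - b) * z%:R)) * W'.
  have e1' : W = expect (gibbs c (n:=n)) (sample b) w by exact: expect_law.
  have e2' : W' = expect (gibbs c (n:=n)) (sample b2) w' by exact: expect_law.
  by rewrite e1' e2'; exact: (overlap pos).
rewrite /fail expect_bind.
(* Averaging over [s1] advances [P] while [Q] still has [size l + 1] factors to come; [s2] then
   advances [Q]. *)
apply: (@le_trans _ _ (expect law (rep (sample b) Nw) (fun s1 =>
    (drift (size l) (P * (mean w s1 / W)) + drift (size l).+1 Q) / (eps / 8) ^+ 2 +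
    (n.+1 - z.+1)%:R * (2 * expR (- B))))); last first.
  rewrite expectD (expect_const law1) lerD2r /D /=.
  under [X in expect _ _ X]funext do rewrite mulrC.
  rewrite expectZ mulrC ler_pM2r ?invr_gt0 // expectD (expect_const law1) lerD2r.
  exact: drift_step.
apply: (expect_le_always law0 (rep_size n.+1 _ _)) => s1 hs1.
rewrite expect_bind.
apply: (@le_trans _ _ (expect law (rep (sample b2) Nw) (fun s2 =>
    (drift (size l) (P * (mean w s1 / W)) + drift (size l) (Q * (mean w' s2 / W'))) / (eps / 8) ^+ 2 +
    (n.+1 - z.+1)%:R * (2 * expR (- B))))); last first.
  rewrite expectD (expect_const law1) lerD2r.
  under [X in expect _ _ X]funext do rewrite mulrC.
  rewrite expectZ mulrC ler_pM2r ?invr_gt0 // expectD (expect_const law1) lerD2l.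
  exact: drift_step.
apply: (expect_le_always law0 (rep_size n.+1 _ _)) => s2 hs2.
have m1 : 0 < mean w s1.
  by apply: mean_gt0; [move=> x; case/andP: (w01 x) | rewrite hs1].
have m2 : 0 < mean w' s2.
  by apply: mean_gt0; [move=> x; case/andP: (w01' x) | rewrite hs2].
rewrite -/(fail _ _ _) -[X in _ <= X]addr0.
apply: (le_trans (fail_bind law0 law1 _ (P := all_est n eps target z.+1) (lexx 0) _)).
  move=> h' hh'; rewrite /fail /= asboolT // => x /andP[hx1 hx2].
  case: leqP => hxz; first by apply: hh; rewrite hx1.
  by apply: hh'; rewrite hxz.
rewrite lerD2r; apply: IH => //.
- exact: link_heavy hlink.
- by rewrite mulr_gt0 // divr_gt0.
- by rewrite mulr_gt0 // divr_gt0.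
rewrite EG EW expRN; have ez := expR_gt0 ((b2 - b) * z%:R).
by field; rewrite !gt_eqF.
Qed.

Lemma walk_cost b lo z G l (a : R) : 0 <= a -> (lo <= z <= n)%N -> increasing n z l ->
  (forall s, (Mh s)%:R <= a * s%:R + 1) ->
  cost law (walk b lo z G l) <=
  (2 * Nw%:R + 1) * (size l)%:R + 1 + a * (n.+1 - lo)%:R.
Proof.
move=> a0 + + ha; elim: l b lo z G => [|[b2 z2] l IH] b lo z G hz hl /=.
  rewrite (cost_bind0 law1) // (cost_bind0 law1) // (cost_rep law1) cost_sample mulr1.
  rewrite mulr0 add0r; apply: (le_trans (ha _)); rewrite addrC lerD2l.
  by apply: ler_wpM2l => //; rewrite ler_nat; clear -hz; lia.
have hc1 : cost law (block_est b (Mh (z.+1 - lo)) G) <= a * (z.+1 - lo)%:R + 1.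
  by rewrite (cost_bind0 law1) // (cost_rep law1) cost_sample mulr1.
set C := (2 * Nw%:R + 1) * (size l)%:R + 1 + a * (n.+1 - z.+1)%:R.
apply: (le_trans (cost_bind_le law0 law1 (always_true _ _) (C := Nw%:R + (Nw%:R + C)) _)).
  move=> h _; apply: (le_trans (cost_bind_le law0 law1 (always_true _ _) (C := Nw%:R + C) _)).
    move=> s1 _; apply: (le_trans (cost_bind_le law0 law1 (always_true _ _) (C := C) _)).
      move=> s2 _; rewrite (cost_bind0 law1) //; apply: IH; case: hl => // h1 h2.
    by rewrite (cost_rep law1) cost_sample mulr1.
  by rewrite (cost_rep law1) cost_sample mulr1.
have e : (n.+1 - lo)%:R = (z.+1 - lo)%:R + (n.+1 - z.+1)%:R :> R.
  by rewrite -natrD; congr _%:R; clear -hz; lia.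
rewrite e /C -natr1 mulrDr; lra.
Qed.

End Walk.

(** * The algorithm *)

Section Compile.
Context {R : realType}.
Variables (N : nat) (O : Type) (adj : R -> R) (q : R) (o0 : O) (p0 : prog R O).

(* State [None]: before the initial coin flip, which runs [p0] with
   probability [q] and otherwise stops at once. *)
Definition run_step (s : option (prog R O)) : action R N O (option (prog R O)) :=
  match s with
  | None => Draw 2%N (fun i : 'I_2 => if i == 0 then q else 1 - q)
              (fun i : 'I_2 => if i == 0 then Some p0 else Some (Ret o0))
  | Some (Ret o) => Stop o
  | Some (Ask b k) => Query (adj b) (fun x : 'I_N => Some (k (x : nat)))
  end.

Definition run_alg : algorithm R N O := Algorithm None run_step.

Lemma run_legal lo hi : 0 <= q <= 1 -> (forall b, lo <= adj b <= hi) -> legal run_alg lo hi.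
Proof.
move=> /andP[q0 q1] hadj; case=> [[o|b k]|] //=.
split; last by rewrite !big_ord_recl big_ord0 /= addr0 addrC subrK.
by move=> i; case: ifP => _ //; rewrite subr_ge0.
Qed.

Variable mu : R -> 'I_N -> R.
Hypothesis mu0 : forall b x, 0 <= mu b x.
Hypothesis mu1 : forall b, \sum_(x < N) mu b x = 1.
Hypothesis q01 : 0 <= q <= 1.

Local Notation law := (fun b => mu (adj b)).

(** Branching is finite, so runs have a maximal length, from which on [prob_within] is constant. *)
Fixpoint depth (p : prog R O) : nat :=
  if p is Ask _ k then (\max_(x < N) depth (k x)).+1 else 1%N.

Lemma prob_within_ge0 good t s : 0 <= prob_within (A := run_alg) mu good t s.
Proof.
elim: t s => //= t IH [[o|b k]|] /=; first by case: ifP.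
  by apply: sumr_ge0 => x _; rewrite mulr_ge0.
case/andP: q01 => q0 q1; apply: sumr_ge0 => i _; rewrite mulr_ge0 //.
by case: ifP => _ //; rewrite subr_ge0.
Qed.

Lemma prob_within_ex good p t : (depth p <= t)%N ->
  prob_within (A := run_alg) mu good t (Some p) = 1 - fail law p good.
Proof.
have law1 b : \sum_(x < N) law b x = 1 by exact: mu1.
elim: p t => [o|b k IH] [|t] //= ht.
  by rewrite /fail /=; case: asboolP; rewrite ?subr0 ?subrr.
rewrite ltnS in ht.
transitivity (\sum_(x < N) (law b x - law b x * fail law (k x) good)).
  apply: eq_bigr => x _; rewrite IH ?mulrBr ?mulr1 //; apply: leq_trans ht.
  exact: (leq_bigmax_cond (F := fun x : 'I_N => depth (k x))).
by rewrite sumrB law1.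
Qed.

Lemma run_prob good (g : R) : fail law p0 good <= g ->
  ((q * (1 - g))%:E <= output_prob run_alg mu good)%E.
Proof.
case/andP: q01 => q0 q1 hf.
have H : prob_within mu good (depth p0).+1 (start run_alg) <=
    fine (prob_within mu good (depth p0).+1 (start run_alg))%:E by [].
apply: (@le_trans _ _ (prob_within mu good (depth p0).+1 (start run_alg))%:E); last first.
  by apply: ereal_sup_ubound; exists (depth p0).+1.
rewrite lee_fin [prob_within _ _ _ _]/= !big_ord_recl big_ord0 /= addr0.
rewrite (prob_within_ex good (leqnn _)).
have := prob_within_ge0 good (depth p0) (Some (Ret o0)) => h.
have h1 : 0 <= (1 - q) * prob_within (A := run_alg) mu good (depth p0) (Some (Ret o0)).
  by rewrite mulr_ge0 // subr_ge0.
have h2 : q * (1 - g) <= q * (1 - fail law p0 good) by apply: ler_wpM2l => //; lra.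
lra.
Qed.

Lemma calls_within_cost p t : calls_within (A := run_alg) mu t (Some p) <= cost law p.
Proof.
have law0 b x : 0 <= law b x by exact: mu0.
elim: p t => [o|b k IH] [|t] //=.
  by apply: addr_ge0 => //; apply: sumr_ge0 => x _; rewrite mulr_ge0 // (cost_ge0 law0).
by rewrite lerD2l; apply: ler_sum => x _; apply: ler_wpM2l.
Qed.

Lemma run_calls (C : R) : q * cost law p0 <= C -> (expected_calls run_alg mu <= C%:E)%E.
Proof.
case/andP: q01 => q0 q1 hC.
have law0 b x : 0 <= law b x by exact: mu0.
apply: ge_ereal_sup => _ [t _ <-]; rewrite lee_fin.
case: t => [|t] /=.
  by apply: (le_trans _ hC); rewrite mulr_ge0 // (cost_ge0 law0).
rewrite !big_ord_recl big_ord0 /= addr0.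
have h1 := ler_wpM2l q0 (calls_within_cost p0 t).
have -> : calls_within (A := run_alg) mu t (Some (Ret o0)) = 0 by case: t {h1}.
rewrite mulr0; lra.
Qed.

End Compile.

(** * The full program *)

Section Full.
Context {R : realType}.
Variables (n : nat) (bmin bmax eps : R).
Variables (fuel d r V m : nat) (Nf Mh : nat -> nat).

Definition full : prog R ('I_n.+1 -> R) :=
  bind (schedule n bmin bmax fuel d r V V) (fun zl =>
    boost n (walk bmin (Nf (size zl.2)) Mh bmin 0 zl.1 1 zl.2) m).

Variable c : nat -> R.
Hypothesis bb : bmin <= bmax.
Hypothesis pos : positive_counts n c.
Hypothesis lc : log_concave n c.
Hypothesis n2 : (2 <= n)%N.
Hypothesis hmin : bmin <= ln (c 0%N / c 1%N).
Hypothesis hmax : ln (c n.-1 / c n) <= bmax.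
Hypothesis V0 : (0 < V)%N.
Hypothesis hfuel : bmax - (2 ^ fuel)%:R <= bmin.
Hypothesis hd : (512 * n <= 2 ^ d)%N.
Hypothesis small : 3/32 + (2 ^ d)%:R * fine_err r + emp_err n V <= 1/4 :> R.
Variable B : R.
Hypothesis heps : 0 < eps < 1.
Hypothesis B0 : 0 < B.
Hypothesis hB : n.+1%:R * (2 * expR (- B)) <= 1/8 :> R.
Hypothesis hM : forall s, (1 <= s)%N -> s%:R * B <= (Mh s)%:R * eps ^+ 2 / (64 * 512).
Hypothesis hN0 : forall t, (0 < Nf t)%N.
Hypothesis hN : forall t, (128 * 128) * t%:R <= (Nf t)%:R * eps ^+ 2.

Local Notation law := (law bmin bmax c (n:=n)).
Let law0 := law_ge0 bmin bmax pos.
Let law1 := law_sum bmin bmax pos.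

Definition sched_err : R := emp_err n V + n%:R * point_err n V V.

(** With [y = 8 t / Nf t <= eps^2 / 2048], each drift is at most [e^y - 1 <= 2 y], and
    [4 y <= eps^2 / 512]. The histograms use up the other 1/8 of the failure probability 1/4 of a
    walk. *)
Lemma drift_small t : (drift (Nf t) t (1 : R) + drift (Nf t) t 1) / (eps / 8) ^+ 2 <= 1/8.
Proof.
have /andP[e0 e1] := heps.
have e2 : 0 < eps ^+ 2 by rewrite exprn_gt0.
have e21 : eps ^+ 2 <= 1 by rewrite exprn_ile1 // ltW.
have N0 : (0 : R) < (Nf t)%:R by rewrite ltr0n.
rewrite /drift subrr expr0n /= add0r expr1n mul1r.
set y := t%:R * (8 / (Nf t)%:R) : R.
have y0 : 0 <= y by rewrite mulr_ge0 // divr_ge0.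
have hy : y <= eps ^+ 2 / (8 * 256).
  by rewrite /y mulrA ler_pdivrMr //; have := hN t; lra.
have h1 : (1 + 8 / (Nf t)%:R) ^+ t <= expR y.
  rewrite /y expRM_natl; apply: lerXn2r; rewrite ?nnegrE ?expR_ge0 //.
  exact: expR_ge1Dx.
have h2 : expR y <= 1 + 2 * y.
  have y4 : y <= 1/4 by lra.
  apply: (le_trans (expR_le_quad _)); first lra.
  nra.
rewrite ler_pdivrMr; last by rewrite exprn_gt0 // divr_gt0.
rewrite expr_div_n; lra.
Qed.

Lemma full_fail :
  fail law full (fun est => forall x : 'I_n.+1, is_estimate eps (est x) (gibbs c bmin x))
  <= sched_err + expR (- (m%:R / 32)).
Proof.
apply: (le_trans (fail_bind law0 law1 _ (P := good_schedule n bmin bmax c)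
  (expR_ge0 (- (m%:R / 32))) _)); last first.
  by rewrite lerD2r; apply: schedule_fail.
move=> [z l] [hs hl].
apply: (boost_fail law0 law1 (tgt := pm n c bmin)); first by move=> x; exact: pm_gt0.
have hz : (0 <= z <= n)%N by case: hs.
have hb : bmin <= bmin <= bmax by rewrite lexx bb.
have hv : heavy n c bmin 0 z := start_heavy pos lc n2 hmin hmax hs.
have hG : 1 = partition_fun n c bmin / partition_fun n c bmin * 1 / 1 :> R.
  by rewrite divff ?gt_eqF ?partition_fun_gt0 // divr1 mulr1.
have := @walk_fail R n bmin bmax (Nf (size l)) Mh c pos lc n2 hmax eps B heps (hN0 _) hM
  bmin 0 z 1 l 1 1 B0 hb hz hv hl ltr01 ltr01 hG.
have := drift_small (size l); have := hB; rewrite subn0 /= => h1 h2 h3.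
by apply: (le_trans h3); lra.
Qed.

Lemma schedule_ex_bound (f : nat -> R) (Tr A M : R) : 0 <= M ->
  (forall t : nat, t%:R <= Tr -> f t <= A) -> (forall t, (t <= n)%N -> f t <= A + M) ->
  (forall zl, good_schedule n bmin bmax c zl -> increasing n zl.1 zl.2 -> (zl.1 <= n)%N ->
     (size zl.2)%:R <= Tr) ->
  expect law (schedule n bmin bmax fuel d r V V) (fun zl => f (size zl.2)) <= A + M * sched_err.
Proof.
move=> M0 h1 h2 h3.
apply: (le_trans (expect_bound_always law0 law1 (schedule_increasing n bmin bmax fuel d r V V)
  (P := good_schedule n bmin bmax c) (f := fun zl => f (size zl.2)) (a := A) (M := M) _ _ M0)).
- by move=> zl [hz hi] hg; apply: h1; apply: h3.
- move=> zl [hz hi]; apply: h2; have := increasing_size hz hi.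
  by apply: leq_trans; exact: leq_addr.
by rewrite lerD2l; apply: ler_wpM2l => //; apply: schedule_fail.
Qed.

(** [T] bounds the length of good schedules only. The others have at most [n] points and, as
    [n^2 sched_err <= 1], add [O(1 / eps^2)] to the mean cost of a walk. *)
Lemma full_cost (a C T : R) : 0 <= a -> 0 <= T ->
  (forall s, (Mh s)%:R <= a * s%:R + 1) ->
  (forall t, (Nf t)%:R <= (128 * 128) * t%:R / eps ^+ 2 + 2) ->
  (forall k, (1 <= k)%N -> (k <= n)%N -> cost law (attempt n bmin bmax k fuel d r) <= C) ->
  (forall zl, good_schedule n bmin bmax c zl -> increasing n zl.1 zl.2 -> (zl.1 <= n)%N ->
     (size zl.2)%:R <= T) ->
  n%:R ^+ 2 * sched_err <= 1 ->
  cost law full <= V%:R + 2 * (C + V%:R) * (T + 1) +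
    m%:R * ((2 * 128 * 128) * (T ^+ 2 + 1) / eps ^+ 2 + 5 * T + 6 + a * n.+1%:R).
Proof.
move=> a0 T0 ha hNu hC hT hbad.
have /andP[e0 e1] := heps.
have e2 : 0 < eps ^+ 2 by rewrite exprn_gt0.
have ei : 1 <= (eps ^+ 2)^-1 by rewrite invf_ge1 // exprn_ile1 // ltW.
have m0 : (0 : R) <= m%:R by [].
have C0 : 0 <= C := le_trans (cost_ge0 law0 _) (hC 1%N isT (ltnW n2)).
have n1 : (1 : R) <= n%:R by rewrite ler1n ltnW.
have err0 : 0 <= sched_err.
  by rewrite addr_ge0 ?emp_err_ge0 // mulr_ge0 // addr_ge0 ?expR_ge0 // mulr_ge0 // emp_err_ge0.
have hbad1 : n%:R * sched_err <= 1.
  apply: (le_trans _ hbad); apply: ler_wpM2r => //; nra.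
rewrite /full cost_bind; apply: lerD.
  apply: (le_trans (schedule_cost bb pos n2 V V0 hfuel hd small hC)).
  rewrite lerD2l; apply: ler_wpM2l; first by rewrite mulr_ge0 // addr_ge0.
  apply: (le_trans (schedule_ex_bound (f := fun t => t%:R) (Tr := T) (A := T) (M := n%:R) _ _ _ _)) => //.
    by move=> t tn; apply: ler_wpDl => //; rewrite ler_nat.
  by rewrite lerD2l.
pose f (t : nat) : R := m%:R * ((2 * 128 * 128) / eps ^+ 2 * t%:R ^+ 2 + 5 * t%:R + 1 + a * n.+1%:R).
apply: (@le_trans _ _ (expect law (schedule n bmin bmax fuel d r V V) (fun zl => f (size zl.2)))).
  apply: (expect_le_always law0 (schedule_increasing n bmin bmax fuel d r V V)) => -[z l] [/= hz hi].
  rewrite (boost_cost law1); apply: ler_wpM2l => //.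
  have hz' : (0 <= z <= n)%N by rewrite hz.
  apply: (le_trans (walk_cost bmin bmax (Nf (size l)) pos bmin 1 a0 hz' hi ha)).
  rewrite subn0 lerD2r lerD2r.
  have := hNu (size l); have := ler0n R (size l); set t := (size l)%:R => t0 ht.
  have := ler_wpM2r t0 ht; rewrite -/t; lra.
have i0 : 0 < (eps ^+ 2)^-1 by lra.
have K0 : 0 <= (2 * 128 * 128) / eps ^+ 2 by lra.
have mono t (u : R) : 0 <= t -> t <= u ->
    (2 * 128 * 128) / eps ^+ 2 * t ^+ 2 + 5 * t <= (2 * 128 * 128) / eps ^+ 2 * u ^+ 2 + 5 * u.
  move=> t0 tu; have : t ^+ 2 <= u ^+ 2 by apply: lerXn2r; rewrite ?nnegrE //; lra.
  move=> h; have := ler_wpM2l (ltW i0) h; lra.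
apply: (le_trans (schedule_ex_bound (f := f) (Tr := T)
  (A := m%:R * ((2 * 128 * 128) / eps ^+ 2 * T ^+ 2 + 5 * T + 1 + a * n.+1%:R))
  (M := m%:R * ((2 * 128 * 128) / eps ^+ 2 * n%:R ^+ 2 + 5 * n%:R)) _ _ _ hT)).
- apply: mulr_ge0 => //; apply: addr_ge0; last by apply: mulr_ge0.
  by apply: mulr_ge0; [exact: K0 | exact: sqr_ge0].
- move=> t ht; apply: ler_wpM2l => //; rewrite !lerD2r; exact: mono.
- move=> t tn; rewrite /f -mulrDr; apply: ler_wpM2l => //.
  have h := @mono t%:R n%:R (ler0n _ _) ltac:(by rewrite ler_nat).
  have : 0 <= (2 * 128 * 128) / eps ^+ 2 * T ^+ 2.
    by apply: mulr_ge0; [apply: divr_ge0; [lra | exact: ltW] | exact: sqr_ge0].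
  lra.
have hE : ((2 * 128 * 128) / eps ^+ 2 * n%:R ^+ 2 + 5 * n%:R) * sched_err <= (2 * 128 * 128) / eps ^+ 2 + 5.
  have h := ler_wpM2l (ltW i0) hbad; lra.
have := ler_wpM2l m0 hE; lra.
Qed.

End Full.

(** * Choice of the parameters *)

Section Rounding.
Context {R : realType}.

Definition up (y : R) : nat := (Num.trunc y).+1.

Lemma up_ge (y : R) : 0 <= y -> y <= (up y)%:R.
Proof. by move=> /truncn_itv /andP[_ /ltW]. Qed.

Lemma up_le (y : R) : 0 <= y -> (up y)%:R <= y + 1.
Proof. by move=> /truncn_itv /andP[h _]; rewrite /up -natr1 lerD2r. Qed.

Lemma exp_half_le2 : expR (1/2) <= 2 :> R.
Proof. by apply: (le_trans (expR_le_quad _)); lra. Qed.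

Lemma exp1_ge2 : 2 <= expR 1 :> R.
Proof. by have := expR_ge1Dx (1 : R); lra. Qed.

Lemma ln2_ge : 1/2 <= ln 2 :> R.
Proof. by rewrite -ler_expR lnK ?posrE // exp_half_le2. Qed.

Lemma ln2_le : ln 2 <= 1 :> R.
Proof. by rewrite -ler_expR lnK ?posrE // exp1_ge2. Qed.

Lemma exp_half_pow d : expR (d%:R / 2) <= (2 ^ d)%:R :> R.
Proof.
rewrite (_ : d%:R / 2 = d%:R * (1/2)); last by field.
rewrite expRM_natl natrX; apply: lerXn2r; rewrite ?nnegrE ?expR_ge0 //.
exact: exp_half_le2.
Qed.

Lemma pow_le_exp d : (2 ^ d)%:R <= expR d%:R :> R.
Proof.
rewrite -[d%:R]mulr1 expRM_natl natrX; apply: lerXn2r; rewrite ?nnegrE ?expR_ge0 //.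
exact: exp1_ge2.
Qed.

Lemma nat_above (y : R) : 0 <= y -> exists k : nat, (0 < k)%N /\ y <= k%:R <= y + 1.
Proof. by move=> y0; exists (up y); rewrite up_ge // up_le. Qed.

Lemma pow2_above (y : R) : 1 <= y ->
  exists k : nat, y <= (2 ^ k)%:R /\ k%:R <= 2 * ln y + 1.
Proof.
move=> y1; have y0 : 0 < y by lra.
have l0 : 0 <= 2 * ln y by rewrite mulr_ge0 // ln_ge0.
have [k [_ /andP[k1 k2]]] := nat_above l0; exists k; split=> //.
apply: (le_trans _ (exp_half_pow _)); rewrite -[X in X <= _](lnK (x := y)) ?posrE //.
by rewrite ler_expR; lra.
Qed.

Lemma ln_sqr_le (s : R) : 1 <= s -> ln (s ^+ 2) <= 2 * s.
Proof.
move=> s1; rewrite lnXn; last lra.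
have := @le_ln1Dx R (s - 1); rewrite [1 + _]addrC subrK => h.
by have := h ltac:(lra); rewrite -[ln s *+ 2]mulr_natl; lra.
Qed.

(** [X] is the search cost up to its constant, [W] is [1 / eps^2], and [l], [L] are [ln n],
    [ln (1 / g)]. Monomials are compared, then generalized, to leave linear goals. *)
Lemma cost_arith (V X T W m N l L : R) : 1 <= T -> 2 <= N -> 1 <= W -> 1/2 <= l -> 1/2 <= L ->
  0 <= X -> 0 <= m <= 98 * L -> V <= 64 * 128 * 2100 * X ->
  V + 2 * (64 * 128 * 2100 * X) * (T + 1) +
    m * (2 * 128 * 128 * (T ^+ 2 + 1) * W + 5 * T + 6 + 64 * 512 * (8 * l) * W * (N + 1))
  <= 64 * 128 * 2100 * 5 * (X * T + L * (T ^+ 2 + N * l) * W).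
Proof.
move=> T1 N2 W1 l1 L1 X0 /andP[m0 m1] hV.
have T2 : T <= T ^+ 2 by rewrite expr2; apply: ler_peMl; lra.
have XT : X <= X * T by apply: ler_peMr.
have W0 : 0 <= W by lra.
have Tsq : 1 <= T ^+ 2 by lra.
have TW : T ^+ 2 <= T ^+ 2 * W by apply: ler_peMr => //; lra.
have NW : l * W * (N + 1) <= 2 * (N * l * W).
  have lW : 0 <= l * W by apply: mulr_ge0; lra.
  by have := ler_wpM2l lW N2; lra.
have WT : W <= T ^+ 2 * W by apply: ler_peMl.
move: T2 Tsq TW WT; move: (T ^+ 2) => Q T2 Tsq TW WT.
have NlW : 0 <= N * l * W by rewrite !mulr_ge0 //; lra.
set Y := 2 * 128 * 128 * (Q + 1) * W + 5 * T + 6 + 64 * 512 * (8 * l) * W * (N + 1).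
have hY : Y <= 16 * 128 * 256 * (Q * W + N * l * W) by rewrite /Y; lra.
have QN : 0 <= 16 * 128 * 256 * (Q * W + N * l * W) by lra.
have h1 : m * Y <= m * (16 * 128 * 256 * (Q * W + N * l * W)) by apply: ler_wpM2l.
have h2 := ler_wpM2r QN m1.
have P0 : 0 <= L * (Q * W + N * l * W) by apply: mulr_ge0; lra.
move: (m * Y) h1 => z h1.
have h3 : z <= 98 * (16 * 128 * 256) * (L * (Q * W + N * l * W)) by lra.
have h4 : 0 <= X * T by apply: mulr_ge0; lra.
have -> : L * (Q + N * l) * W = L * (Q * W + N * l * W) by ring.
have -> : 2 * (64 * 128 * 2100 * X) * (T + 1) = 64 * 128 * 2100 * (2 * (X * T) + 2 * X).
  by ring.
move: (L * (Q * W + N * l * W)) (X * T) h3 h4 XT P0 => P XT h3 h4 hXT P0.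
lra.
Qed.

End Rounding.

(** * Errors and cost at the chosen parameters *)

Section MainProgram.
Context {R : realType}.
Variables (n : nat) (bmin bmax eps g : R).
Hypothesis n2 : (2 <= n)%N.
Hypothesis bb : bmin <= bmax.
Hypothesis heps : 0 < eps < 1.
Hypothesis hg : 0 < g <= 1/2.

Local Notation l := (@ln R n%:R).
Local Notation L := (ln (1 / g)).

Lemma par_n_ge2 : 2 <= n%:R :> R.
Proof. by rewrite ler_nat. Qed.

Lemma par_eps2_gt0 : 0 < eps ^+ 2.
Proof. by case/andP: heps => e0 _; rewrite exprn_gt0. Qed.

Lemma par_eps2_inv_ge1 : 1 <= (eps ^+ 2)^-1.
Proof. by case/andP: heps => e0 e1; rewrite invf_ge1 ?par_eps2_gt0 // exprn_ile1 // ltW. Qed.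

Lemma par_ln_ge : 1/2 <= l.
Proof. by apply: (le_trans ln2_ge); rewrite ler_ln ?posrE ?ltr0n ?ler_nat // ltnW. Qed.

Lemma exp_ln_n : expR (- l) = n%:R^-1.
Proof. by rewrite expRN lnK ?posrE // ltr0n ltnW. Qed.

Lemma par_g_gt0 : 0 < g. Proof. by case/andP: hg. Qed.

Lemma exp_ln_g : expR (- L) = g.
Proof. by rewrite div1r lnV ?posrE ?par_g_gt0 // opprK lnK ?posrE ?par_g_gt0. Qed.

Lemma par_lng_ge : 1/2 <= L.
Proof.
apply: (le_trans ln2_ge); rewrite ler_ln ?posrE ?divr_gt0 ?par_g_gt0 // ler_pdivlMr ?par_g_gt0 //.
by case/andP: hg; lra.
Qed.

Lemma pow2_le_pow k : 2 ^+ k <= n%:R ^+ k :> R.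
Proof. by apply: lerXn2r; rewrite ?nnegrE ?ler_nat. Qed.

Lemma pow_n8_ge : 256 <= n%:R ^+ 8 :> R.
Proof. by apply: (le_trans _ (pow2_le_pow 8)); rewrite -natrX ler_nat. Qed.

Lemma exp_8ln : expR (- (8 * l)) = (n%:R ^+ 8)^-1.
Proof. by rewrite -mulrN expRM_natl exp_ln_n exprVn. Qed.

Lemma expN1_le_half : expR (- 1) <= 1/2 :> R.
Proof. by have := @expRN_half R 1; rewrite expr1. Qed.

Variables (fuel d r V m : nat) (Nf Mh : nat -> nat).
Hypothesis hfuel : bmax - (2 ^ fuel)%:R <= bmin.
Hypothesis hd : (512 * n <= 2 ^ d)%N.
Hypothesis hd_le : d%:R <= 40 * l :> R.
(** The factor [64 * 128 = 8 * 32^2] cancels the rate of [fine_err], which becomes [e^(- (d + 5))]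
    at [r] and at most [g / (2 n^8)] at [V]. *)
Hypothesis hr : r%:R = 64 * 128 * (d%:R + 5) :> R.
Hypothesis hV0 : (0 < V)%N.
Hypothesis hV : 64 * 128 * (8 * l + L + 1) <= V%:R <= 64 * 128 * (8 * l + L + 1) + 1.
Hypothesis hm : 32 * (L + 1) <= m%:R <= 32 * (L + 1) + 1.
Hypothesis hN0 : forall t, (0 < Nf t)%N.
Hypothesis hN : forall t, 128 * 128 * t%:R <= (Nf t)%:R * eps ^+ 2.
Hypothesis hN_le : forall t, (Nf t)%:R <= 128 * 128 * t%:R / eps ^+ 2 + 2.
Hypothesis hM : forall s, (1 <= s)%N -> s%:R * (8 * l) <= (Mh s)%:R * eps ^+ 2 / (64 * 512).
Hypothesis hM_le : forall s, (Mh s)%:R <= 64 * 512 * (8 * l) / eps ^+ 2 * s%:R + 1.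

Lemma fine_err_V : fine_err V * n%:R ^+ 8 <= g / 2 :> R.
Proof.
have n0 : 0 < n%:R ^+ 8 :> R by have := pow_n8_ge; lra.
rewrite -ler_pdivlMr // /fine_err.
apply: (@le_trans _ _ (expR (- (8 * l) + - L + - 1))).
  by rewrite ler_expR; case/andP: hV => hV1 _; lra.
rewrite !expRD exp_8ln exp_ln_g.
have h : 0 <= (n%:R ^+ 8)^-1 * g :> R by rewrite mulr_ge0 ?invr_ge0 ?(ltW n0) ?(ltW par_g_gt0).
by have := ler_wpM2l h expN1_le_half; lra.
Qed.

Lemma emp_err_V : emp_err n V <= 4 * n%:R * fine_err V :> R.
Proof.
rewrite /emp_err; apply: ler_wpM2r; first exact: expR_ge0.
by rewrite -addn2 natrD; have := par_n_ge2; lra.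
Qed.

Lemma pow_n8_linear : 128 * n%:R <= n%:R ^+ 8 :> R.
Proof.
rewrite exprSr; apply: ler_wpM2r => //.
by apply: (le_trans _ (pow2_le_pow 7)); rewrite -natrX ler_nat.
Qed.

Lemma pow_n8_quartic : 16 * (n%:R ^+ 2 * n%:R ^+ 2) <= n%:R ^+ 8 :> R.
Proof.
rewrite -exprD (exprD _ 4 4); apply: ler_wpM2r; first exact: exprn_ge0.
by apply: (le_trans _ (pow2_le_pow 4)); rewrite -natrX ler_nat.
Qed.

(** Here [sched_err <= 13 n^2 * fine_err V], so a total of [n^4] has to be beaten; the power [n^8]
    in [fine_err_V] also swallows the constant. *)
Lemma sched_err_V : n%:R ^+ 2 * sched_err n V <= g / 2 :> R.
Proof.
have E0 : 0 <= fine_err V :> R by exact: expR_ge0.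
have h1 := emp_err_V; have h2 := fine_err_V.
have h3 : expR (- V%:R) <= fine_err V :> R.
  by rewrite ler_expR; have := ler0n R V; lra.
have n1 : 1 <= n%:R :> R by have := par_n_ge2; lra.
set E : R := fine_err V in E0 h1 h2 h3.
set e : R := emp_err n V in h1.
have h4 : sched_err n V <= 13 * n%:R ^+ 2 * E :> R.
  rewrite /sched_err /point_err -/e.
  have k1 : n%:R * (2 * e + expR (- V%:R)) <= n%:R * (9 * n%:R * E).
    apply: ler_wpM2l => //; have : 1 * E <= n%:R * E by apply: ler_wpM2r.
    lra.
  have k2 : n%:R * E <= n%:R ^+ 2 * E.
    by apply: ler_wpM2r => //; rewrite expr2; apply: ler_peMl.
  lra.
apply: (le_trans _ h2); apply: (le_trans (ler_wpM2l (sqr_ge0 n%:R) h4)).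
have h5 := ler_wpM2r E0 pow_n8_quartic; have h6 : 0 <= n%:R ^+ 2 * n%:R ^+ 2 * E.
  by rewrite !mulr_ge0 ?sqr_ge0.
by move: h5 h6; move: (n%:R ^+ 8) (n%:R ^+ 2) => u w; lra.
Qed.

(** As [2^d <= e^d], the fine search errs with probability at most [e^(-5) <= 1/32], and
    [3/32 + 1/32 + 1/8 = 1/4]. *)
Lemma par_small : 3/32 + (2 ^ d)%:R * fine_err r + emp_err n V <= 1/4 :> R.
Proof.
have h1 : (2 ^ d)%:R * fine_err r <= 1/32 :> R.
  apply: (@le_trans _ _ (expR d%:R * expR (- (d%:R + 5)))).
    apply: ler_pM => //; rewrite ?expR_ge0 //; first exact: pow_le_exp.
    by rewrite ler_expR hr; lra.
  rewrite -expRD (_ : d%:R + - (d%:R + 5) = - 5%:R); last by ring.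
  by apply: (le_trans (expRN_half _)); lra.
have h2 : emp_err n V <= 1/8 :> R.
  apply: (le_trans emp_err_V); have := fine_err_V.
  have E0 : 0 <= fine_err V :> R by exact: expR_ge0.
  set E : R := fine_err _ in E0 * => h.
  have := ler_wpM2r E0 pow_n8_linear; move: h; case/andP: hg => _; move: (n%:R ^+ 8) => u; lra.
lra.
Qed.

Lemma par_hB : n.+1%:R * (2 * expR (- (8 * l))) <= 1/8 :> R.
Proof.
rewrite exp_8ln.
have n0 : 0 < n%:R ^+ 8 :> R by have := pow_n8_ge; lra.
rewrite mulrA ler_pdivrMr //.
by move: pow_n8_linear; rewrite -natr1; move: (n%:R ^+ 8) => u; have := par_n_ge2; lra.
Qed.

Lemma par_m_exp : expR (- (m%:R / 32)) <= g / 2.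
Proof.
apply: (@le_trans _ _ (expR (- L + - 1))).
  by rewrite ler_expR; case/andP: hm => hm1 _; lra.
rewrite expRD exp_ln_g; have := ler_wpM2l (ltW par_g_gt0) expN1_le_half; lra.
Qed.

Definition main_prog : prog R ('I_n.+1 -> R) :=
  full n bmin bmax fuel d r V m Nf Mh.

Variable c : nat -> R.
Hypothesis pos : positive_counts n c.
Hypothesis lc : log_concave n c.
Hypothesis hmin : bmin <= ln (c 0%N / c 1%N).
Hypothesis hmax : ln (c n.-1 / c n) <= bmax.

Local Notation law := (law bmin bmax c (n:=n)).
Local Notation G := (Gamma c bmax).

Lemma main_fail : fail law main_prog
  (fun est => forall x : 'I_n.+1, is_estimate eps (est x) (gibbs c bmin x)) <= g.
Proof.
have B0 : 0 < (8 * l) by have := par_ln_ge; lra.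
have h := full_fail (V := V) m bb pos lc n2 hmin hmax hV0 hfuel hd
  par_small heps B0 par_hB hM hN0 hN.
apply: (le_trans h); have h1 := par_m_exp; have h2 := sched_err_V.
have h3 : sched_err n V <= n%:R ^+ 2 * sched_err n V :> R.
  apply: ler_peMl.
    rewrite /sched_err addr_ge0 ?emp_err_ge0 // mulr_ge0 // addr_ge0 ?expR_ge0 //.
    by rewrite mulr_ge0 // emp_err_ge0.
  by rewrite exprn_ege1 //; have := par_n_ge2; lra.
lra.
Qed.

Lemma par_Gamma_ge1 : 1 <= G.
Proof. exact: Gamma_ge1. Qed.

Lemma par_lnGamma_ge0 : 0 <= ln G.
Proof. exact: ln_ge0 par_Gamma_ge1. Qed.

(** Covers one attempt and its [V] samples. The main part is [d r <= (40 l) (64 * 128 * 50 l)],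
    hence a factor slightly above 2000. *)
Definition search_cost : R := 64 * 128 * 2100 * (ln G + l ^+ 2 + L).

Lemma par_ln2_ge : 1/4 <= l ^+ 2.
Proof. by have := par_ln_ge; nra. Qed.

Lemma par_ln_le_sqr : l <= 2 * l ^+ 2.
Proof. by have := par_ln_ge; nra. Qed.

Lemma attempt_cost_le k : (1 <= k)%N -> (k <= n)%N ->
  cost law (attempt n bmin bmax k fuel d r) <= search_cost - V%:R.
Proof.
move=> k1 kn; have G1 := par_Gamma_ge1.
have G3 : 1 <= 2 * G + 1 by lra.
have [J [hJ hJ1]] := pow2_above G3.
have hat := @attempt_cost R n bmin bmax c pos lc n2 k k1 kn fuel d r J hJ.
apply: (le_trans hat).
have h3 : ln 3 <= 2 :> R.
  by rewrite -ler_expR lnK ?posrE //; have := expR_ge1Dx (2 : R); lra.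
have hJu : J%:R <= 2 * ln G + 5.
  have : ln (2 * G + 1) <= ln (3 * G) by rewrite ler_ln ?posrE; lra.
  rewrite lnM ?posrE //; last by lra.
  lra.
have /andP[_ hV2] := hV.
have hdr : d%:R * r%:R <= 64 * 128 * 2000 * l ^+ 2 :> R.
  rewrite hr.
  have hl := par_ln_ge.
  have h5 : d%:R + 5 <= 50 * l :> R.
    by move: hd_le hl; move: (d%:R : R) (ln n%:R) => x y; lra.
  have := ler_pM (ler0n _ _) (_ : 0 <= d%:R + 5 :> R) hd_le h5.
  have : 0 <= d%:R + 5 :> R by rewrite addr_ge0.
  rewrite expr2 => h6 /(_ h6); lra.
rewrite /search_cost; have := par_ln2_ge; have := par_ln_le_sqr; have := par_lnGamma_ge0; have := par_lng_ge; lra.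
Qed.

Definition total_cost (T : R) : R :=
  64 * 128 * 2100 * 5 * ((ln G + l ^+ 2 + L) * T + L * (T ^+ 2 + n%:R * l) / eps ^+ 2).

Lemma main_cost_bound (T : R) : 1 <= T ->
  (forall zl, good_schedule n bmin bmax c zl -> increasing n zl.1 zl.2 -> (zl.1 <= n)%N ->
     (size zl.2)%:R <= T) ->
  cost law main_prog <= total_cost T.
Proof.
move=> T1 hT.
have B0 : 0 < (8 * l) by have := par_ln_ge; lra.
have a0 : 0 <= 64 * 512 * (8 * l) / eps ^+ 2.
  by apply: divr_ge0; [lra | exact: ltW par_eps2_gt0].
have T0 : 0 <= T by lra.
have hbad : n%:R ^+ 2 * sched_err n V <= 1 :> R.
  by apply: (le_trans sched_err_V); case/andP: hg; lra.
have H := full_cost m bb pos lc n2 hmax hV0 hfuel hd par_small heps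
  a0 T0 hM_le hN_le attempt_cost_le hT hbad.
apply: (le_trans H); rewrite subrK /total_cost.
have /andP[_ hV2] := hV; have /andP[_ hm2] := hm.
have hl := par_ln_ge; have hL := par_lng_ge; have hG := par_lnGamma_ge0.
have hl1 := par_ln2_ge; have hl2 := par_ln_le_sqr.
have hVS : V%:R <= search_cost by rewrite /search_cost; lra.
have X0 : 0 <= ln G + l ^+ 2 + L by lra.
have m98 : (0 <= m%:R :> R) && (m%:R <= 98 * L :> R).
  by apply/andP; split; [exact: ler0n | lra].
have E := cost_arith T1 par_n_ge2 par_eps2_inv_ge1 hl hL X0 m98 hVS.
by rewrite [n.+1%:R]mulrSr; exact: E.
Qed.

End MainProgram.

(** * Costs *)

Section Final.
Context {R : realType}.

(** Case [T = n]: the search term [n (ln n)^2] is absorbed because [(ln n)^2 <= 4 n]. *)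
Lemma integer_arith (N W l L h : R) : 2 <= N -> 1 <= W -> 1/2 <= l -> 1/2 <= L -> 0 <= h ->
  l <= N -> l ^+ 2 <= 4 * N ->
  (h + l ^+ 2 + L) * N + L * (N ^+ 2 + N * l) * W <= 11 * (N ^+ 2 * L * W + N * h).
Proof.
move=> N2 W1 l1 L1 h0 lN l2.
have N0 : 0 <= N by lra.
have a1 : l ^+ 2 * N <= 4 * N ^+ 2 by have := ler_wpM2r N0 l2; lra.
have LW : 1/2 <= L * W by have := ler_peMr (_ : 0 <= L) W1; lra.
have NN : 0 <= N ^+ 2 by exact: sqr_ge0.
have a2 : 4 * N ^+ 2 <= 8 * (N ^+ 2 * (L * W)) by have := ler_wpM2l NN LW; lra.
have a3 : L * N <= N ^+ 2 * (L * W).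
  apply: (@le_trans _ _ (L * W * N)).
    by apply: ler_wpM2r => //; apply: ler_peMr; lra.
  rewrite mulrC; apply: ler_wpM2r; first lra.
  by rewrite expr2; apply: ler_peMl; lra.
have a4 : L * (N * l) * W <= N ^+ 2 * (L * W).
  have := ler_wpM2l N0 lN => a5.
  have : (L * W) * (N * l) <= (L * W) * (N * N) by apply: ler_wpM2l => //; lra.
  lra.
have a6 : 0 <= N * h by rewrite mulr_ge0.
move: a1 a2 a3 a4; move: (N ^+ 2) => Q a1 a2 a3 a4; lra.
Qed.

(** Case [T = 34 S] with [S = sqrt (n Gamma)]: [ln n] and [ln Gamma] are at most [2 S], so the
    search terms, linear in [S], are absorbed by [S^2 = n Gamma]. *)
Lemma continuous_arith (N G W l L h S : R) : 2 <= N -> 1 <= W -> 1/2 <= l -> 1/2 <= L ->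
  0 <= h -> 1 <= G -> 1 <= S -> S ^+ 2 = N * G -> h <= 2 * S -> l <= 2 * S ->
  (h + l ^+ 2 + L) * (34 * S) + L * ((34 * S) ^+ 2 + N * l) * W <=
  3000 * (N * G * l * L * W).
Proof.
move=> N2 W1 l1 L1 h0 G1 S1 hS hh hl.
have S0 : 0 <= S by lra.
have NS : N <= S ^+ 2 by rewrite hS; apply: ler_peMr; lra.
have SS : S <= S ^+ 2 by rewrite expr2; apply: ler_peMl.
have LW : L <= L * W by apply: ler_peMr; lra.
have lL : 1/4 <= l * L by have := ler_pM (_ : 0 <= 1/2) (_ : 0 <= 1/2) l1 L1; lra.
have lLW : l * L <= l * L * W by apply: ler_peMr => //; lra.
have LlL : L <= 2 * (l * L) by have := ler_wpM2r (_ : 0 <= L) l1; lra.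
rewrite -hS; set Q := S ^+ 2 in NS SS *.
have Q0 : 0 <= Q by lra.
set P := Q * l * L * W.
have b0 : Q * (1/4) <= P.
  have c1 : Q * (1/4) <= Q * (l * L * W) by apply: ler_wpM2l => //; lra.
  by rewrite /P; lra.
have b1 : h * S <= 2 * Q by have := ler_wpM2r S0 hh; rewrite /Q expr2; lra.
have b2 : l ^+ 2 * S <= 4 * P.
  have c1 : l ^+ 2 * S <= l * (2 * Q).
    have := ler_wpM2l (_ : 0 <= l * S) hl; rewrite /Q !expr2 => c.
    by have := c ltac:(apply: mulr_ge0; lra); lra.
  have c2 : Q * l * (1/2) <= Q * l * (L * W).
    by apply: ler_wpM2l; [apply: mulr_ge0; lra | lra].
  rewrite /P; lra.
have b3 : L * S <= 2 * P.
  have c1 : L * S <= L * Q by apply: ler_wpM2l => //; lra.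
  have c2 : Q * L <= Q * (2 * (l * L * W)) by apply: ler_wpM2l => //; lra.
  rewrite /P; lra.
have b4 : L * W * Q <= 2 * P.
  have c1 : (L * W) * Q * (1/2) <= (L * W) * Q * l.
    by apply: ler_wpM2l => //; rewrite mulr_ge0 //; lra.
  rewrite /P; lra.
have b5 : L * (N * l) * W <= P.
  have c1 : (l * L * W) * N <= (l * L * W) * Q by apply: ler_wpM2l => //; lra.
  rewrite /P; lra.
have -> : (34 * S) ^+ 2 = 1156 * Q by rewrite /Q; ring.
move: b0 b1 b2 b3 b4 b5; clearbody P Q; lra.
Qed.

Lemma ln_le_2sqrt (x s : R) : 1 <= s -> 1 <= x -> x <= s ^+ 2 -> ln x <= 2 * s.
Proof.
move=> s1 x1 xs; apply: (le_trans _ (ln_sqr_le s1)).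
by rewrite ler_ln ?posrE //; [lra | rewrite exprn_gt0 //; lra].
Qed.

Definition cost_const : R := 64 * 128 * 2100 * 5 * 3000.

Lemma total_cost_integer n (bmax eps g : R) (c : nat -> R) : (2 <= n)%N -> 0 < eps < 1 ->
  0 < g <= 1/2 ->
  total_cost n bmax eps g c n%:R <= cost_const *
    (n%:R ^+ 2 * ln (1 / g) / eps ^+ 2 + n%:R * ln (Gamma c bmax)).
Proof.
move=> n2 heps hg.
have hN := @par_n_ge2 R n n2; have hW := par_eps2_inv_ge1 heps.
have hl := @par_ln_ge R n n2; have hL := par_lng_ge hg.
have hh : 0 <= ln (Gamma c bmax) by exact: ln_ge0 (Gamma_ge1 c bmax).
have s1 : 1 <= Num.sqrt (n%:R : R) by rewrite -[X in X <= _]sqrtr1 ler_sqrt; lra.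
have sE : Num.sqrt (n%:R : R) ^+ 2 = n%:R by rewrite sqr_sqrtr.
have hl2 : ln n%:R <= 2 * Num.sqrt n%:R :> R by apply: ln_le_2sqrt; rewrite ?sE //; lra.
have hq : ln n%:R ^+ 2 <= 4 * n%:R :> R.
  rewrite -sE (_ : 4 * _ = (2 * Num.sqrt n%:R) ^+ 2); last by ring.
  by rewrite sE; apply: lerXn2r; rewrite ?nnegrE //; lra.
have hlN : ln n%:R <= n%:R :> R.
  have := @le_ln1Dx R (n%:R - 1); rewrite [1 + _]addrC subrK => h.
  by have := h ltac:(lra); lra.
have H := integer_arith hN hW hl hL hh hlN hq.
rewrite /total_cost /cost_const.
have B0 : 0 <= n%:R ^+ 2 * ln (1 / g) * (eps ^+ 2)^-1 + n%:R * ln (Gamma c bmax).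
  by rewrite addr_ge0 ?mulr_ge0 ?sqr_ge0 //; lra.
move: H B0; set X := (_ + _ : R) => H; set Y := (_ + _ : R) in H * => B0; lra.
Qed.

Lemma total_cost_continuous n (bmax eps g S : R) (c : nat -> R) : (2 <= n)%N ->
  0 < eps < 1 -> 0 < g <= 1/2 -> 1 <= S -> S ^+ 2 = n%:R * Gamma c bmax ->
  total_cost n bmax eps g c (34 * S) <= cost_const *
    (n%:R * Gamma c bmax * ln n%:R * ln (1 / g) / eps ^+ 2).
Proof.
move=> n2 heps hg S1 hS.
have hN := @par_n_ge2 R n n2; have hW := par_eps2_inv_ge1 heps.
have hl := @par_ln_ge R n n2; have hL := par_lng_ge hg.
have hG := Gamma_ge1 c bmax.
have hh : 0 <= ln (Gamma c bmax) by exact: ln_ge0 hG.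
have NS : n%:R <= S ^+ 2 :> R by rewrite hS; apply: ler_peMr; lra.
have GS : Gamma c bmax <= S ^+ 2 by rewrite hS; apply: ler_peMl; lra.
have hlS : ln n%:R <= 2 * S by apply: ln_le_2sqrt => //; lra.
have hhS : ln (Gamma c bmax) <= 2 * S by exact: ln_le_2sqrt.
have H := continuous_arith hN hW hl hL hh hG S1 hS hhS hlS.
rewrite /total_cost /cost_const.
by move: H; set X := (_ + _ : R); set Y := (_ * (eps ^+ 2)^-1 : R) => H; lra.
Qed.

(* For [gamma > 1/2] the budget is proportional to [ln (1 / gamma)], which may
   be tiny, so the algorithm with failure probability [1/2] is run only with
   probability [2 (1 - gamma)]. *)
Lemma amplify (q gamma g a b K cost : R) : 0 < gamma < 1 -> 0 <= a -> 0 <= b -> 0 <= K ->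
  q = Num.min 1 (2 * (1 - gamma)) -> g = Num.min gamma (1/2) ->
  cost <= K * (a * ln (1 / g) + b) ->
  q * cost <= 2 * K * (a * ln (1 / gamma) + b).
Proof.
move=> /andP[g0 g1] a0 b0 K0 -> -> hc.
have Lge : 1 - gamma <= ln (1 / gamma).
  rewrite div1r lnV ?posrE //; have := @le_ln1Dx R (gamma - 1).
  by rewrite [1 + _]addrC subrK => h; have := h ltac:(lra); lra.
have Ka : 0 <= K * a by rewrite mulr_ge0.
have Kb : 0 <= K * b by rewrite mulr_ge0.
have [hg|hg] := leP gamma (1/2).
  rewrite min_l ?[1 * cost]mul1r; last lra.
  rewrite min_l // in hc; apply: (le_trans hc).
  have : 0 <= K * a * ln (1 / gamma) by rewrite mulr_ge0 //; lra.
  lra.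
rewrite min_r; last lra.
rewrite min_r in hc; last lra.
have l2 : ln (1 / (1/2)) <= 1 :> R.
  by rewrite (_ : 1 / (1/2) = 2); [exact: ln2_le | field].
have hc' : cost <= K * (a + b).
  by apply: (le_trans hc); have := ler_wpM2l Ka l2; lra.
have q0 : 0 <= 2 * (1 - gamma) by lra.
have h1 := ler_wpM2l q0 hc'.
have h2 := ler_wpM2l Ka Lge.
have h3 : 2 * (1 - gamma) * (K * b) <= K * b by apply: ler_piMl => //; lra.
lra.
Qed.

Lemma amplify_prob (q gamma g : R) : 0 < gamma < 1 ->
  q = Num.min 1 (2 * (1 - gamma)) -> g = Num.min gamma (1/2) ->
  1 - gamma <= q * (1 - g).
Proof.
move=> /andP[g0 g1] -> ->; have [hg|hg] := leP gamma (1/2).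
  by rewrite min_l ?mul1r //; lra.
by rewrite min_r; lra.
Qed.

Lemma program_exists n (bmin bmax eps g : R) : (2 <= n)%N -> bmin <= bmax ->
  0 < eps < 1 -> 0 < g <= 1/2 ->
  exists p : prog R ('I_n.+1 -> R), forall c : nat -> R,
    positive_counts n c -> log_concave n c ->
    bmin <= ln (c 0%N / c 1%N) -> ln (c n.-1 / c n) <= bmax ->
    [/\ fail (law bmin bmax c (n:=n)) p
          (fun est => forall x : 'I_n.+1, is_estimate eps (est x) (gibbs c bmin x)) <= g,
        cost (law bmin bmax c (n:=n)) p <= cost_const *
          (n%:R ^+ 2 * ln (1 / g) / eps ^+ 2 + n%:R * ln (Gamma c bmax)) &
        cost (law bmin bmax c (n:=n)) p <= cost_const *
          (n%:R * Gamma c bmax * ln n%:R * ln (1 / g) / eps ^+ 2)].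
Proof.
move=> n2 bb heps hg.
have hN := @par_n_ge2 R n n2.
have hl := @par_ln_ge R n n2; have hL := par_lng_ge hg.
have e2 : 0 < eps ^+ 2 := par_eps2_gt0 heps.
have n512 : 1 <= 512 * n%:R :> R by lra.
have [d [hd1 hd2]] := pow2_above n512.
have hd : (512 * n <= 2 ^ d)%N by rewrite -(ler_nat R) natrM.
have hd_le : d%:R <= 40 * ln n%:R :> R.
  apply: (le_trans hd2); rewrite lnM ?posrE; [|lra..].
  have h512 : ln 512 <= 9 :> R.
    by rewrite -ler_expR lnK ?posrE ?ltr0n; first by apply: (le_trans _ (pow_le_exp 9)); rewrite ler_nat.
  lra.
have [r hr] : exists r : nat, r%:R = 64 * 128 * (d%:R + 5) :> R.
  by exists (64 * 128 * (d + 5))%N; rewrite !natrM natrD.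
have [V [hV0 hV]] := @nat_above R (64 * 128 * (8 * ln n%:R + ln (1 / g) + 1)) ltac:(lra).
have [m [_ hm]] := @nat_above R (32 * (ln (1 / g) + 1)) ltac:(lra).
(* The fuel comes from the interval, known before [c], whereas the cost of the doubling is governed
   by [Gamma]. *)
have [f0 [_ /andP[hf0 _]]] := @nat_above R (bmax - bmin) ltac:(by rewrite subr_ge0).
have hfuel : bmax - (2 ^ f0)%:R <= bmin.
  have : (f0%:R : R) <= (2 ^ f0)%:R by rewrite ler_nat ltnW // ltn_expl.
  lra.
have [Nf hNf] : exists Nf : nat -> nat, forall t, (0 < Nf t)%N /\
    128 * 128 * t%:R / eps ^+ 2 <= (Nf t)%:R <= 128 * 128 * t%:R / eps ^+ 2 + 1.
  exists (fun t => up (128 * 128 * t%:R / eps ^+ 2)) => t; split=> //.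
  have h : 0 <= 128 * 128 * t%:R / eps ^+ 2.
    by apply: divr_ge0; [have := ler0n R t; lra | exact: ltW].
  by rewrite up_ge // up_le.
have [Mh hMh] : exists Mh : nat -> nat, forall s,
    64 * 512 * (8 * ln n%:R) / eps ^+ 2 * s%:R <= (Mh s)%:R <=
    64 * 512 * (8 * ln n%:R) / eps ^+ 2 * s%:R + 1.
  exists (fun s => up (64 * 512 * (8 * ln n%:R) / eps ^+ 2 * s%:R)) => s.
  have h : 0 <= 64 * 512 * (8 * ln n%:R) / eps ^+ 2 * s%:R.
    by apply: mulr_ge0; [apply: divr_ge0; [lra | exact: ltW] | exact: ler0n].
  by rewrite up_ge // up_le.
have hN0 t : (0 < Nf t)%N by case: (hNf t).
have hN1 t : 128 * 128 * t%:R <= (Nf t)%:R * eps ^+ 2.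
  by rewrite -ler_pdivrMr //; case: (hNf t) => _ /andP[].
have hN2 t : (Nf t)%:R <= 128 * 128 * t%:R / eps ^+ 2 + 2.
  by case: (hNf t) => _ /andP[_ h]; apply: (le_trans h); rewrite lerD2l ler1n.
have hM1 s : (1 <= s)%N -> s%:R * (8 * ln n%:R) <= (Mh s)%:R * eps ^+ 2 / (64 * 512).
  move=> _; case/andP: (hMh s) => h _; rewrite ler_pdivlMr; last lra.
  by rewrite -ler_pdivrMr //; lra.
have hM2 s : (Mh s)%:R <= 64 * 512 * (8 * ln n%:R) / eps ^+ 2 * s%:R + 1.
  by case/andP: (hMh s).
exists (main_prog n bmin bmax f0 d r V m Nf Mh) => c pos lc hmin hmax.
have bound := @main_cost_bound R n bmin bmax eps g n2 bb heps hg f0 d r V m Nf Mh hfuel hd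
  hd_le hr hV0 hV hm hN2 hM2 c pos lc hmax.
split.
- exact: (main_fail n2 bb heps hg hfuel hd hr hV0 hV hm hN0 hN1 hM1 pos lc hmin hmax).
- apply: (le_trans _ (total_cost_integer bmax c n2 heps hg)); apply: bound; first lra.
  move=> zl _ hi hz; rewrite ler_nat; have := increasing_size hz hi.
  by apply: leq_trans; exact: leq_addr.
have G1 := Gamma_ge1 c bmax.
have NG : 1 <= n%:R * Gamma c bmax.
  by apply: (le_trans G1); apply: ler_peMl; lra.
have S1 : 1 <= Num.sqrt (n%:R * Gamma c bmax).
  by rewrite -[X in X <= _]sqrtr1 ler_sqrt; lra.
have SE : Num.sqrt (n%:R * Gamma c bmax) ^+ 2 = n%:R * Gamma c bmax.
  by rewrite sqr_sqrtr; lra.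
apply: (le_trans _ (total_cost_continuous n2 heps hg S1 SE)); apply: bound; first lra.
move=> zl hgood _ _; apply: (good_schedule_size pos lc n2 hgood) => //; lra.
Qed.

End Final.

Unset Implicit Arguments.
Set Strict Implicit.

Theorem theorem51 (R : realType) :
  (exists2 C : R, 0 < C &
    forall (n : nat) (bmin bmax : R) (c : nat -> R),
      (2 <= n)%N ->
      positive_counts n c -> log_concave n c ->
      bmin <= ln (c 0%N / c 1%N) -> ln (c n.-1 / c n) <= bmax ->
      log_ratio n c bmin bmax <= C * (n%:R * Gamma c bmax))
  /\
  (exists2 C : R, 0 < C &
    forall (n : nat) (bmin bmax eps gamma : R),
      (2 <= n)%N -> 0 < eps < 1 -> 0 < gamma < 1 ->
      exists2 A : algorithm R n.+1 ('I_n.+1 -> R), legal A bmin bmax &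
        forall c : nat -> R,
          positive_counts n c -> log_concave n c ->
          bmin <= ln (c 0%N / c 1%N) -> ln (c n.-1 / c n) <= bmax ->
          ((1 - gamma)%:E <=
             output_prob A (gibbs c)
               (fun est => forall x : 'I_n.+1,
                  is_estimate eps (est x) (gibbs c bmin x)))%E
          /\
          (expected_calls A (gibbs c) <=
             (C * Num.min
                (n%:R * Gamma c bmax * ln n%:R * ln (1 / gamma) / eps ^+ 2)
                (n%:R ^+ 2 * ln (1 / gamma) / eps ^+ 2
                 + n%:R * ln (Gamma c bmax)))%:E)%E).
Proof.
split.
  exists 3 => // n bmin bmax c n2 pos lc hmin hmax; exact: log_ratio_le.
have K0 : 0 < cost_const :> R by rewrite /cost_const; lra.
exists (2 * cost_const); first lra.
move=> n bmin bmax eps gamma n2 heps hgamma.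
have [bb|bb] := leP bmin bmax; last first.
  (* For [bmin > bmax] no log-concave counts meet both endpoint conditions, so an algorithm that
     stops at once will do. *)
  exists (Algorithm tt (fun _ => Stop (fun _ => 0))) => // c pos lc hmin hmax.
  by have := bmin_le_bmax pos lc n2 hmin hmax; rewrite leNgt bb.
pose q : R := Num.min 1 (2 * (1 - gamma)); pose g : R := Num.min gamma (1/2).
have /andP[g0 g1] := hgamma.
have hg : 0 < g <= 1/2.
  by rewrite /g lt_min g0 ge_min lexx orbT andbT /=; lra.
have q01 : 0 <= q <= 1.
  by rewrite /q le_min ler01 ge_min lexx /= andbT; lra.
have [p hp] := program_exists n2 bb heps hg.
exists (run_alg n.+1 (clip bmin bmax) q (fun _ => 0) p).
  by apply: run_legal => // b; exact: clip_range.
move=> c pos lc hmin hmax; have [hf hc1 hc2] := hp c pos lc hmin hmax.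
have mu0 := gibbs_ge0 pos; have mu1 := gibbs_sum pos.
have e2 : 0 <= (eps ^+ 2)^-1 by rewrite invr_ge0 sqr_ge0.
have lG : 0 <= ln (Gamma c bmax) by exact: ln_ge0 (Gamma_ge1 c bmax).
have ln0 : 0 <= ln n%:R :> R by have := @par_ln_ge R n n2; lra.
have G0 : 0 <= Gamma c bmax by have := Gamma_ge1 c bmax; lra.
split.
  apply: (@le_trans _ _ (q * (1 - g))%:E); first by rewrite lee_fin; exact: amplify_prob.
  exact: (run_prob _ mu0 mu1 q01 hf).
apply: (run_calls _ mu0 q01).
rewrite minr_pMr; last lra.
rewrite le_min; apply/andP; split.
  have := @amplify R q gamma g (n%:R * Gamma c bmax * ln n%:R * (eps ^+ 2)^-1) 0 cost_const
    _ hgamma _ (lexx 0) (ltW K0) erefl erefl.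
  rewrite !addr0 => H; rewrite (mulrAC _ (ln (1 / gamma))); apply: H.
    by rewrite !mulr_ge0.
  by rewrite (mulrAC _ (ln (1 / g))) in hc2.
have H := @amplify R q gamma g (n%:R ^+ 2 * (eps ^+ 2)^-1) (n%:R * ln (Gamma c bmax))
  cost_const _ hgamma _ _ (ltW K0) erefl erefl.
rewrite (mulrAC _ (ln (1 / gamma))); apply: H.
- by rewrite mulr_ge0 ?sqr_ge0.
- by rewrite mulr_ge0.
by rewrite (mulrAC _ (ln (1 / g))) in hc1.
Qed.
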